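(* Let $(Z_i)_{i\ge1}$ be as in the context, let $\theta>0$, and let $0\le a<n$. Then \[ d_W\big(\mathcal L(n^{-1}T_{a,n}),P_\theta\big)\le n^{-1}(1+\theta)^2+\min_{1\le m\le n}\varepsilon_1(n,a,m), \] where \[ \varepsilon_1(n,a,m):=\tfrac14\theta^* m\,D^1(T_{a,n})+\delta(m,\theta)+n^{-1}\theta^*\{5\theta^*\sigma^*_n+2m+a\}. \] Moreover, if the sequence $(Z_i)$ satisfies condition QLC (with this $\theta$), then $d_W(\mathcal L(n^{-1}T_{a_n,n}),P_\theta)\to0$ as $n\to\infty$ for every sequence of nonnegative integers $a_n=o(n)$; and if it satisfies condition QLC2 (with this $\theta$), then $d_W(\mathcal L(n^{-1}T_{a,n}),P_\theta)=O(\{(a+1)/n\}^{\eta_1})$ for some $\eta_1>0$.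
   Context: Let $(Z_i)_{i\ge1}$ be independent $\mathbb Z_+$-valued random variables, each of the form $Z_i=\sum_{j=1}^{r_i}Z_{ij}$ with $r_i\in\mathbb N$, where all the $Z_{ij}$ ($i\ge1$, $1\le j\le r_i$) are independent and, for each $i$, $Z_{i1},\dots,Z_{ir_i}$ are identically distributed. Set $\theta_i:=i\,\mathbb E Z_i$, $\varepsilon_{ik}:=\frac{ir_i}{\theta_i}P[Z_{i1}=k]-\mathbf 1\{k=1\}$ for $k\ge1$, and $\mu_i:=\sum_{k\ge1}k\sup_{j\ge i}|\varepsilon_{jk}|$, assumed finite. For $0\le a<n$, $T_{a,n}:=\sum_{i=a+1}^n iZ_i$. For $m\in\mathbb N$, $\delta(m,\theta):=\sup_{j\ge0}\big|\theta-\frac1m\sum_{i=1}^m\theta_{jm+i}\big|$. Put $\theta^*:=\max\{1,\theta,\sup_i\theta_i\}$ (assumed finite) and $\sigma^*_n:=\sum_{i=1}^n\max\{\mu_i,1/(ir_i)\}$. For a $\mathbb Z$-valued random variable $T$, $D^1(T):=d_{TV}(\mathcal L(T),\mathcal L(T+1))$. $d_W$ is the Wasserstein distance $\sup_f|\int f\,dP-\int f\,dQ|$ over $1$-Lipschitz $f$. $P_\theta$ is the Dickman distribution with parameter $\theta$: the distribution on $[0,\infty)$ with Laplace transform $\int e^{-sx}P_\theta(dx)=\exp\{-\theta\int_0^1(1-e^{-sx})x^{-1}dx\}$. Condition QLC: $\mu_i\to0$ as $i\to\infty$; $\delta(m,\theta)\to0$ as $m\to\infty$; and there exist coprime $r,s\in\mathbb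 N$, $k\in\mathbb N$ and $\psi>0$ such that, with $D:=\{r\}\cup\{s2^g:g\ge0\}$, $i_0:=\min\{i:\mu_i\le1/2\}$ and $E'(d,\psi):=\{i\ge i_0:\min(\theta_i,\theta_{i+d})\ge4\psi\}$, one has $E'(d,\psi)\cap\{jk+1,\dots,(j+1)k\}\ne\emptyset$ for all $d\in D$, $j\ge1$. Condition QLC2: the same, but with $\mu_i=O(i^{-\alpha})$ and $\delta(m,\theta)=O(m^{-\beta})$ for some $\alpha,\beta>0$. *)

(* Defs.v *)
From HB Require Import structures.
From mathcomp Require Import all_boot all_order all_algebra finmap.
From mathcomp Require Import all_classical all_reals all_analysis.
From mathcomp Require Import measurable_realfun.

Set Implicit Arguments.
Unset Strict Implicit.
Unset Printing Implicit Defensive.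

Import Order.TTheory GRing.Theory Num.Theory.
Import numFieldNormedType.Exports.

Local Open Scope classical_set_scope.
Local Open Scope ring_scope.

(** * Probability metrics, the Dickman distribution, independence *)

Definition dTV d (T : measurableType d) (R : realType)
    (mu nu : probability T R) : R :=
  sup [set `|fine (mu A) - fine (nu A)| | A in measurable].

(* The integrals of the (possibly unbounded) Lipschitz functions are finite
   when [mu] and [nu] have finite first moments. *)
Definition dW (R : realType) (mu nu : probability (measurableTypeR R) R) :
    \bar R :=
  ereal_sup [set `| \int[mu]_x (f x)%:E - \int[nu]_x (f x)%:E |%E
            | f in [set f : R -> R | (1 : R).-lipschitz f]].

Definition is_dickman (R : realType) (theta : R)
    (Q : probability (measurableTypeR R) R) : Prop :=
  Q `[0, +oo[%classic = 1%E /\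
  forall s : R, 0 <= s ->
    (\int[Q]_(x in `[0%R, +oo[) (expR (- (s * x)))%:E)%E =
    (expR (- (theta * \int[lebesgue_measure]_(x in `[0, 1])
                        ((1 - expR (- (s * x))) * x^-1))))%:E.

(* Only the subfamily of [X] indexed by [D] is required to be independent. *)
Definition mutually_independent d d' (T : measurableType d)
    (T' : measurableType d') (R : realType) (P : probability T R)
    (I : choiceType) (D : set I) (X : I -> {RV P >-> T'}) : Prop :=
  forall J : {fset I}, [set` J] `<=` D ->
  forall A : I -> set T', (forall i, measurable (A i)) ->
    P (\bigcap_(i in [set` J]) (X i @^-1` A i)) =
    (\prod_(i <- J) fine (P (X i @^-1` A i)))%:E.

(** * The random variables of the model *)

Section random_variables.
Context d (T : measurableType d) (R : realType) (P : probability T R).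
Variables (r : nat -> nat) (Z : nat -> nat -> {RV P >-> nat}).

(* Indices start at 1 as on paper: [Z i j] matters only for [1 <= i] and
   [1 <= j <= r i]. *)
Definition index_set : set (nat * nat) :=
  [set p | (1 <= p.1)%N && (1 <= p.2 <= r p.1)%N].

Definition Zsum (i : nat) : T -> nat :=
  fun w => (\sum_(1 <= j < (r i).+1) Z i j w)%N.

Definition Tsum (a n : nat) : T -> nat :=
  fun w => (\sum_(a.+1 <= i < n.+1) i * Zsum i w)%N.

Lemma measurable_sum_nat (F : nat -> T -> nat) (m n : nat) :
  (forall i, measurable_fun setT (F i)) ->
  measurable_fun setT (fun w => (\sum_(m <= i < n) F i w)%N).
Proof.
move=> mF; rewrite /index_iota; elim: (iota m (n - m)) => [|i s IHs].
  by under eq_fun do rewrite big_nil; exact: measurable_cst.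
by under eq_fun do rewrite big_cons; exact: measurable_fun_addn.
Qed.

Lemma measurable_Zsum i : measurable_fun setT (Zsum i).
Proof. by apply: measurable_sum_nat => j; exact: measurable_funPT. Qed.

HB.instance Definition _ i :=
  isMeasurableFun.Build _ _ _ _ (Zsum i) (measurable_Zsum i).

Lemma measurable_Tsum a n : measurable_fun setT (Tsum a n).
Proof.
apply: measurable_sum_nat => i.
have mul_i : measurable_fun [set: nat] (muln i) by [].
exact: (measurableT_comp mul_i (measurable_Zsum i)).
Qed.

HB.instance Definition _ a n :=
  isMeasurableFun.Build _ _ _ _ (Tsum a n) (measurable_Tsum a n).

Definition Tscaled (a n : nat) : T -> measurableTypeR R :=
  fun w => n%:R^-1 * (Tsum a n w)%:R.

Lemma measurable_Tscaled a n : measurable_fun setT (Tscaled a n).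
Proof.
have mg : measurable_fun [set: nat]
  (fun k => n%:R^-1 * k%:R : measurableTypeR R) by [].
exact: (measurableT_comp mg (measurable_Tsum a n)).
Qed.

HB.instance Definition _ a n :=
  isMeasurableFun.Build _ _ _ _ (Tscaled a n) (measurable_Tscaled a n).

End random_variables.

Section shift.
Context d (T : measurableType d) (X : {mfun T >-> nat}).

Definition shift1 : T -> nat := fun w => (X w).+1.

Lemma measurable_shift1 : measurable_fun setT shift1.
Proof.
have mS : measurable_fun [set: nat] succn by [].
exact: (measurableT_comp mS).
Qed.

HB.instance Definition _ :=
  isMeasurableFun.Build _ _ _ _ shift1 measurable_shift1.

End shift.

(* [X] is nat-valued here: the laws of [X] and [X + 1] live on the
   nonnegative integers, so their total variation distance there and on the
   integers is the same. *)
Definition D1 d (T : measurableType d) (R : realType) (P : probability T R)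
    (X : {mfun T >-> nat}) : R :=
  dTV (distribution P X) (distribution P (shift1 X)).

(** * Parameters of the sequence *)

Section parameters.
Context d (T : measurableType d) (R : realType) (P : probability T R).
Variables (r : nat -> nat) (Z : nat -> nat -> {RV P >-> nat}).

Definition theta_bar (i : nat) : \bar R :=
  (i%:R%:E * 'E_P[fun w => (Zsum r Z i w)%:R])%E.

Definition theta_ (i : nat) : R := fine (theta_bar i).

(* When [theta_ i = 0] the variable [Z i 1] vanishes almost surely and the
   quotient is [0 / 0]; the error term is then set to [0]. *)
Definition eps (i k : nat) : R :=
  if theta_ i == 0 then 0 else
  (i * r i)%N%:R / theta_ i * fine (P [set w | Z i 1%N w = k]) - (k == 1%N)%:R.

Definition mu (i : nat) : \bar R :=
  (\sum_(1 <= k <oo)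
     k%:R%:E * ereal_sup [set `|eps j k|%:E | j in [set j | (i <= j)%N]])%E.

Definition delta (m : nat) (theta : R) : R :=
  sup (range (fun j : nat =>
    `|theta - m%:R^-1 * \sum_(1 <= i < m.+1) theta_ (j * m + i)%N|)).

Definition theta_star (theta : R) : R :=
  Num.max 1 (Num.max theta (sup [set theta_ i | i in [set i | (1 <= i)%N]])).

Definition sigma_star (n : nat) : R :=
  \sum_(1 <= i < n.+1) Num.max (fine (mu i)) (i * r i)%N%:R^-1.

Definition eps1 (theta : R) (n a m : nat) : R :=
  4^-1 * theta_star theta * m%:R * D1 P (Tsum r Z a n)
  + delta m theta
  + n%:R^-1 * theta_star theta *
      (5 * theta_star theta * sigma_star n + 2 * m%:R + a%:R).

(* [i0] is the least positive index with [mu i0 <= 1/2]. *)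
Definition is_i0 (i0 : nat) : Prop :=
  [/\ (1 <= i0)%N, (mu i0 <= (2^-1)%:E)%E &
      forall i : nat, (1 <= i)%N -> (mu i <= (2^-1)%:E)%E -> (i0 <= i)%N].

Definition Eprime (i0 e : nat) (psi : R) : set nat :=
  [set i | (i0 <= i)%N /\ 4 * psi <= Num.min (theta_ i) (theta_ (i + e)%N)].

Definition scales (u v : nat) : set nat :=
  u |` range (fun g : nat => (v * 2 ^ g)%N).

(* The requirement common to QLC and QLC2. The coprime pair usually written
   [r, s] is [u, v] here, [r] being the sequence of numbers of summands. *)
Definition QLC_blocks : Prop :=
  exists (u v k : nat) (psi : R) (i0 : nat),
    [/\ [/\ (0 < u)%N, (0 < v)%N & coprime u v], (0 < k)%N, 0 < psi, is_i0 i0 &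
        forall e j : nat, scales u v e -> (1 <= j)%N ->
          Eprime i0 e psi `&` [set i | (j * k + 1 <= i <= j.+1 * k)%N] !=set0].

Definition QLC (theta : R) : Prop :=
  [/\ mu i @[i --> \oo] --> 0%E,
      delta m theta @[m --> \oo] --> 0 &
      QLC_blocks].

Definition QLC2 (theta : R) : Prop :=
  [/\ exists2 alpha : R, 0 < alpha &
        (fun i => fine (mu i)) =O_\oo (fun i => i%:R `^ (- alpha) : R^o),
      exists2 beta : R, 0 < beta &
        (fun m => delta m theta) =O_\oo (fun m => m%:R `^ (- beta) : R^o) &
      QLC_blocks].

End parameters.

(* Main.v *)
(* A Dickman variable X satisfies the size-biasing identity
   E[X g(X)] = theta E[g(X + U)], U uniform on [0, 1]; it is read off the
   derivative of the Laplace transform and extended to indicators of half-lines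
   by approximation with polynomials in exp(- x). For T = T_{a,n} the analogue
   E[T g(T)] ~ theta sum_{i <= n} E g(T + i) holds up to eps1: independence and
   the smallness of the mu_i give E[T g(T)] ~ sum_i theta_i E g(T + i), and
   theta_i is then averaged over blocks of length m, along which E g(T + i)
   varies slowly because of D^1(T). Both identities are tested on the solution g
   of the discrete Stein equation with right-hand side f(j / n), which is
   bounded by 1 / n when f is 1-Lipschitz.

   For the rates, T and T + 1 are coupled through pairs i, i + d of summands
   (Mineka). A difference 1 first performs a walk with steps u until it is a
   multiple of v; a difference v is then removed by steps v, 2v, 4v, ..., each of
   which hits 0 or doubles the difference. On each window ]L, 8L] a step takes
   place with probability bounded below, so that log(n / (a + 1)) windows give
   D^1(T) <= C ((a + 1) / n)^eta. *)

Require Import Defs.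
From HB Require Import structures.
From mathcomp Require Import all_boot all_order all_algebra finmap.
From mathcomp Require Import all_classical all_reals all_analysis.
From mathcomp Require Import measurable_realfun.
From mathcomp Require Import ring lra zify.

Set Implicit Arguments.
Unset Strict Implicit.
Unset Printing Implicit Defensive.

Import Order.TTheory GRing.Theory Num.Theory.
Import numFieldNormedType.Exports.

Local Open Scope classical_set_scope.
Local Open Scope ring_scope.

(** * Sums over blocks *)

(** Only the differences [u] and [v * 2 ^ g] can be used for pairing, and this shapes the coupling.
    A walk with the fixed step [v] hits 0 within N windows except with probability of order
    N^(-1/2), which after log n windows leaves only a power of log n; with doubled steps every
    window succeeds with probability bounded below, the tail is geometric in N, and a power of n
    results. The walk with steps [u] has a geometric tail too, since it moves on finitely many
    residues modulo [v], but it may drift away from 0; one potential is used for each effect. No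
    coupled pair is constructed: each step is an inequality between expectations.

    The Stein equation is solved on the integers by a geometric series, so the Dickman law is tested
    on step functions only. Hence half-lines suffice there, and rounding costs a term of order 1/n.
    The series is cut at [N]; the remainder has a Lipschitz constant decaying like (theta / (1 +
    theta))^N and disappears in the limit because both means are finite.

    The factor 1/4 rests on an extremal fact: the distances between a subset of m consecutive
    integers and its complement add up to at most m^3/8. *)

Section block_sums.
Context {R : realFieldType}.
Implicit Types (x t e : nat -> R) (m n : nat).

Definition dist_form m e f : R :=
  \sum_(0 <= i < m) \sum_(0 <= j < m) e i * f j * `|i%:R - j%:R|.

Definition lin_form m e : R := \sum_(0 <= i < m) e i * (m%:R - i%:R).

Lemma lin_form_recr m e :
  lin_form m.+1 e = lin_form m e + \sum_(0 <= i < m.+1) e i.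
Proof.
rewrite /lin_form big_nat_recr //= [X in _ = _ + X]big_nat_recr //=.
rewrite addrA -big_split /=; congr (_ + _); last by rewrite -natr1; ring.
by apply: eq_bigr => i _; rewrite -natr1; ring.
Qed.

Lemma dist_form_recr m e :
  dist_form m.+1 e e = dist_form m e e + 2 * e m * lin_form m e.
Proof.
rewrite /dist_form big_nat_recr //= [X in _ + X]big_nat_recr //=.
rewrite subrr normr0 mulr0 addr0.
have -> : \sum_(0 <= i < m) \sum_(0 <= j < m.+1) e i * e j * `|i%:R - j%:R| =
   dist_form m e e + e m * lin_form m e.
  rewrite /dist_form /lin_form mulr_sumr -big_split /=.
  apply: eq_big_nat => i /andP[_ im]; rewrite big_nat_recr //=; congr (_ + _).
  rewrite distrC ger0_norm ?subr_ge0 ?ler_nat 1?ltnW //; ring.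
have -> : \sum_(0 <= i < m) e m * e i * `|m%:R - i%:R| = e m * lin_form m e.
  rewrite /lin_form mulr_sumr; apply: eq_big_nat => i /andP[_ im].
  rewrite ger0_norm ?subr_ge0 ?ler_nat 1?ltnW //; ring.
by rewrite /dist_form; ring.
Qed.

(* Equality holds when [e] selects the last indices below [m]. *)
Lemma dist_form_indic m e (s := \sum_(0 <= i < m) e i) :
  (forall i, e i = 0 \/ e i = 1) ->
  s * (s + 1) / 2 <= lin_form m e /\ (s ^+ 3 - s) / 3 <= dist_form m e e.
Proof.
move=> e01; rewrite {}/s; elim: m => [|m [IHl IHd]].
  by rewrite /lin_form /dist_form !big_geq // !mul0r expr0n /= subr0 mul0r.
rewrite lin_form_recr dist_form_recr big_nat_recr //=.
have : 0 <= \sum_(0 <= i < m) e i.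
  by apply: sumr_ge0 => i _; case: (e01 i) => ->.
move: IHl IHd; move: (\sum_(0 <= i < m) e i) (lin_form m e) (dist_form m e e).
by move=> s l d IHl IHd s0; case: (e01 m) => ->; split; nra.
Qed.

Lemma dist_form1 m : dist_form m (fun=> 1) (fun=> 1) = (m%:R ^+ 3 - m%:R) / 3.
Proof.
have lin1 k : lin_form k (fun=> 1) = k%:R * (k%:R + 1) / 2.
  elim: k => [|k IH]; first by rewrite /lin_form big_geq // !mul0r.
  by rewrite lin_form_recr IH sumr_const_nat subn0 -natr1; field.
elim: m => [|m IH]; first by rewrite /dist_form big_geq // expr0n subr0 mul0r.
by rewrite dist_form_recr IH lin1 -natr1; field.
Qed.

(** The total (m^3 - m)/3 over all pairs splits into the pairs inside each class and twice the pairs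
    across. With s and m - s the class sizes, [dist_form_indic] bounds the inside parts from below,
    so the pairs across contribute at most m s (m - s)/2, which is at most m^3/8. *)
Lemma dist_form_cut m e : (forall i, e i = 0 \/ e i = 1) ->
  dist_form m e (fun i => 1 - e i) <= m%:R ^+ 3 / 8.
Proof.
move=> e01; pose e' i := 1 - e i.
have e'01 i : e' i = 0 \/ e' i = 1.
  by rewrite /e'; case: (e01 i) => ->; [right|left]; rewrite ?subr0 ?subrr.
have [_ He] := dist_form_indic m e01.
have [_ He'] := dist_form_indic m e'01.
have sE : \sum_(0 <= i < m) e' i = m%:R - \sum_(0 <= i < m) e i.
  by rewrite sumrB sumr_const_nat subn0.
have symE : dist_form m e' e = dist_form m e e'.
  rewrite /dist_form exchange_big /=; apply: eq_bigr => i _.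
  by apply: eq_bigr => j _; rewrite distrC; ring.
have decE : dist_form m (fun=> 1) (fun=> 1) =
    dist_form m e e + dist_form m e' e' + dist_form m e e' + dist_form m e' e.
  rewrite /dist_form -!big_split; apply: eq_bigr => i _.
  by rewrite -!big_split; apply: eq_bigr => j _; rewrite /e' /=; ring.
move: He He' decE; rewrite dist_form1 symE sE -/e'.
move: (\sum_(0 <= i < m) e i) (dist_form m e e) (dist_form m e' e') => s d d'.
have m0 : 0 <= m%:R :> R by [].
have : 0 <= m%:R * (m%:R - 2 * s) ^+ 2 by rewrite mulr_ge0 ?sqr_ge0.
move: m0; move: (m%:R : R) (dist_form m e e') => M c M0; nra.
Qed.

Lemma ler_dist_steps x (D : R) : (forall i, `|x i.+1 - x i| <= D) ->
  forall i j, `|x i - x j| <= D * `|i%:R - j%:R|.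
Proof.
move=> xD.
have D0 : 0 <= D by apply: le_trans (xD 0%N).
have H i k : `|x (i + k)%N - x i| <= D * k%:R.
  elim: k => [|k IH]; first by rewrite addn0 subrr normr0 mulr0.
  rewrite addnS -natr1 mulrDr mulr1.
  have -> : x (i + k).+1 - x i = (x (i + k).+1 - x (i + k)%N) + (x (i + k)%N - x i) by ring.
  by rewrite (le_trans (ler_normD _ _)) // addrC lerD.
move=> i j; wlog ij : i j / (i <= j)%N.
  move=> W; case: (leqP i j) => [/W //|/ltnW /W].
  by rewrite distrC [X in _ <= _ * X]distrC.
rewrite distrC [X in _ <= _ * X]distrC -(subnKC ij) (le_trans (H _ _)) //.
by rewrite natrD addrAC subrr add0r ger0_norm.
Qed.

(** Centring [t] amounts to centring [x]. The extremal [t] then takes only the values 0 and [B], and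
    the sum reduces to [dist_form] across the cut that it defines. *)
Lemma sum_mean_dev_le x t (B D : R) m :
  (forall i, `|x i.+1 - x i| <= D) ->
  (forall i, 0 <= t i <= B) -> (0 < m)%N ->
  \sum_(0 <= i < m) (t i - m%:R^-1 * \sum_(0 <= j < m) t j) * x i
    <= B * D * m%:R ^+ 2 / 8.
Proof.
move=> xD tB m0.
have B0 : 0 <= B by have /andP[/le_trans] := tB 0%N; apply.
have D0 : 0 <= D by apply: le_trans (xD 0%N).
have M0 : 0 < m%:R :> R by rewrite ltr0n.
pose xb := m%:R^-1 * \sum_(0 <= j < m) x j.
pose e i : R := (xb <= x i)%R%:R.
have e01 i : e i = 0 \/ e i = 1 by rewrite /e; case: (_ <= _); [right|left].
have -> : \sum_(0 <= i < m) (t i - m%:R^-1 * \sum_(0 <= j < m) t j) * x i =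
          \sum_(0 <= i < m) t i * (x i - xb).
  under eq_bigr do rewrite mulrBl.
  under [RHS]eq_bigr do rewrite mulrBr.
  rewrite !sumrB; congr (_ - _).
  by rewrite -mulr_sumr -mulr_suml /xb; ring.
(* The sum is linear in [t], hence largest when [t] equals [B] where [x]
   exceeds its mean and vanishes elsewhere. *)
have le1 : \sum_(0 <= i < m) t i * (x i - xb) <=
           \sum_(0 <= i < m) B * (e i * (x i - xb)).
  apply: ler_sum => i _; have /andP[t0 t1] := tB i; rewrite /e.
  case: (lerP xb (x i)) => h /=.
    by rewrite mul1r ler_wpM2r // subr_ge0.
  by rewrite mul0r mulr0 mulr_ge0_le0 // subr_le0 ltW.
apply: (le_trans le1); rewrite -mulr_sumr -!mulrA ler_wpM2l // {le1}.
have E : m%:R * \sum_(0 <= i < m) e i * (x i - xb) =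
   \sum_(0 <= i < m) \sum_(0 <= j < m) e i * (1 - e j) * (x i - x j).
  (* Pairs with both indices selected cancel by antisymmetry, so only pairs across the cut remain
     and the Lipschitz bound applies to them. *)
  have A0 : \sum_(0 <= i < m) \sum_(0 <= j < m) e i * e j * (x i - x j) = 0.
    set S := (LHS); suff : S = - S by lra.
    rewrite {1}/S exchange_big /= -sumrN; apply: eq_bigr => i _.
    by rewrite -sumrN; apply: eq_bigr => j _; ring.
  rewrite -[RHS]addr0 -[X in _ = _ + X]A0 -big_split mulr_sumr /=.
  apply: eq_bigr => i _; rewrite -big_split /=.
  under eq_bigr do rewrite -mulrDl -mulrDr subrK mulr1.
  rewrite -mulr_sumr sumrB sumr_const_nat subn0 /xb.
  by rewrite -[x i *+ m]mulr_natl; field; rewrite gt_eqF.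
have le2 : m%:R * \sum_(0 <= i < m) e i * (x i - xb) <= D * (m%:R ^+ 3 / 8).
  rewrite E; apply: le_trans (_ : D * dist_form m e (fun i => 1 - e i) <= _); last first.
    by rewrite ler_wpM2l // dist_form_cut.
  rewrite /dist_form mulr_sumr; apply: ler_sum => i _.
  rewrite mulr_sumr; apply: ler_sum => j _.
  have e0 : 0 <= e i * (1 - e j).
    by case: (e01 i) => ->; case: (e01 j) => ->; rewrite ?subrr ?subr0 ?mulr0 ?mulr1.
  rewrite mulrCA ler_wpM2l // (le_trans (ler_norm _)) //.
  exact: ler_dist_steps.
rewrite -(ler_pM2l M0) (le_trans le2) // le_eqVlt; apply/orP; left.
by apply/eqP; field.
Qed.

Lemma abs_sum_mean_dev_le x t (B D : R) m :
  (forall i, `|x i.+1 - x i| <= D) ->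
  (forall i, 0 <= t i <= B) -> (0 < m)%N ->
  `|\sum_(0 <= i < m) (t i - m%:R^-1 * \sum_(0 <= j < m) t j) * x i|
    <= B * D * m%:R ^+ 2 / 8.
Proof.
move=> xD tB m0; rewrite ler_norml lerNl; apply/andP; split; last exact: sum_mean_dev_le.
rewrite -sumrN; under eq_bigr do rewrite -mulrN.
apply: (@sum_mean_dev_le (fun i => - x i)) => // i.
by rewrite /= opprK addrC distrC xD.
Qed.

(* For [D = 2 * D1 / n] the factor [1 / 8] gives the [1 / 4] of [eps1]. *)
Lemma block_sum_le x t (th B c D dl : R) m n :
  (forall i, `|x i| <= c) -> (forall i, `|x i.+1 - x i| <= D) ->
  (forall i, 0 <= t i <= B) -> 0 <= th <= B -> (0 < m)%N ->
  (forall j, `|th - m%:R^-1 * \sum_(1 <= i < m.+1) t (j * m + i)%N| <= dl) ->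
  `|\sum_(1 <= i < n.+1) (t i - th) * x i| <=
    (n %/ m)%:R * (B * D * m%:R ^+ 2 / 8 + m%:R * dl * c) + m%:R * B * c.
Proof.
move=> xc xD tB /andP[th0 thB] m0 Hd.
have B0 : 0 <= B by apply: le_trans th0 thB.
have c0 : 0 <= c by apply: le_trans (xc 0%N).
have M0 : 0 < m%:R :> R by rewrite ltr0n.
have blk j : `|\sum_(0 <= i < m) (t (j * m + i.+1)%N - th) * x (j * m + i.+1)%N|
    <= B * D * m%:R ^+ 2 / 8 + m%:R * dl * c.
  pose t' i := t (j * m + i.+1)%N; pose x' i := x (j * m + i.+1)%N.
  pose tb := m%:R^-1 * \sum_(0 <= i < m) t' i.
  have -> : \sum_(0 <= i < m) (t (j * m + i.+1)%N - th) * x (j * m + i.+1)%N =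
     \sum_(0 <= i < m) (t' i - tb) * x' i + (tb - th) * \sum_(0 <= i < m) x' i.
    rewrite mulr_sumr -big_split /=; apply: eq_bigr => i _.
    by rewrite -mulrDl addrA subrK.
  rewrite (le_trans (ler_normD _ _)) // lerD //.
    apply: abs_sum_mean_dev_le => // i; last exact: tB.
    by rewrite /x' (addnS (j * m) i.+1).
  rewrite normrM -mulrA mulrCA ler_pM //.
    by have := Hd j; rewrite big_add1 distrC.
  rewrite (le_trans (ler_norm_sum _ _ _)) //.
  rewrite (le_trans (ler_sum _ (fun i _ => xc _))) //.
  by rewrite sumr_const_nat subn0 mulr_natl.
have full J : `|\sum_(0 <= i < J * m) (t i.+1 - th) * x i.+1| <=
   J%:R * (B * D * m%:R ^+ 2 / 8 + m%:R * dl * c).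
  elim: J => [|J IH]; first by rewrite mul0n big_geq // normr0 mul0r.
  rewrite mulSn addnC (big_cat_nat _ (n := J * m)) ?leq_addr //=.
  rewrite (le_trans (ler_normD _ _)) // -natr1 mulrDl mul1r lerD //.
  rewrite -{1}[(J * m)%N]add0n big_addn addnC addnK.
  rewrite (le_trans _ (blk J)) //.
  by under eq_bigr do rewrite addnC -addnS.
rewrite big_add1 /= {1}(divn_eq n m) (big_cat_nat _ (n := n %/ m * m)) ?leq_addr //=.
rewrite (le_trans (ler_normD _ _)) // lerD //.
rewrite (le_trans (ler_norm_sum _ _ _)) //.
(* The incomplete last block has fewer than [m] terms, and [t i] and [th] differ by at most [B]
   because both lie between 0 and [B]. *)
apply: (@le_trans _ _ (\sum_(n %/ m * m <= i < n %/ m * m + n %% m) B * c)).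
  apply: ler_sum => i _; rewrite normrM ler_pM // ler_norml.
  by have /andP[] := tB i.+1; lra.
rewrite sumr_const_nat addKn -[X in X <= _]mulr_natl -[X in _ <= X]mulrA ler_wpM2r ?mulr_ge0 //.
by rewrite ler_nat ltnW // ltn_mod.
Qed.

End block_sums.

(** * The discrete Stein equation *)

Section stein_equation.
Context {R : realFieldType}.
Variable th : R.
Hypothesis th_gt0 : 0 < th.
Implicit Types (F f : nat -> R) (n N : nat).

(* The solution [G] of [th * (G j - F j) + j * (G j - G (j - 1)) = 0]. *)
Fixpoint resolvent F j : R :=
  if j is j'.+1 then (th * F j + j%:R * resolvent F j') / (th + j%:R) else F 0%N.

Lemma resolventE F j :
  th * (F j - resolvent F j) = j%:R * (resolvent F j - resolvent F j.-1).
Proof.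
case: j => [|j] /=; first by rewrite subrr mulr0 mul0r.
by field; rewrite gt_eqF // ltr_pwDl.
Qed.

Let kap := th / (1 + th).

(** Subtracting the equations at j + 1 and j gives a recursion for the increments of the resolvent,
    with weights [th] and j and total th + j + 1. The bound [kap * L] reproduces itself because kap
    (1 + th) = th. *)
Lemma resolvent_lip F L : (forall j, `|F j.+1 - F j| <= L) ->
  forall j, `|resolvent F j.+1 - resolvent F j| <= kap * L.
Proof.
move=> FL j.
have L0 : 0 <= L by apply: le_trans (FL 0%N).
have th1 : 0 < 1 + th by rewrite ltr_pwDl // ltW.
have kL0 : 0 <= kap * L by rewrite mulr_ge0 // divr_ge0 // ltW.
have key i : (th + i.+1%:R) * (resolvent F i.+1 - resolvent F i) =
    th * (F i.+1 - F i) + i%:R * (resolvent F i - resolvent F i.-1).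
  by rewrite -resolventE mulrDl mulrBr -[i.+1%:R * _ in LHS](resolventE F i.+1); ring.
have step i : `|i%:R * (resolvent F i - resolvent F i.-1)| <= i%:R * (kap * L) ->
    `|resolvent F i.+1 - resolvent F i| <= kap * L.
  move=> IH; have D0 : 0 < th + i.+1%:R by rewrite ltr_pwDl.
  rewrite -(ler_pM2l D0) -{1}(gtr0_norm D0) -normrM key.
  rewrite (le_trans (ler_normD _ _)) // normrM gtr0_norm //.
  have -> : (th + i.+1%:R) * (kap * L) = th * L + i%:R * (kap * L).
    by rewrite -natr1 /kap; field; rewrite gt_eqF //; lra.
  by rewrite lerD // ler_wpM2l // ltW.
elim: j => [|j IH]; first by apply: step; rewrite !mul0r normr0.
by apply: step; rewrite normrM ger0_norm //= ler_wpM2l.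
Qed.

(** When g is a difference of consecutive values of G, the sum of g (j + i) over i from 1 to n
    telescopes to G (j + n) - G j. This is the origin of the shift by [n]. *)
Definition stein_iter n f k : nat -> R :=
  iter k (fun F j => resolvent F (j + n)) f.

Lemma stein_iter_lip n f k L : (forall j, `|f j.+1 - f j| <= L) ->
  forall j, `|stein_iter n f k j.+1 - stein_iter n f k j| <= kap ^+ k * L.
Proof.
move=> fL; elim: k => [|k IH] j; first by rewrite expr0 mul1r.
by rewrite exprS -mulrA; exact: (resolvent_lip IH (j + n)).
Qed.

(* [resolvent] contracts the Lipschitz seminorm by [th / (1 + th)], so the
   iterates of [f] become constant and [stein_sol n f N] solves the equation
   [th * \sum_(1 <= i < n.+1) g (j + i) - j * g j = cst - f j] as [N] grows. *)
Definition stein_sol n f N j : R := th^-1 *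
  \sum_(0 <= k < N) (resolvent (stein_iter n f k) j - resolvent (stein_iter n f k) j.-1).

(** The k-th term is at most kap^(k+1) L, and the geometric series sums to th L because kap / (1 -
    kap) = th. The prefactor 1/th makes the bound exactly [L]. *)
Lemma stein_sol_le n f N L : (forall j, `|f j.+1 - f j| <= L) ->
  forall j, `|stein_sol n f N j| <= L.
Proof.
move=> fL j; have L0 : 0 <= L by apply: le_trans (fL 0%N).
have th1 : 0 < 1 + th by rewrite ltr_pwDl // ltW.
have k0 : 0 <= kap by rewrite divr_ge0 // ltW.
have thV0 : 0 <= th^-1 by rewrite invr_ge0 ltW.
rewrite /stein_sol normrM (ger0_norm thV0).
rewrite -(ler_pM2l th_gt0) mulrA mulfV ?gt_eqF // mul1r.
apply: (@le_trans _ _ (\sum_(0 <= k < N) kap * (kap ^+ k * L))).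
  rewrite (le_trans (ler_norm_sum _ _ _)) // ler_sum // => k _.
  case: j => [|j] /=; first by rewrite subrr normr0 mulr_ge0 // mulr_ge0 // exprn_ge0.
  by apply: resolvent_lip; exact: stein_iter_lip.
have -> : \sum_(0 <= k < N) kap * (kap ^+ k * L) = th * L - kap ^+ N * (th * L).
  elim: N => [|N IH]; first by rewrite big_geq // expr0; ring.
  by rewrite big_nat_recr //= IH exprS /kap; field; rewrite gt_eqF //; lra.
by rewrite gerBl mulr_ge0 ?exprn_ge0 // mulr_ge0 // ltW.
Qed.

(** The sum telescopes twice: in i it leaves resolvent values at j + n and j, which [resolventE]
    combines into the next iterate minus the present one; in k these differences telescope again. *)
Lemma stein_solE n f N j :
  th * \sum_(1 <= i < n.+1) stein_sol n f N (j + i) - j%:R * stein_sol n f N j =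
  stein_iter n f N j - f j.
Proof.
have th0 : th != 0 by rewrite gt_eqF.
rewrite /stein_sol -mulr_sumr mulrA mulfV // mul1r exchange_big /=.
rewrite mulrCA mulr_sumr mulr_sumr -sumrB.
transitivity (\sum_(0 <= k < N) (stein_iter n f k.+1 j - stein_iter n f k j)); last first.
  by rewrite telescope_sumr.
apply: eq_bigr => k _; rewrite -resolventE mulrA mulVf // mul1r.
rewrite big_add1 /=.
pose G i := resolvent (stein_iter n f k) (j + i)%N.
rewrite (eq_bigr (fun i => G i.+1 - G i)) => [|i _]; last by rewrite /G addnS.
by rewrite telescope_sumr // /G addn0 /=; ring.
Qed.

End stein_equation.

(** * Real-valued integrals *)

Section real_integrals.
Context d (T : measurableType d) (R : realType).
Variables (mu : {measure set T -> \bar R}) (D : set T).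
Hypothesis mD : measurable D.
Implicit Types f g : T -> R.

Local Notation intb f := (mu.-integrable D (EFin \o f)).

Lemma integrable_measurable f : intb f -> measurable_fun D f.
Proof. by move=> /measurable_int /measurable_EFinP. Qed.

Lemma integrable_dom f g : measurable_fun D f ->
  (forall x, D x -> `|f x| <= g x) -> intb g -> intb f.
Proof.
move=> mf fg; apply: le_integrable => //; first exact/measurable_EFinP.
move=> x Dx /=; rewrite lee_fin (le_trans (fg x Dx)) //; exact: ler_norm.
Qed.

Lemma integrable_cstR (c : R) : (mu D < +oo)%E -> intb (fun=> c).
Proof.
move=> muD; apply: (@measurable_bounded_integrable _ _ _ mu (fun=> c)) => //.
by exists `|c|; split => // M cM x Dx /=; rewrite ltW.
Qed.

Lemma integrable_bounded f c : (mu D < +oo)%E -> measurable_fun D f ->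
  (forall x, D x -> `|f x| <= c) -> intb f.
Proof. by move=> muD mf fc; apply: (integrable_dom mf fc); exact: integrable_cstR. Qed.

Lemma integrableDR f g : intb f -> intb g -> intb (fun x => f x + g x).
Proof. by move=> intf intg; exact: (@integrableD _ _ _ mu D mD (EFin \o f) (EFin \o g)). Qed.

Lemma integrableBR f g : intb f -> intb g -> intb (fun x => f x - g x).
Proof. by move=> intf intg; exact: (@integrableB _ _ _ mu D mD (EFin \o f) (EFin \o g)). Qed.

Lemma integrableZR (k : R) f : intb f -> intb (fun x => k * f x).
Proof. by move=> intf; exact: (@integrableZl _ _ _ mu D mD k (EFin \o f)). Qed.

Lemma integrable_sumR I (s : seq I) (F : I -> T -> R) :
  (forall i, intb (F i)) -> intb (fun x => \sum_(i <- s) F i x).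
Proof.
move=> intF; elim: s => [|i s IH].
  by under eq_fun do rewrite big_nil; exact: integrable0.
under eq_fun do rewrite big_cons; exact: integrableDR.
Qed.

Lemma Rintegral_sum I (s : seq I) (F : I -> T -> R) :
  (forall i, intb (F i)) ->
  \int[mu]_(x in D) (\sum_(i <- s) F i x) = \sum_(i <- s) \int[mu]_(x in D) F i x.
Proof.
move=> intF; elim: s => [|i s IH].
  by under eq_fun do rewrite big_nil; rewrite big_nil /Rintegral integral0.
under eq_fun do rewrite big_cons.
by rewrite RintegralD //; [rewrite IH big_cons|exact: integrable_sumR].
Qed.

Lemma integrable_sum_in (I : eqType) (s : seq I) (F : I -> T -> R) :
  {in s, forall i, intb (F i)} -> intb (fun x => \sum_(i <- s) F i x).
Proof.
move=> intF; pose G i := if i \in s then F i else fun=> 0.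
have -> : (fun x => \sum_(i <- s) F i x) = fun x => \sum_(i <- s) G i x.
  by apply/funext => x; apply: eq_big_seq => i si; rewrite /G si.
apply: integrable_sumR => i; rewrite /G; case: ifP => [si|_]; first exact: intF.
exact: integrable0.
Qed.

Lemma Rintegral_sum_in (I : eqType) (s : seq I) (F : I -> T -> R) :
  {in s, forall i, intb (F i)} ->
  \int[mu]_(x in D) (\sum_(i <- s) F i x) = \sum_(i <- s) \int[mu]_(x in D) F i x.
Proof.
move=> intF; pose G i := if i \in s then F i else fun=> 0.
have -> : (fun x => \sum_(i <- s) F i x) = fun x => \sum_(i <- s) G i x.
  by apply/funext => x; apply: eq_big_seq => i si; rewrite /G si.
rewrite Rintegral_sum; first by apply: eq_big_seq => i si; rewrite /G si.
move=> i; rewrite /G; case: ifP => [si|_]; first exact: intF.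
exact: integrable0.
Qed.

Lemma Rintegral_norm_le f g : measurable_fun D f ->
  (forall x, D x -> `|f x| <= g x) -> intb g ->
  `|\int[mu]_(x in D) f x| <= \int[mu]_(x in D) g x.
Proof.
move=> mf fg intg; have intf := integrable_dom mf fg intg.
rewrite (le_trans (le_normr_Rintegral mD intf)) // le_Rintegral //.
exact: integrable_norm.
Qed.

Lemma Rintegral_EFin f : intb f ->
  (\int[mu]_(x in D) (f x)%:E)%E = (\int[mu]_(x in D) f x)%:E.
Proof. by move=> intf; rewrite /Rintegral fineK // integrable_fin_num. Qed.

Lemma Rintegral_dominated_cvg (F : nat -> T -> R) f g :
  (forall n, measurable_fun D (F n)) ->
  (forall x, D x -> F n x @[n --> \oo] --> f x) ->
  intb g -> (forall n x, D x -> `|F n x| <= g x) ->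
  intb f /\ \int[mu]_(x in D) F n x @[n --> \oo] --> \int[mu]_(x in D) f x.
Proof.
move=> mF Ff intg Fg.
have mf : measurable_fun D f by exact: measurable_fun_cvg Ff.
have [||||| intf _ cv] := @dominated_convergence _ _ _ mu D mD
   (fun n => EFin \o F n) (EFin \o f) (EFin \o g).
- by move=> n; exact/measurable_EFinP.
- exact/measurable_EFinP.
- by apply: aeW => x Dx; apply: cvg_EFin; [exact: nearW|exact: Ff].
- exact: intg.
- by apply: aeW => x n Dx /=; rewrite lee_fin Fg.
split=> //; apply: fine_cvg; rewrite -/(Rintegral mu D f) -Rintegral_EFin //.
Qed.

End real_integrals.

(** * The Dickman law *)

Section exponential_bounds.
Context {R : realType}.
Implicit Types y : R.

Lemma one_sub_expRN_le y : 1 - expR (- y) <= y.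
Proof. by have := expR_ge1Dx (- y); lra. Qed.

Lemma one_sub_expRN_ge y : 0 <= y -> y - y ^+ 2 <= 1 - expR (- y).
Proof.
move=> y0; have : expR (- y) * (1 + y) <= 1.
  rewrite -[leRHS](expRxMexpNx_1 y) mulrC ler_wpM2r ?expR_ge0 //.
  exact: expR_ge1Dx.
have := expR_ge0 (- y); nra.
Qed.

Lemma one_sub_expRN_ge0 y : 0 <= y -> 0 <= 1 - expR (- y).
Proof. by move=> y0; rewrite subr_ge0 expR_le1 oppr_le0. Qed.

Lemma measurable_expRN (s : R) (D : set R) :
  measurable_fun D (fun x => expR (- (s * x))).
Proof.
apply: measurable_funTS; apply: measurableT_comp => //.
by apply: measurableT_comp => //; apply: measurable_funM.
Qed.

End exponential_bounds.

Section dickman_exponent.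
Context {R : realType}.
Local Notation leb := (@lebesgue_measure R).
Implicit Types s h : R.

Definition dickman_exponent s : R :=
  \int[leb]_(x in `[0, 1]) ((1 - expR (- (s * x))) * x^-1).

Definition unif_laplace s : R := \int[leb]_(x in `[0, 1]) expR (- (s * x)).

Lemma leb01 : leb (`]0%R, 1%R]%classic : set R) = 1%E.
Proof. by rewrite lebesgue_measure_itv /= lte01 oppr0 adde0. Qed.

Lemma leb01_lty : (leb (`]0%R, 1%R]%classic : set R) < +oo)%E.
Proof. by rewrite leb01 ltry. Qed.

Lemma measurable_inv01 : measurable_fun (`]0%R, 1%R]%classic : set R) (fun x : R => x^-1).
Proof.
have sub : `]0%R, 1%R]%classic `<=` (`]0%R, +oo[%classic : set R).
  by move=> x /=; rewrite !in_itv /= => /andP[->].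
apply: (measurable_funS _ sub) => //.
apply: open_continuous_measurable_fun; first exact: interval_open.
move=> x; rewrite inE /= in_itv /= andbT => x0.
by apply: inv_continuous; rewrite gt_eqF.
Qed.

Lemma integrable_unif_laplace s : 0 <= s ->
  leb.-integrable (`]0%R, 1%R]%classic : set R) (EFin \o (fun x => expR (- (s * x)))).
Proof.
move=> s0; apply: (@integrable_bounded _ _ _ _ _ _ _ 1) => //.
- exact: leb01_lty.
- exact: measurable_expRN.
- move=> x /=; rewrite in_itv /= => /andP[x0 _].
  by rewrite ger0_norm ?expR_ge0 // expR_le1 oppr_le0 mulr_ge0 // ltW.
Qed.

Lemma integrable_dickman_exponent s : 0 <= s ->
  leb.-integrable (`]0%R, 1%R]%classic : set R)
    (EFin \o (fun x => (1 - expR (- (s * x))) * x^-1)).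
Proof.
move=> s0; apply: (@integrable_bounded _ _ _ _ _ _ _ s) => //.
- exact: leb01_lty.
- apply: measurable_funM measurable_inv01.
  by apply: measurable_funB => //; exact: measurable_expRN.
- move=> x /=; rewrite in_itv /= => /andP[x0 _].
  have sx0 : 0 <= s * x by rewrite mulr_ge0 // ltW.
  have xV0 : 0 <= x^-1 by rewrite invr_ge0 ltW.
  rewrite ger0_norm; last by rewrite mulr_ge0 // one_sub_expRN_ge0.
  by rewrite ler_pdivrMr // one_sub_expRN_le.
Qed.

(** A quantitative form of the fact that the exponent has derivative [unif_laplace], which replaces
    differentiation under the integral. With e = exp(-s x), the difference of the integrands is e (1
    - exp(-h x)) / x, and this lies between h e - h^2 and h e on ]0, 1]. *)
Lemma dickman_exponent_diff s h : 0 <= s -> 0 <= h ->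
  h * (unif_laplace s - h) <= dickman_exponent (s + h) - dickman_exponent s
    <= h * unif_laplace s.
Proof.
move=> s0 h0; have sh0 : 0 <= s + h by rewrite addr_ge0.
rewrite /dickman_exponent /unif_laplace -!Rintegral_itv_obnd_cbnd;
  [|exact: integrable_dickman_exponent|exact: integrable_dickman_exponent|
   exact: integrable_unif_laplace].
rewrite -RintegralB //; [|exact: integrable_dickman_exponent..].
have int1 : leb.-integrable (`]0%R, 1%R]%classic : set R) (EFin \o (fun=> h)).
  by apply: integrable_cstR => //; exact: leb01_lty.
have key x : `]0%R, 1%R]%classic x ->
    h * (expR (- (s * x)) - h) <=
    (1 - expR (- ((s + h) * x))) * x^-1 - (1 - expR (- (s * x))) * x^-1
    <= h * expR (- (s * x)).
  rewrite /= in_itv /= => /andP[x0 x1].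
  have hx0 : 0 <= h * x by rewrite mulr_ge0 // ltW.
  rewrite -mulrBl ler_pdivrMr // ler_pdivlMr //.
  rewrite mulrDl opprD expRD.
  have := one_sub_expRN_le (h * x); have := one_sub_expRN_ge hx0.
  have : expR (- (s * x)) <= 1 by rewrite expR_le1 oppr_le0 mulr_ge0 // ltW.
  have := expR_ge0 (- (s * x)).
  move: (expR _) (expR (- (h * x))) => e f e0 e1 H1 H2.
  have E : 1 - e * f - (1 - e) = e * (1 - f) by ring.
  rewrite E; apply/andP; split.
    apply: le_trans (_ : e * (h * x - (h * x) ^+ 2) <= _); last by rewrite ler_wpM2l.
    have ex1 : e * x <= 1 by rewrite mulr_ile1 // ltW.
    have : 0 <= h ^+ 2 * x * (1 - e * x).
      by rewrite mulr_ge0 ?subr_ge0 // mulr_ge0 ?sqr_ge0 // ltW.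
    by nra.
  by rewrite [leRHS](_ : _ = e * (h * x)); [rewrite ler_wpM2l|ring].
have intI := integrable_unif_laplace s0.
apply/andP; split.
  rewrite -[X in h * (_ - X)]mulr1 -[X in h * (_ - _ * X)](_ : fine (leb `]0%R, 1%R]%classic) = 1); last by rewrite leb01.
  rewrite -(Rintegral_cst leb) // -RintegralB // -RintegralZl //; last exact: integrableBR.
  apply: le_Rintegral => //; first by apply: integrableZR => //; exact: integrableBR.
    by apply: integrableBR => //; exact: integrable_dickman_exponent.
  by move=> x /key /andP[].
rewrite -RintegralZl //.
apply: le_Rintegral => //; last by move=> x /key /andP[].
  by apply: integrableBR => //; exact: integrable_dickman_exponent.
exact: integrableZR.
Qed.

Lemma unif_laplace_bounds s : 0 <= s -> 0 <= unif_laplace s <= 1.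
Proof.
move=> s0; rewrite /unif_laplace.
rewrite Rintegral_ge0 => [|x _]; last exact: expR_ge0.
rewrite -Rintegral_itv_obnd_cbnd; last exact: integrable_unif_laplace.
apply: (@le_trans _ _ (\int[leb]_(x in `]0, 1]) (1 : R))).
  apply: le_Rintegral => //; first exact: integrable_unif_laplace.
    by apply: integrable_cstR => //; exact: leb01_lty.
  move=> x /=; rewrite in_itv /= => /andP[x0 _].
  by rewrite expR_le1 oppr_le0 mulr_ge0 // ltW.
rewrite Rintegral_cst // mul1r.
by have -> := congr1 fine leb01.
Qed.

End dickman_exponent.

Section elementary_limits.
Context {R : realType}.

Lemma cvg_of_le_harmonic (u : nat -> R) (l K : R) :
  (forall n, `|u n - l| <= K * n.+1%:R^-1) -> u n @[n --> \oo] --> l.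
Proof.
move=> H; apply/cvgrPdist_le => /= e e0; near=> n.
rewrite distrC; apply: le_trans (H n) _.
near: n; suff /cvgr0_norm_le /(_ e e0) : K * n.+1%:R^-1 @[n --> \oo] --> (0 : R).
  by apply: filterS => n; apply: le_trans; exact: ler_norm.
by rewrite -[X in _ --> X](mulr0 K); apply: cvgMr; exact: cvg_harmonic.
Unshelve. all: by end_near.
Qed.

Lemma bernoulli_ge (y : R) k : 0 <= y <= 1 -> 1 - k%:R * y <= (1 - y) ^+ k.
Proof.
case/andP=> y0 y1; elim: k => [|k IH]; first by rewrite mul0r subr0 expr0.
rewrite exprS -natr1; apply: le_trans (_ : (1 - y) * (1 - k%:R * y) <= _).
  have : 0 <= k%:R * y ^+ 2 by rewrite mulr_ge0 ?sqr_ge0.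
  by nra.
by rewrite ler_wpM2l // subr_ge0.
Qed.

Lemma bernoulli_le (y : R) k : 0 <= y <= 1 -> (1 - y) ^+ k * (1 + k%:R * y) <= 1.
Proof.
case/andP=> y0 y1; elim: k => [|k IH]; first by rewrite mul0r addr0 expr0 mulr1.
apply: le_trans IH; rewrite exprSr -mulrA ler_wpM2l //.
  by rewrite exprn_ge0 // subr_ge0.
have : 0 <= k%:R * y ^+ 2 by rewrite mulr_ge0 ?sqr_ge0.
by rewrite -natr1; have := sqr_ge0 y; nra.
Qed.

(* Polynomials in [exp (- x)] approximating the indicator of [tau <= x]. *)
Definition ray_deg (tau : R) n : nat :=
  (Num.truncn (expR (n.+1%:R * tau) / n.+1%:R)).+1.

Definition ray_approx (tau : R) n (x : R) : R :=
  (1 - expR (- x) ^+ n.+1) ^+ ray_deg tau n.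

Lemma ray_approx_itv tau n x : 0 <= x -> 0 <= ray_approx tau n x <= 1.
Proof.
move=> x0; have e1 : expR (- x) <= 1 by rewrite expR_le1 oppr_le0.
have : 0 <= 1 - expR (- x) ^+ n.+1 <= 1.
  by rewrite subr_ge0 exprn_ile1 ?expR_ge0 // gerBl exprn_ge0 ?expR_ge0.
by case/andP=> a b; rewrite /ray_approx exprn_ge0 // exprn_ile1.
Qed.

(** Put N = n + 1, y = exp(-N x) and let k be the degree, about exp(N tau)/N. Then k y is about
    exp(N (tau - x))/N: it vanishes for x >= tau, the point x = tau included thanks to the division
    by N, and it explodes for x < tau. The two Bernoulli inequalities 1 - k y <= (1 - y)^k <= 1/(1 +
    k y) conclude. *)
Lemma ray_approx_cvg tau x : 0 < tau -> 0 <= x ->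
  ray_approx tau n x @[n --> \oo] --> ((tau <= x)%R%:R : R).
Proof.
move=> tau0 x0.
have N0 n : 0 < n.+1%:R :> R by rewrite ltr0n.
have e1 : expR (- x) <= 1 by rewrite expR_le1 oppr_le0.
have y01 n : 0 <= expR (- x) ^+ n.+1 <= 1.
  by rewrite exprn_ge0 ?expR_ge0 // exprn_ile1 ?expR_ge0.
have yE n : expR (- x) ^+ n.+1 = expR (- (n.+1%:R * x)).
  by rewrite -expRM_natl mulrN.
have degP n : expR (n.+1%:R * tau) / n.+1%:R <= (ray_deg tau n)%:R
              <= expR (n.+1%:R * tau) / n.+1%:R + 1.
  have e0 : 0 <= expR (n.+1%:R * tau) / n.+1%:R by rewrite divr_ge0 ?expR_ge0.
  have /andP[lo hi] := truncn_itv e0.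
  by rewrite /ray_deg ltW //= -natr1 lerD2r.
case: (lerP tau x) => h /=.
  apply: (@cvg_of_le_harmonic _ _ (1 + tau^-1)) => n.
  have /andP[q0 q1] := ray_approx_itv tau n x0.
  rewrite ler0_norm ?subr_le0 // opprB.
  have := bernoulli_ge (ray_deg tau n) (y01 n); rewrite -/(ray_approx tau n x) => B.
  apply: le_trans (_ : (ray_deg tau n)%:R * expR (- x) ^+ n.+1 <= _).
    by move: B; rewrite /ray_approx; lra.
  have /andP[_ hi] := degP n.
  apply: le_trans (_ : (expR (n.+1%:R * tau) / n.+1%:R + 1) * expR (- (n.+1%:R * tau)) <= _).
    rewrite yE ler_pM ?expR_ge0 // ler_expR lerN2 ler_wpM2l //.
  rewrite mulrDl mul1r mulrAC expRxMexpNx_1 [leRHS]mulrDl lerD //.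
  rewrite expRN -invfM lef_pV2 ?posrE ?expR_gt0 ?mulr_gt0 //.
  by have := expR_ge1Dx (n.+1%:R * tau); rewrite mulrC; lra.
set dl := tau - x; have dl0 : 0 < dl by rewrite subr_gt0.
apply: (@cvg_of_le_harmonic _ _ (2 / dl ^+ 2)) => n.
have /andP[q0 q1] := ray_approx_itv tau n x0.
rewrite subr0 ger0_norm //.
have := bernoulli_le (ray_deg tau n) (y01 n).
have /andP[lo _] := degP n.
set k := (ray_deg tau n)%:R : R; set y := expR (- x) ^+ n.+1.
rewrite -[(1 - y) ^+ _]/(ray_approx tau n x) => B.
have ky : n.+1%:R * dl ^+ 2 / 2 <= k * y.
  apply: le_trans (_ : expR (n.+1%:R * tau) / n.+1%:R * y <= _); last first.
    by rewrite ler_wpM2r // /y yE expR_ge0.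
  rewrite /y yE [leRHS]mulrAC -expRD -mulrN -mulrDr -/dl.
  have := @expR_ge1Dxn R (n.+1%:R * dl) 1 (mulr_ge0 (ltW (N0 n)) (ltW dl0)).
  rewrite ler_pdivlMr //; apply: le_trans; rewrite exprMn expr2.
  rewrite -[2`!%N]/2%N; lra.
rewrite mulrAC -[2 / _ / _]mulrA -invfM ler_pdivlMr; last by rewrite mulr_gt0 ?exprn_gt0.
apply: le_trans (_ : 2 * (ray_approx tau n x * (1 + k * y)) <= _); last by lra.
rewrite [leRHS]mulrCA ler_wpM2l //; lra.
Qed.

End elementary_limits.

Section dickman_law.
Context {R : realType}.
Variables (theta : R) (Q : probability (measurableTypeR R) R).
Hypothesis theta_gt0 : 0 < theta.
Hypothesis Q_dickman : is_dickman theta Q.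
Local Notation leb := (@lebesgue_measure R).
Local Notation D := (`[0%R, +oo[%classic : set R).

Lemma dickman_mass : Q D = 1%E. Proof. by case: Q_dickman. Qed.

Lemma dickman_mass_lty : (Q D < +oo)%E. Proof. by rewrite dickman_mass ltry. Qed.

Lemma halflineP (x : R) : D x = (0 <= x) :> Prop.
Proof. by rewrite /= in_itv /= andbT. Qed.

Let phi s := expR (- (theta * dickman_exponent s)).

Lemma integrable_laplace s : 0 <= s ->
  Q.-integrable D (EFin \o (fun x => expR (- (s * x)))).
Proof.
move=> s0; apply: (@integrable_bounded _ _ _ _ _ _ _ 1) => //.
- exact: dickman_mass_lty.
- exact: measurable_expRN.
- move=> x; rewrite halflineP => x0.
  by rewrite ger0_norm ?expR_ge0 // expR_le1 oppr_le0 mulr_ge0.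
Qed.

Lemma dickman_laplace s : 0 <= s -> \int[Q]_(x in D) expR (- (s * x)) = phi s.
Proof. by move=> s0; have [_ H] := Q_dickman; rewrite /Rintegral H. Qed.

(** The difference quotient of -exp(-s x) in s, with step 1/(n + 1); it tends to x exp(-s x) from
    below. *)
Let slope s n (x : R) : R :=
  expR (- (s * x)) * (1 - expR (- (n.+1%:R^-1 * x))) * n.+1%:R.

Lemma slope_bounds s n x : 0 <= s -> 0 <= x ->
  [/\ 0 <= slope s n x, slope s n x <= x * expR (- (s * x)) &
   x * expR (- (s * x)) - n.+1%:R^-1 * x ^+ 2 <= slope s n x].
Proof.
move=> s0 x0; rewrite /slope.
have N0 : 0 < n.+1%:R :> R by rewrite ltr0n.
have e0 := expR_ge0 (- (s * x)).
have e1 : expR (- (s * x)) <= 1 by rewrite expR_le1 oppr_le0 mulr_ge0.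
have hx0 : 0 <= n.+1%:R^-1 * x by rewrite mulr_ge0.
have B0 := one_sub_expRN_ge0 hx0.
split; first by rewrite !mulr_ge0.
  rewrite -ler_pdivlMr // mulrC [leRHS]mulrAC ler_wpM2r //.
  by rewrite mulrC one_sub_expRN_le.
rewrite -ler_pdivrMr //.
apply: le_trans (_ : expR (- (s * x)) * (n.+1%:R^-1 * x - (n.+1%:R^-1 * x) ^+ 2) <= _); last first.
  by rewrite ler_wpM2l // one_sub_expRN_ge.
have : 0 <= (n.+1%:R^-1 * x) ^+ 2 * (1 - expR (- (s * x))).
  by rewrite mulr_ge0 ?sqr_ge0 // subr_ge0.
by move: (_ ^-1) (expR _) => h e; lra.
Qed.

Lemma measurable_slope s n : measurable_fun D (slope s n).
Proof.
apply: measurable_funM => //; apply: measurable_funM; first exact: measurable_expRN.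
by apply: measurable_funB => //; exact: measurable_expRN.
Qed.

Lemma measurable_size_biased s : measurable_fun D (fun x => x * expR (- (s * x))).
Proof. by apply: measurable_funM => //; exact: measurable_expRN. Qed.

Lemma integral_slope s n : 0 <= s ->
  (\int[Q]_(x in D) (slope s n x)%:E)%E = ((phi s - phi (s + n.+1%:R^-1)) * n.+1%:R)%:E.
Proof.
move=> s0.
have sh0 : 0 <= s + n.+1%:R^-1 by rewrite addr_ge0.
have E x : slope s n x =
    n.+1%:R * (expR (- (s * x)) - expR (- ((s + n.+1%:R^-1) * x))).
  by rewrite /slope mulrDl opprD expRD; ring.
under eq_integral do rewrite E.
have intB : Q.-integrable D (EFin \o (fun x => expR (- (s * x)) - expR (- ((s + n.+1%:R^-1) * x)))).
  by apply: integrableBR => //; exact: integrable_laplace.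
rewrite Rintegral_EFin //; last exact: integrableZR.
by rewrite RintegralZl // RintegralB //;
  [rewrite !dickman_laplace // mulrC|exact: integrable_laplace..].
Qed.

Lemma phi_slope_cvg s : 0 <= s ->
  (phi s - phi (s + n.+1%:R^-1)) * n.+1%:R @[n --> \oo] -->
   theta * unif_laplace s * phi s.
Proof.
(* In the constant, [theta] pays for the h^2 of [dickman_exponent_diff] and [theta ^+ 2] for the
   quadratic error in 1 - exp(-y) >= y - y^2. *)
move=> s0; apply: (@cvg_of_le_harmonic _ _ _ (phi s * (theta + theta ^+ 2))) => n.
set N : R := n.+1%:R; set h := N^-1; have N0 : 0 < N by rewrite /N ltr0n.
have h0 : 0 < h by rewrite invr_gt0.
have hN : h * N = 1 by rewrite mulVf // gt_eqF.
have /andP[I1 I2] := dickman_exponent_diff s0 (ltW h0).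
set y := theta * (dickman_exponent (s + h) - dickman_exponent s).
have phiE : phi (s + h) = phi s * expR (- y).
  rewrite /phi -expRD /y; congr expR.
  by move: (dickman_exponent _) (dickman_exponent _) => A B; ring.
have /andP[a0 a1] := unif_laplace_bounds s0.
have p0 : 0 <= phi s by exact: expR_ge0.
have y0 : 0 <= y.
  apply: mulr_ge0; first exact: ltW.
  rewrite /dickman_exponent subr_ge0.
  have sh0 : 0 <= s + h by rewrite addr_ge0 // ltW.
  rewrite -!Rintegral_itv_obnd_cbnd; try exact: integrable_dickman_exponent.
  apply: le_Rintegral => //; try exact: integrable_dickman_exponent.
  move=> x /=; rewrite in_itv /= => /andP[x0 _].
  have xV0 : 0 <= x^-1 by rewrite invr_ge0 ltW.
  rewrite ler_wpM2r // lerD2l lerN2 ler_expR lerN2 ler_wpM2r // ?lerDl ltW //.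
have y1 : y <= theta * (h * unif_laplace s) by rewrite ler_wpM2l // ltW.
have y2 : theta * (h * (unif_laplace s - h)) <= y by rewrite ler_wpM2l // ltW.
have e1 := one_sub_expRN_le y; have e2 := one_sub_expRN_ge y0.
have yh : y <= theta * h.
  by apply: le_trans y1 _; rewrite ler_pM2l // ler_piMr // ltW.
have ysq : y ^+ 2 <= (theta * h) ^+ 2 by rewrite ler_sqr // nnegrE mulr_ge0 // ltW.
have -> : (phi s - phi (s + h)) * N - theta * unif_laplace s * phi s =
   phi s * ((1 - expR (- y)) * N - theta * unif_laplace s) by rewrite phiE; ring.
rewrite normrM (ger0_norm p0) -mulrA ler_wpM2l // ler_norml.
have -> : theta * unif_laplace s = theta * (h * unif_laplace s) * N.
  by rewrite -mulrA [h * _]mulrC -mulrA hN mulr1.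
have -> : (theta + theta ^+ 2) * h = (theta * h ^+ 2 + (theta * h) ^+ 2) * N.
  by rewrite exprMn -mulrDl expr2 -!mulrA hN mulr1.
rewrite -mulrBl -mulNr !ler_pM2r //; apply/andP; split; last first.
  apply: le_trans (_ : 0 <= _); first by rewrite subr_le0 (le_trans e1).
  by rewrite addr_ge0 ?sqr_ge0 // mulr_ge0 ?sqr_ge0 // ltW.
rewrite -subr_ge0 [leRHS](_ : _ = (1 - expR (- y) - (y - y ^+ 2)) +
  (y - theta * (h * (unif_laplace s - h))) + ((theta * h) ^+ 2 - y ^+ 2)); last by ring.
apply: addr_ge0; last by rewrite subr_ge0.
by apply: addr_ge0; rewrite subr_ge0.
Qed.

(* The Laplace transform of the identity [x Q(dx) = theta * law of (X + U)]
   with [U] uniform, obtained by differentiating that of [Q]. *)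
Lemma dickman_size_bias s : 0 <= s ->
  Q.-integrable D (EFin \o (fun x => x * expR (- (s * x)))) /\
  \int[Q]_(x in D) (x * expR (- (s * x))) =
    theta * unif_laplace s * \int[Q]_(x in D) expR (- (s * x)).
Proof.
move=> s0; rewrite dickman_laplace //.
set c := theta * _ * _.
suff E : (\int[Q]_(x in D) (x * expR (- (s * x)))%:E)%E = c%:E.
  split; last by rewrite /Rintegral E.
  apply/integrableP; split; first by apply/measurable_EFinP; exact: measurable_size_biased.
  under eq_integral.
    move=> x; rewrite inE halflineP => x0.
    rewrite /= ger0_norm; last by rewrite mulr_ge0 ?expR_ge0.
    over.
  by rewrite E ltry.
have cv : (\int[Q]_(x in D) (slope s n x)%:E)%E @[n --> \oo] --> c%:E.
  under eq_fun do rewrite integral_slope //.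
  by apply: cvg_EFin; [exact: nearW|exact: phi_slope_cvg].
apply/eqP; rewrite eq_le; apply/andP; split.
  have [<- _] := cvg_limn_einf_sup cv.
  apply: le_trans (_ : (\int[Q]_(x in D) limn_einf (fun n => (slope s n x)%:E) <= _)%E).
    rewrite (_ : (\int[Q]_(x in D) _ = \int[Q]_(x in D) limn_einf (fun n => (slope s n x)%:E))%E) //.
    apply: eq_integral => x; rewrite inE halflineP => x0.
    have cvx : (slope s n x)%:E @[n --> \oo] --> (x * expR (- (s * x)))%:E.
      apply: cvg_EFin; first exact: nearW.
      apply: (@cvg_of_le_harmonic _ _ _ (x ^+ 2)) => n.
      have [_ B1 B2] := slope_bounds n s0 x0.
      have B3 : 0 <= x ^+ 2 * n.+1%:R^-1 by rewrite mulr_ge0 ?sqr_ge0.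
      rewrite ler_norml /=; move: B1 B2 B3; move: (slope s n x) (x * _) (n.+1%:R^-1); clear.
      by move=> u v h B1 B2 B3; apply/andP; split; lra.
    by have [-> _] := cvg_limn_einf_sup cvx.
  apply: fatou => //.
  - by move=> n; apply/measurable_EFinP; exact: measurable_slope.
  - by move=> n x; rewrite halflineP lee_fin => /(slope_bounds n s0)[].
rewrite -(cvg_lim _ cv) //; apply: lime_le; first by apply/cvg_ex; exists c%:E.
apply: nearW => n.
apply: ge0_le_integral => //.
- by move=> x; rewrite halflineP lee_fin => /(slope_bounds n s0)[].
- by apply/measurable_EFinP; exact: measurable_slope.
- by apply/measurable_EFinP; exact: measurable_size_biased.
- by move=> x; rewrite halflineP lee_fin => /(slope_bounds n s0)[].
Qed.

Lemma dickman_mean : Q.-integrable D (EFin \o id) /\ \int[Q]_(x in D) x = theta.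
Proof.
have [] := dickman_size_bias (lexx 0).
have E : (fun x : R => x * expR (- (0 * x))) = id.
  by apply/funext => x; rewrite mul0r oppr0 expR0 mulr1.
have E' : (fun x : R => expR (- (0 * x))) = fun=> 1.
  by apply/funext => x; rewrite mul0r oppr0 expR0.
rewrite E /unif_laplace E' => H ->; split=> //.
rewrite -Rintegral_itv_obnd_cbnd; last by apply: integrable_cstR => //; exact: leb01_lty.
rewrite !Rintegral_cst //.
have -> := congr1 fine leb01; have -> := congr1 fine dickman_mass.
by rewrite !mul1r !mulr1.
Qed.

End dickman_law.

(** * Size biasing of the Dickman law on half-lines *)

Section dickman_rays.
Context {R : realType}.
Variables (theta : R) (Q : probability (measurableTypeR R) R).
Hypothesis theta_gt0 : 0 < theta.
Hypothesis Q_dickman : is_dickman theta Q.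
Local Notation leb := (@lebesgue_measure R).
Local Notation D := (`[0%R, +oo[%classic : set R).
Implicit Types p : {poly R}.

Lemma leb01c : leb (`[0%R, 1%R]%classic : set R) = 1%E.
Proof. by rewrite lebesgue_measure_itv /= lte01 oppr0 adde0. Qed.

Lemma leb01c_lty : (leb (`[0%R, 1%R]%classic : set R) < +oo)%E.
Proof. by rewrite leb01c ltry. Qed.

Lemma horner_expRN p (x : R) :
  p.[expR (- x)] = \sum_(i < size p) p`_i * expR (- (i%:R * x)).
Proof.
by rewrite horner_coef; apply: eq_bigr => i _; rewrite -mulrN expRM_natl.
Qed.

Definition unif_avg p (x : R) : R := \int[leb]_(t in `[0, 1]) p.[expR (- (x + t))].

Lemma unif_avgE p x : unif_avg p x =
  \sum_(i < size p) p`_i * unif_laplace i%:R * expR (- (i%:R * x)).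
Proof.
rewrite /unif_avg.
have E t : p.[expR (- (x + t))] =
    \sum_(i < size p) (p`_i * expR (- (i%:R * x))) * expR (- (i%:R * t)).
  rewrite horner_expRN; apply: eq_bigr => i _.
  by rewrite mulrDr opprD expRD mulrA.
under eq_Rintegral do rewrite E.
have intE (i : nat) : leb.-integrable (`[0%R, 1%R]%classic : set R)
    (EFin \o (fun t => expR (- (i%:R * t)))).
  apply: (@integrable_bounded _ _ _ _ _ _ _ 1) => //.
  - exact: leb01c_lty.
  - exact: measurable_expRN.
  - move=> t /=; rewrite in_itv /= => /andP[t0 _].
    by rewrite ger0_norm ?expR_ge0 // expR_le1 oppr_le0 mulr_ge0.
rewrite Rintegral_sum // => [|i]; last exact: integrableZR.
apply: eq_bigr => i _; rewrite RintegralZl // /unif_laplace; ring.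
Qed.

Lemma dickman_poly p :
  Q.-integrable D (EFin \o (fun x => x * p.[expR (- x)])) /\
  \int[Q]_(x in D) (x * p.[expR (- x)]) = theta * \int[Q]_(x in D) unif_avg p x.
Proof.
have E x : x * p.[expR (- x)] = \sum_(i < size p) p`_i * (x * expR (- (i%:R * x))).
  by rewrite horner_expRN mulr_sumr; apply: eq_bigr => i _; rewrite mulrCA.
have sb (i : nat) := dickman_size_bias theta_gt0 Q_dickman (ler0n R i).
have int1 (i : nat) : Q.-integrable D (EFin \o (fun x => p`_i * (x * expR (- (i%:R * x))))).
  by apply: integrableZR => //; case: (sb i).
have int2 (i : nat) : Q.-integrable D (EFin \o (fun x => expR (- (i%:R * x)))).
  exact: (integrable_laplace Q_dickman).
rewrite (funext E : (fun x => x * p.[expR (- x)]) = _); split.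
  exact: (@integrable_sumR _ _ _ Q _ _ _ _ (fun i : 'I_(size p) => _)).
rewrite Rintegral_sum //.
under [in RHS]eq_Rintegral do rewrite unif_avgE.
rewrite Rintegral_sum // => [|i]; last exact: integrableZR.
rewrite mulr_sumr; apply: eq_bigr => i _.
have [I1 I2] := sb i.
by rewrite RintegralZl // I2 RintegralZl //; ring.
Qed.

Definition ray_poly (tau : R) n : {poly R} := (1 - 'X^(n.+1)) ^+ ray_deg tau n.

Lemma ray_polyE tau n x : (ray_poly tau n).[expR (- x)] = ray_approx tau n x.
Proof. by rewrite /ray_poly !hornerE. Qed.

(** The probability that x + U is at least tau, for U uniform on [0, 1]. *)
Definition ray_overlap (tau x : R) : R := Num.max 0 (1 - Num.max 0 (tau - x)).

Lemma ray_overlapE tau x :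
  \int[leb]_(t in `[0, 1]) ((tau <= x + t)%R%:R : R) = ray_overlap tau x.
Proof.
pose m : R := Num.max 0 (tau - x).
have E t : t \in (`[0%R, 1%R]%classic : set R) ->
    (tau <= x + t)%R%:R = ((fun=> 1 : R) \_ (`[m, +oo[%classic : set R)) t :> R.
  rewrite inE /= in_itv /= => /andP[t0 t1].
  rewrite patchE mem_setE in_itv /= andbT ge_max t0 /= lerBlDl.
  by case: ifP.
transitivity (\int[leb]_(t in `[0, 1]) ((fun=> 1 : R) \_ (`[m, +oo[%classic : set R)) t).
  by apply: eq_Rintegral => t; exact: E.
rewrite -Rintegral_mkcondr.
have -> : (`[0%R, 1%R]%classic `&` `[m, +oo[%classic : set R) = `[m, 1%R]%classic.
  rewrite eqEsubset; split => t /=; rewrite !in_itv /= ?andbT.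
    by case=> /andP[_ ->] ->.
  case/andP=> mt ->; rewrite mt andbT; split=> //.
  by move: mt; rewrite ge_max => /andP[].
rewrite Rintegral_cst // mul1r.
have -> : fine (leb (`[m, 1%R]%classic : set R)) = Num.max 0 (1 - m).
  rewrite lebesgue_measure_itv /= lte_fin; case: ltP => h /=.
    by rewrite max_r // subr_ge0 ltW.
  by rewrite max_l // subr_le0.
by [].
Qed.

Lemma measurable_ray_approx tau n (A : set R) : measurable_fun A (ray_approx tau n).
Proof.
apply: measurable_funTS; apply: measurable_funX; apply: measurable_funB => //.
apply: measurable_funX; apply: measurableT_comp => //.
Qed.

Lemma unif_avg_ray_cvg tau x : 0 < tau -> 0 <= x ->
  unif_avg (ray_poly tau n) x @[n --> \oo] --> ray_overlap tau x.
Proof.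
move=> tau0 x0; rewrite -ray_overlapE /unif_avg.
under eq_fun do under eq_Rintegral do rewrite ray_polyE.
have int1 : leb.-integrable (`[0%R, 1%R]%classic : set R) (EFin \o (fun=> 1)).
  by apply: integrable_cstR => //; exact: leb01c_lty.
have mF n : measurable_fun (`[0%R, 1%R]%classic : set R) (fun t => ray_approx tau n (x + t)).
  apply: measurable_funTS.
  by apply: measurableT_comp; [exact: measurable_ray_approx|exact: measurable_funD].
have cF t : `[0%R, 1%R]%classic t ->
    ray_approx tau n (x + t) @[n --> \oo] --> ((tau <= x + t)%R%:R : R).
  rewrite /= in_itv /= => /andP[t0 _].
  by apply: ray_approx_cvg => //; rewrite addr_ge0.
have bF n t : `[0%R, 1%R]%classic t -> `|ray_approx tau n (x + t)| <= 1.
  rewrite /= in_itv /= => /andP[t0 _].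
  have /andP[a0 a1] := ray_approx_itv tau n (addr_ge0 x0 t0).
  by rewrite ger0_norm.
by have [] := @Rintegral_dominated_cvg _ _ _ leb _ (measurable_itv _) _ _ _ mF cF int1 bF.
Qed.

Lemma unif_avg_ray_itv tau n x : 0 <= x -> 0 <= unif_avg (ray_poly tau n) x <= 1.
Proof.
move=> x0; rewrite /unif_avg.
under eq_Rintegral do rewrite ray_polyE.
have int1 : leb.-integrable (`[0%R, 1%R]%classic : set R) (EFin \o (fun=> 1)).
  by apply: integrable_cstR => //; exact: leb01c_lty.
have ap t : `[0%R, 1%R]%classic t -> 0 <= ray_approx tau n (x + t) <= 1.
  by rewrite /= in_itv /= => /andP[t0 _]; rewrite ray_approx_itv // addr_ge0.
apply/andP; split; first by apply: Rintegral_ge0 => t /ap /andP[].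
apply: (@le_trans _ _ (\int[leb]_(t in `[0, 1]) (1 : R))).
  apply: le_Rintegral => //; last by move=> t /ap /andP[].
  apply: (@integrable_dom _ _ _ _ _ _ _ (fun=> 1)) => //.
    apply: measurable_funTS.
    by apply: measurableT_comp; [exact: measurable_ray_approx|exact: measurable_funD].
  by move=> t /ap /andP[? ?]; rewrite ger0_norm.
rewrite Rintegral_cst // mul1r.
by have -> := congr1 fine leb01c.
Qed.

Lemma measurable_unif_avg p (A : set R) : measurable_fun A (unif_avg p).
Proof.
rewrite (funext (unif_avgE p) : unif_avg p = _).
apply: measurable_sum => i.
by apply: measurable_funM => //; exact: measurable_expRN.
Qed.

(** For tau > 0 the polynomial identity passes to the limit on both sides, dominated by x and by 1.
    For tau <= 0 the half-line contains the support and the claim is the value of the mean; this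
    case occurs, since the first threshold used below is negative. *)
Lemma dickman_ray tau :
  [/\ Q.-integrable D (EFin \o (fun x => x * (tau <= x)%R%:R)),
      Q.-integrable D (EFin \o ray_overlap tau) &
      \int[Q]_(x in D) (x * (tau <= x)%R%:R) = theta * \int[Q]_(x in D) ray_overlap tau x].
Proof.
have [intx Ex] := dickman_mean theta_gt0 Q_dickman.
have int1 : Q.-integrable D (EFin \o (fun=> 1)).
  by apply: integrable_cstR => //; exact: (dickman_mass_lty Q_dickman).
have [tau0|tau0] := lerP tau 0.
  have E1 x : x \in D -> x * (tau <= x)%R%:R = x.
    by rewrite inE halflineP => x0; rewrite (le_trans tau0 x0) mulr1.
  have E2 x : x \in D -> ray_overlap tau x = 1.
    rewrite inE halflineP => x0; rewrite /ray_overlap.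
    have -> : Num.max 0 (tau - x) = 0.
      by apply/max_idPl; rewrite subr_le0; exact: le_trans tau0 x0.
    by rewrite subr0 max_r.
  have -> : \int[Q]_(x in D) (x * (tau <= x)%R%:R) = \int[Q]_(x in D) x.
    exact: eq_Rintegral.
  have -> : \int[Q]_(x in D) ray_overlap tau x = \int[Q]_(x in D) 1.
    exact: eq_Rintegral.
  rewrite Ex Rintegral_cst //.
  have -> := congr1 fine (dickman_mass Q_dickman).
  rewrite mul1r mulr1; split=> //.
    by apply: eq_integrable intx => // x xD /=; rewrite E1.
  by apply: eq_integrable int1 => // x xD /=; rewrite E2.
have mF1 n : measurable_fun D (fun x => x * (ray_poly tau n).[expR (- x)]).
  by case: (dickman_poly (ray_poly tau n)) => /integrable_measurable.
have cF1 x : D x ->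
    x * (ray_poly tau n).[expR (- x)] @[n --> \oo] --> x * (tau <= x)%R%:R.
  rewrite halflineP => x0; apply: cvgMr.
  by under eq_fun do rewrite ray_polyE; exact: ray_approx_cvg.
have bF1 n x : D x -> `|x * (ray_poly tau n).[expR (- x)]| <= x.
  rewrite halflineP => x0; have /andP[a0 a1] := ray_approx_itv tau n x0.
  by rewrite ray_polyE ger0_norm ?mulr_ge0 // ler_piMr.
have [I1 C1] := @Rintegral_dominated_cvg _ _ _ Q _ (measurable_itv _) _ _ _ mF1 cF1 intx bF1.
have mF2 n : measurable_fun D (unif_avg (ray_poly tau n)) by exact: measurable_unif_avg.
have cF2 x : D x -> unif_avg (ray_poly tau n) x @[n --> \oo] --> ray_overlap tau x.
  by rewrite halflineP => x0; exact: unif_avg_ray_cvg.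
have bF2 n x : D x -> `|unif_avg (ray_poly tau n) x| <= 1.
  rewrite halflineP => x0.
  by have /andP[a0 a1] := unif_avg_ray_itv tau n x0; rewrite ger0_norm.
have [I2 C2] := @Rintegral_dominated_cvg _ _ _ Q _ (measurable_itv _) _ _ _ mF2 cF2 int1 bF2.
split=> //; rewrite -(cvg_lim _ C1) //; apply/cvg_lim => //.
under eq_fun do rewrite (dickman_poly _).2.
exact: cvgMr.
Qed.

End dickman_rays.

(** * Size biasing of the Dickman law on step functions *)

Section step_sums.
Context {R : realType}.
Variable n : nat.
Hypothesis n_gt0 : (0 < n)%N.
Variable g : nat -> R.

(** The length of the set of t in [0, n] with i <= w + t. *)
Definition step_overlap (w : R) i : R := Num.max 0 (n%:R - Num.max 0 (i%:R - w)).

Lemma step_overlap_nincr w i : step_overlap w i.+1 <= step_overlap w i.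
Proof.
rewrite /step_overlap ge_max le_max lexx /= le_max; apply/orP; right.
rewrite lerD2l lerN2 ge_max le_max lexx /= le_max; apply/orP; right.
by rewrite lerD2r ler_nat.
Qed.

Lemma step_overlap_lo w i : i%:R <= w -> step_overlap w i = n%:R.
Proof.
by move=> iw; rewrite /step_overlap [Num.max 0 (_ - w)](max_idPl _) ?subr_le0 // subr0; apply/max_idPr.
Qed.

Lemma step_overlap_mid w i : w <= i%:R -> i%:R <= w + n%:R ->
  step_overlap w i = n%:R - (i%:R - w).
Proof.
move=> wi iw; rewrite /step_overlap [Num.max 0 (_ - w)](max_idPr _) ?subr_ge0 //.
by apply/max_idPr; rewrite subr_ge0 lerBlDl.
Qed.

Lemma step_overlap_hi w i : w + n%:R <= i%:R -> step_overlap w i = 0.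
Proof.
move=> wi; have wi' : w <= i%:R by apply: le_trans wi; rewrite lerDl.
rewrite /step_overlap [Num.max 0 (_ - w)](max_idPr _) ?subr_ge0 //.
by apply/max_idPl; rewrite subr_le0 lerBrDl.
Qed.

(** The weight of g i is the length of the set of t in [0, n] for which w + t has integer part i. It
    is 1 at the inner indices, while the two end cells j and j + n share one unit of length. *)
Lemma step_overlap_sum w j M : j%:R <= w < j.+1%:R -> (j + n < M)%N ->
  \sum_(0 <= i < M) g i * (step_overlap w i - step_overlap w i.+1) =
  (j.+1%:R - w) * g j + \sum_(1 <= i < n) g (j + i)%N + (w - j%:R) * g (j + n)%N.
Proof.
move=> /andP[jw wj] jM.
have lo i : (i < j)%N -> step_overlap w i = n%:R.
  by move=> ij; apply: step_overlap_lo; apply: le_trans jw; rewrite ler_nat ltnW.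
have jn1 : (j < j + n)%N by rewrite -[X in (X < _)%N]addn0 ltn_add2l.
rewrite (big_cat_nat _ (n := j)) //=; last exact: ltnW (ltn_trans jn1 jM).
rewrite big_nat big1 ?add0r => [|i /andP[_ ij]]; last first.
  rewrite lo // step_overlap_lo ?subrr ?mulr0 //.
  by apply: le_trans jw; rewrite ler_nat.
rewrite (big_cat_nat _ (n := (j + n).+1)) //=; last exact: leqW (ltnW jn1).
rewrite [X in _ + X]big_nat [X in _ + X]big1 ?addr0 => [|i /andP[ji _]]; last first.
  have H : w + n%:R <= i%:R.
    apply: le_trans (_ : (j + n).+1%:R <= _); last by rewrite ler_nat.
    by rewrite -addSn natrD lerD2r ltW.
  rewrite !step_overlap_hi ?subrr ?mulr0 //.
  by apply: le_trans H _; rewrite ler_nat.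
rewrite big_nat_recr /=; last exact: ltnW.
rewrite big_ltn //=; congr (_ + _ + _).
- rewrite mulrC step_overlap_lo // step_overlap_mid //; first by congr (_ * _); ring.
    exact: ltW.
  by rewrite -natr1 lerD // ler1n.
- rewrite -[j.+1]/(1 + j)%N big_addn addKn; apply: eq_big_nat => i /andP[i1 i2].
  have iw : w <= (i + j)%:R.
    by rewrite (le_trans (ltW wj)) // ler_nat -add1n leq_add2r.
  rewrite step_overlap_mid // ?step_overlap_mid //.
  + by rewrite -natr1 [(i + j)%N]addnC -[RHS]mulr1; congr (_ * _); ring.
  + by rewrite (le_trans iw) // ler_nat.
  + rewrite -addSn natrD addrC lerD // ler_nat //.
  + by rewrite natrD addrC lerD // ler_nat ltnW.
- rewrite mulrC step_overlap_mid ?step_overlap_hi //.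
  + by congr (_ * _); rewrite natrD; ring.
  + by rewrite -addSn natrD lerD2r ltW.
  + by rewrite (le_trans (ltW wj)) // ler_nat.
  + by rewrite natrD lerD2r.
Qed.

(** The weights are nonnegative and add up to at most n whatever [M] is; this bound dominates the
    passage [M] to infinity. *)
Lemma step_overlap_sum_le w M (c : R) : (forall j, `|g j| <= c) ->
  `|\sum_(0 <= i < M) g i * (step_overlap w i - step_overlap w i.+1)| <= c * n%:R.
Proof.
move=> gc; have c0 : 0 <= c by apply: le_trans (gc 0%N).
apply: le_trans (ler_norm_sum _ _ _) _.
apply: le_trans (_ : \sum_(0 <= i < M) c * (step_overlap w i - step_overlap w i.+1) <= _).
  apply: ler_sum => i _; have H := step_overlap_nincr w i.
  by rewrite normrM ler_pM // ger0_norm ?subr_ge0.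
rewrite -mulr_sumr ler_wpM2l //.
have -> : \sum_(0 <= i < M) (step_overlap w i - step_overlap w i.+1) =
   step_overlap w 0%N - step_overlap w M.
  rewrite -[RHS]opprB -(telescope_sumr (step_overlap w)) // -sumrN.
  by apply: eq_bigr => i _; rewrite opprB.
apply: le_trans (_ : step_overlap w 0%N <= _).
  by rewrite gerBl /step_overlap le_max lexx.
rewrite /step_overlap ge_max ler0n /= gerBl.
by rewrite le_max lexx.
Qed.


End step_sums.

Section dickman_stein.
Context {R : realType}.
Variables (theta : R) (Q : probability (measurableTypeR R) R).
Hypothesis theta_gt0 : 0 < theta.
Hypothesis Q_dickman : is_dickman theta Q.
Local Notation D := (`[0%R, +oo[%classic : set R).
Variable n : nat.
Hypothesis n_gt0 : (0 < n)%N.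

(* [truncn (w x)] is [n * x] rounded to the nearest integer. *)
Let w (x : R) : R := n%:R * x + 2^-1.

Lemma truncn_w x : 0 <= x -> (Num.truncn (w x))%:R <= w x < (Num.truncn (w x)).+1%:R.
Proof. by move=> x0; apply: truncn_itv; rewrite /w addr_ge0 // mulr_ge0. Qed.

Section step.
Variable g : nat -> R.
Variable c : R.
Hypothesis gc : forall j, `|g j| <= c.

(** The integral of [g (Num.truncn (w x + t))] over t in [0, n] in closed form, that is, n times the
    mean of g at the rounded value of n (x + U). *)
Definition step_rhs (x : R) : R := let j := Num.truncn (w x) in
  (j.+1%:R - w x) * g j + \sum_(1 <= i < n) g (j + i)%N + (w x - j%:R) * g (j + n)%N.

Let bound (i : nat) : R := (i%:R - 2^-1) / n%:R.

Lemma bound_le i x : (bound i <= x) = (i%:R <= w x).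
Proof. by rewrite /bound ler_pdivrMr ?ltr0n // lerBlDr mulrC. Qed.

Lemma ray_overlap_bound i x : n%:R * ray_overlap (bound i) x = step_overlap n (w x) i.
Proof.
have n0 : 0 < n%:R :> R by rewrite ltr0n.
rewrite /ray_overlap /step_overlap maxr_pMr ?ler0n // mulr0 mulrBr mulr1.
rewrite maxr_pMr ?ler0n // mulr0 mulrBr /bound; congr (Num.max 0 (_ - Num.max 0 _)).
by rewrite mulrC divfK ?gt_eqF // /w; ring.
Qed.

Let step_lhs M (x : R) : R :=
  \sum_(0 <= i < M) g i * (x * (bound i <= x)%R%:R - x * (bound i.+1 <= x)%R%:R).

Lemma step_lhsE M x : 0 <= x ->
  step_lhs M x = if (Num.truncn (w x) < M)%N then x * g (Num.truncn (w x)) else 0.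
Proof.
move=> x0; rewrite /step_lhs; set j := Num.truncn _.
have w0 : 0 <= w x by rewrite /w addr_ge0 // mulr_ge0.
have E i : g i * (x * (bound i <= x)%R%:R - x * (bound i.+1 <= x)%R%:R) =
           if i == j then x * g j else 0.
  rewrite !bound_le -!truncn_ge_nat // -/j.
  by case: ltngtP => [h|h|->] /=; rewrite ?subrr ?mulr1 ?mulr0 ?subr0 ?mulr0 1?mulrC.
under eq_bigr do rewrite E.
by rewrite -big_mkcond /= big_nat1_eq.
Qed.

Let step_ov M (x : R) : R :=
  \sum_(0 <= i < M) g i * (ray_overlap (bound i) x - ray_overlap (bound i.+1) x).

Lemma step_ovE M x : n%:R * step_ov M x =
  \sum_(0 <= i < M) g i * (step_overlap n (w x) i - step_overlap n (w x) i.+1).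
Proof.
rewrite /step_ov mulr_sumr; apply: eq_bigr => i _.
by rewrite -!ray_overlap_bound; ring.
Qed.

(** A step function is a combination of differences of half-line indicators. [dickman_ray] applies
    to each of them, and the cut-off [M] is removed by dominated convergence, with dominating
    functions c x on the left and c n on the right. *)
Lemma dickman_step :
  [/\ Q.-integrable D (EFin \o (fun x => x * g (Num.truncn (w x)))),
      Q.-integrable D (EFin \o step_rhs) &
      n%:R * \int[Q]_(x in D) (x * g (Num.truncn (w x))) =
      theta * \int[Q]_(x in D) step_rhs x].
Proof.
have n0 : 0 < n%:R :> R by rewrite ltr0n.
have c0 : 0 <= c by apply: le_trans (gc 0%N).
have [intx Ex] := dickman_mean theta_gt0 Q_dickman.
have ray i := dickman_ray theta_gt0 Q_dickman (bound i).
have int1 i : Q.-integrable D (EFin \o (fun x =>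
    g i * (x * (bound i <= x)%R%:R - x * (bound i.+1 <= x)%R%:R))).
  by apply: integrableZR => //; apply: integrableBR => //; [case: (ray i)|case: (ray i.+1)].
have int2 i : Q.-integrable D (EFin \o (fun x =>
    g i * (ray_overlap (bound i) x - ray_overlap (bound i.+1) x))).
  by apply: integrableZR => //; apply: integrableBR => //; [case: (ray i)|case: (ray i.+1)].
have iL M : Q.-integrable D (EFin \o step_lhs M) by exact: integrable_sumR.
have iR M : Q.-integrable D (EFin \o (fun x => n%:R * step_ov M x)).
  by apply: integrableZR => //; exact: integrable_sumR.
have EM M : n%:R * \int[Q]_(x in D) step_lhs M x =
            theta * \int[Q]_(x in D) (n%:R * step_ov M x).
  rewrite RintegralZl //; last exact: integrable_sumR.
  rewrite mulrCA; congr (_ * _); rewrite !Rintegral_sum // mulr_sumr.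
  apply: eq_bigr => i _.
  have [i1 i2 i3] := ray i; have [j1 j2 j3] := ray i.+1.
  rewrite RintegralZl //; last exact: integrableBR.
  rewrite RintegralZl //; last exact: integrableBR.
  by rewrite !RintegralB // i3 j3; ring.
have ic : Q.-integrable D (EFin \o (fun=> c * n%:R)).
  by apply: integrable_cstR => //; exact: (dickman_mass_lty Q_dickman).
have icx : Q.-integrable D (EFin \o (fun x => c * x)) by exact: integrableZR.
have mL M : measurable_fun D (step_lhs M) by exact: integrable_measurable (iL M).
have mR M : measurable_fun D (fun x => n%:R * step_ov M x) by exact: integrable_measurable (iR M).
have cL x : D x -> step_lhs M x @[M --> \oo] --> x * g (Num.truncn (w x)).
  rewrite halflineP => x0; apply: (@cvg_trans _ (nbhs (cst (x * g (Num.truncn (w x))) @ \oo))); last exact: cvg_cst.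
  apply: near_eq_cvg; near=> M; rewrite step_lhsE // ifT //.
  by near: M; exact: nbhs_infty_gt.
have cR x : D x -> n%:R * step_ov M x @[M --> \oo] --> step_rhs x.
  rewrite halflineP => x0; apply: (@cvg_trans _ (nbhs (cst (step_rhs x) @ \oo))); last exact: cvg_cst.
  apply: near_eq_cvg; near=> M; rewrite step_ovE (@step_overlap_sum _ _ n_gt0 _ _ (Num.truncn (w x))) //.
    exact: truncn_w.
  by near: M; exact: nbhs_infty_gt.
have bL M x : D x -> `|step_lhs M x| <= c * x.
  rewrite halflineP => x0; rewrite step_lhsE //; case: ifP => _; last first.
    by rewrite normr0 mulr_ge0.
  by rewrite normrM ger0_norm // mulrC ler_wpM2r.
have bR M x : D x -> `|n%:R * step_ov M x| <= c * n%:R.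
  by move=> _; rewrite step_ovE; exact: step_overlap_sum_le.
have [IL CL] := @Rintegral_dominated_cvg _ _ _ Q _ (measurable_itv _) _ _ _ mL cL icx bL.
have [IR CR] := @Rintegral_dominated_cvg _ _ _ Q _ (measurable_itv _) _ _ _ mR cR ic bR.
split=> //.
have H1 : n%:R * \int[Q]_(x in D) step_lhs M x @[M --> \oo] -->
    n%:R * \int[Q]_(x in D) (x * g (Num.truncn (w x))) by exact: cvgMr.
have H2 : n%:R * \int[Q]_(x in D) step_lhs M x @[M --> \oo] -->
    theta * \int[Q]_(x in D) step_rhs x.
  by under eq_fun do rewrite EM; exact: cvgMr.
by rewrite -(cvg_lim _ H1) // -(cvg_lim _ H2).
Unshelve. all: by end_near.
Qed.

End step.

(** By [dickman_step] the function [h] of the proof has integral zero and may be added to f. With n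
    x = j + v and |v| <= 1/2, the Stein equation at j cancels the main terms pointwise. There remain
    the rounding of f and v g(j), each at most 1/(2n), the end correction theta (1/2 - v)(g j - g (j
    + n)), at most 2 theta / n, and the drift of [fN], at most (n x + 1/2) kap, whose integral
    brings in the mean [theta]. *)
Lemma dickman_stein_bound (f : R -> R) (fN g : nat -> R) (kap : R) :
  (forall x y, `|f x - f y| <= `|x - y|) -> measurable_fun D f ->
  (forall j, `|g j| <= n%:R^-1) ->
  (forall j, theta * \sum_(1 <= i < n.+1) g (j + i)%N - j%:R * g j = fN j - f (j%:R / n%:R)) ->
  (forall j, `|fN j - fN 0%N| <= j%:R * kap) ->
  Q.-integrable D (EFin \o f) /\
  `|\int[Q]_(x in D) f x - fN 0%N| <= n%:R^-1 * (1 + 2 * theta) + (n%:R * theta + 2^-1) * kap.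
Proof.
move=> fL mf gn stein fNk.
have n0 : 0 < n%:R :> R by rewrite ltr0n.
have nV : n%:R * n%:R^-1 = 1 :> R by rewrite mulfV // gt_eqF.
have [intx Ex] := dickman_mean theta_gt0 Q_dickman.
have int1 (c : R) : Q.-integrable D (EFin \o (fun=> c)).
  by apply: integrable_cstR => //; exact: (dickman_mass_lty Q_dickman).
have QD (c : R) : \int[Q]_(x in D) c = c.
  rewrite Rintegral_cst //.
  by have -> := congr1 fine (dickman_mass Q_dickman); rewrite mulr1.
have intf : Q.-integrable D (EFin \o f).
  apply: (@integrable_dom _ _ _ Q _ (measurable_itv _) f (fun x => `|f 0| + x)) => //.
    move=> x; rewrite halflineP => x0.
    rewrite -[f x](subrK (f 0)) addrC (le_trans (ler_normD _ _)) // lerD2l.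
    by rewrite (le_trans (fL _ _)) // subr0 ger0_norm.
  exact: integrableDR.
split=> //.
have [I1 I2 E] := dickman_step gn.
pose h x := theta * step_rhs g x - n%:R * (x * g (Num.truncn (w x))).
have Ih : Q.-integrable D (EFin \o h) by apply: integrableBR => //; exact: integrableZR.
have h0 : \int[Q]_(x in D) h x = 0.
  rewrite /h RintegralB //; [|exact: integrableZR..].
  by rewrite !RintegralZl // E subrr.
rewrite -[fN 0%N]QD -RintegralB // -[X in `|X|]addr0 -[X in _ + X]h0 -RintegralD //; last exact: integrableBR.
have kap0 : 0 <= kap by have := le_trans (normr_ge0 _) (fNk 1%N); rewrite mul1r.
have -> : n%:R^-1 * (1 + 2 * theta) + (n%:R * theta + 2^-1) * kap =
   \int[Q]_(x in D) ((n%:R^-1 * (1 + 2 * theta) + 2^-1 * kap) + (n%:R * kap) * x).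
  rewrite RintegralD //; last exact: integrableZR.
  by rewrite QD RintegralZl // Ex; ring.
apply: Rintegral_norm_le => //.
- have i1 : Q.-integrable D (EFin \o (fun x => f x - fN 0%N)) by exact: integrableBR.
  have i2 : Q.-integrable D (EFin \o (fun x => f x - fN 0%N + h x)) by exact: integrableDR.
  exact: integrable_measurable i2.
- move=> x; rewrite halflineP => x0; have /andP[jw wj] := truncn_w x0.
  rewrite /h /step_rhs /=; set j := Num.truncn (w x).
  set v := w x - j%:R - 2^-1.
  have vE : n%:R * x = j%:R + v by rewrite /v /w; lra.
  have v1 : - 2^-1 <= v <= 2^-1 by move: jw wj; rewrite -/j -natr1 /v; lra.
  have -> : f x - fN 0%N + (theta * ((j.+1%:R - w x) * g j + \sum_(1 <= i < n) g (j + i)%N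
      + (w x - j%:R) * g (j + n)%N) - n%:R * (x * g j)) =
     (f x - f (j%:R / n%:R)) + (fN j - fN 0%N)
     + (theta * (2^-1 - v) * (g j - g (j + n)%N)) - v * g j.
    have := stein j; rewrite big_nat_recr //= => S.
    rewrite mulrA vE -natr1.
    have -> : w x = j%:R + v + 2^-1 by rewrite /w vE.
    have -> : f (j%:R / n%:R) =
        fN j - (theta * (\sum_(1 <= i < n) g (j + i)%N + g (j + n)%N) - j%:R * g j).
      by rewrite S opprB addrC subrK.
    move: (\sum_(1 <= i < n) _) (fN j) (fN 0%N) (f x) (g j) (g (j + n)%N) (j%:R : R).
    by move=> s a b fx gj gjn J; field.
  have vn : `|v| <= 2^-1 by rewrite ler_norml.
  have nV0 : 0 <= n%:R^-1 :> R by rewrite invr_ge0.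
  have T1 : `|f x - f (j%:R / n%:R)| <= 2^-1 * n%:R^-1.
    apply: le_trans (fL _ _) _.
    have -> : x - j%:R / n%:R = v * n%:R^-1.
      by apply: (mulfI (lt0r_neq0 n0)); rewrite mulrBr vE mulrCA [in RHS]mulrCA nV; ring.
    by rewrite normrM (ger0_norm nV0) ler_wpM2r.
  have T2 : `|fN j - fN 0%N| <= 2^-1 * kap + n%:R * kap * x.
    apply: le_trans (fNk j) _; rewrite -mulrA [kap * x]mulrC mulrA -mulrDl.
    by rewrite ler_wpM2r // addrC.
  have T3 : `|theta * (2^-1 - v) * (g j - g (j + n)%N)| <= n%:R^-1 * (2 * theta).
    have /andP[v0 v2] := v1.
    rewrite normrM ger0_norm; last by rewrite mulr_ge0 ?subr_ge0 // ltW.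
    have gg : `|g j - g (j + n)%N| <= n%:R^-1 * 2.
      by rewrite mulr_natr mulr2n (le_trans (ler_normB _ _)) // lerD.
    have t1 : theta * (2^-1 - v) <= theta.
      by apply: ler_piMr; [exact: ltW|move: v0; lra].
    apply: le_trans (_ : theta * (n%:R^-1 * 2) <= _); last by rewrite mulrCA [theta * 2]mulrC.
    by apply: ler_pM => //; rewrite mulr_ge0 ?subr_ge0 // ltW.
  have T4 : `|v * g j| <= 2^-1 * n%:R^-1 by rewrite normrM ler_pM.
  apply: le_trans (ler_normB _ _) _.
  apply: le_trans (_ : (2^-1 * n%:R^-1 + (2^-1 * kap + n%:R * kap * x) +
     n%:R^-1 * (2 * theta)) + 2^-1 * n%:R^-1 <= _).
    rewrite lerD // (le_trans (ler_normD _ _)) // lerD //.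
    by rewrite (le_trans (ler_normD _ _)) // lerD.
  by rewrite le_eqVlt; apply/orP; left; apply/eqP; field; rewrite gt_eqF.
- by apply: integrableDR => //; exact: integrableZR.
Qed.

End dickman_stein.

(** * Random variables with values in nat *)

Section nat_random_variables.
Context d (T : measurableType d) (R : realType) (P : probability T R).
Implicit Types X Y : T -> nat.

Lemma measurable_natfun d' (U : measurableType d') X (h : nat -> U) :
  measurable_fun setT X -> measurable_fun setT (h \o X).
Proof. by move=> mX; exact: measurableT_comp. Qed.

Lemma measurable_nateq X k : measurable_fun setT X -> measurable [set w | X w = k].
Proof. by move=> mX; rewrite -[A in measurable A]setTI; exact: (mX _ [set k]). Qed.

Lemma indicatorE X k w : \1_[set w | X w = k] w = (X w == k)%:R :> R.
Proof. by rewrite indicE; congr (nat_of_bool _)%:R; apply/idP/eqP; rewrite inE. Qed.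

Lemma nneseries_pick (h : nat -> \bar R) (n : nat) : (forall k, 0 <= h k)%E ->
  (\sum_(0 <= k <oo) h k * (n == k)%:R%:E = h n)%E.
Proof.
move=> h0; rewrite (@nneseriesD1 _ _ n) //; last first.
  by move=> k _; apply: mule_ge0 => //; rewrite lee_fin.
rewrite eqxx mule1 eseries0 ?adde0 // => k _ /= kn.
by rewrite eq_sym (negbTE kn) mule0.
Qed.

Lemma integral_natfun X (h : nat -> \bar R) :
  measurable_fun setT X -> (forall k, 0 <= h k)%E ->
  (\int[P]_w h (X w) = \sum_(0 <= k <oo) h k * P [set w | X w = k])%E.
Proof.
move=> mX h0.
under eq_integral do rewrite -nneseries_pick //.
rewrite integral_nneseries //.
- apply: eq_eseriesr => k _; under eq_integral do rewrite -indicatorE.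
  rewrite ge0_integralZl //.
  + rewrite integral_indic //; last exact: measurable_nateq.
    by rewrite setIT.
  + apply/measurable_EFinP; apply: measurable_indic; exact: measurable_nateq.
- by move=> k; apply: (@measurable_natfun _ _ X (fun j => h k * (j == k)%:R%:E)%E).
- by move=> k x _; apply: mule_ge0 => //; rewrite lee_fin.
Qed.

Lemma measurable_nat2 d' (U : measurableType d') (f : nat -> nat -> U) :
  measurable_fun setT (fun p : nat * nat => f p.1 p.2).
Proof.
move=> _ A mA; rewrite setTI.
have -> : (fun p : nat * nat => f p.1 p.2) @^-1` A =
  \bigcup_k \bigcup_(l in [set l | A (f k l)]) ([set k] `*` [set l]).
  apply/seteqP; split => [[k l] /= Akl|[k l] [k' _ [l' /= Akl [/= -> ->]]] //].
  by exists k => //; exists l.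
apply: bigcup_measurable => k _; apply: bigcup_measurable => l _.
exact: measurableX.
Qed.

Lemma measurable_natfun2 d' (U : measurableType d') X Y (f : nat -> nat -> U) :
  measurable_fun setT X -> measurable_fun setT Y ->
  measurable_fun setT (fun w => f (X w) (Y w)).
Proof.
move=> mX mY; have mp : measurable_fun setT (fun w => (X w, Y w)).
  exact: measurable_fun_pair.
exact: (measurableT_comp (measurable_nat2 f) mp).
Qed.

Lemma integral_natfun_pick X Y (h : nat -> nat -> \bar R) :
  measurable_fun setT X -> measurable_fun setT Y ->
  (forall k l, 0 <= h k l)%E ->
  (\int[P]_w h (X w) (Y w) =
   \sum_(0 <= k <oo) \int[P]_w (h k (Y w) * (X w == k)%:R%:E))%E.
Proof.
move=> mX mY h0.
under eq_integral => w _ do rewrite -(@nneseries_pick (fun k => h k (Y w)) (X w)) //.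
rewrite integral_nneseries //.
- by move=> k; apply: (@measurable_natfun2 _ _ X Y (fun x y => h k y * (x == k)%:R%:E)%E).
- by move=> k x _; apply: mule_ge0 => //; rewrite lee_fin.
Qed.

Definition indep_nat X Y := forall k l,
  (P ([set w | X w = k] `&` [set w | Y w = l]) =
   P [set w | X w = k] * P [set w | Y w = l])%E.

(** Both sides are expanded into double series over the atoms of [X] and [Y], where independence is
    the factorization of each term; no product measure is involved. *)
Lemma indep_fubini_ge0 X Y (h : nat -> nat -> \bar R) :
  measurable_fun setT X -> measurable_fun setT Y -> indep_nat X Y ->
  (forall k l, 0 <= h k l)%E ->
  (\int[P]_w h (X w) (Y w) = \int[P]_w \int[P]_w' h (X w) (Y w'))%E.
Proof.
move=> mX mY XY h0.
rewrite (integral_natfun (h := fun k => \int[P]_w' h k (Y w')))%E //; last first.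
  by move=> k; exact: integral_ge0.
rewrite integral_natfun_pick //; apply: eq_eseriesr => k _.
have inner : (\int[P]_w (h k (Y w) * (X w == k)%:R%:E) =
    \sum_(0 <= l <oo) h k l * P ([set w | X w = k] `&` [set w | Y w = l]))%E.
  rewrite (@integral_natfun_pick Y X (fun l x => h k l * (x == k)%:R%:E)%E) //; last first.
    by move=> l x; apply: mule_ge0 => //; rewrite lee_fin.
  apply: eq_eseriesr => l _.
  have mI : measurable ([set w | X w = k] `&` [set w | Y w = l]).
    by apply: measurableI; exact: measurable_nateq.
  rewrite -[A in (_ * P A)%E]setIT -integral_indic // -ge0_integralZl //.
  - apply: eq_integral => w _; rewrite -muleA -EFinM; congr (_ * _%:E)%E.
    by rewrite indicI -!indicatorE.
  - by apply/measurable_EFinP; apply: measurable_indic.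
rewrite inner (integral_natfun (h := h k)) // muleC.
have -> : P [set w | X w = k] = (fine (P [set w | X w = k]))%:E.
  by rewrite fineK // fin_num_measure //; exact: measurable_nateq.
rewrite -nneseriesZl; last by move=> l _; exact: mule_ge0.
apply: eq_eseriesr => l _; rewrite XY muleCA; congr (_ * _)%E.
by rewrite fineK // fin_num_measure //; exact: measurable_nateq.
Qed.

Lemma prob_lty : (P setT < +oo)%E.
Proof. by rewrite (@probability_setT _ _ _ P) ltry. Qed.

Lemma Rintegral_prob_cst (c : R) : \int[P]_w c = c.
Proof.
rewrite Rintegral_cst //.
by have -> := congr1 fine (@probability_setT _ _ _ P); rewrite mulr1.
Qed.

Lemma integrable_prob_cst (c : R) : P.-integrable setT (EFin \o (fun=> c)).
Proof. by apply: integrable_cstR => //; exact: prob_lty. Qed.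

Lemma integrable_natfun X (f : nat -> R) c : measurable_fun setT X ->
  (forall k, `|f k| <= c) -> P.-integrable setT (EFin \o (f \o X)).
Proof.
move=> mX fc; exact: (@integrable_bounded _ _ _ P setT measurableT (f \o X) c
  prob_lty (measurable_natfun f mX) (fun w _ => fc _)).
Qed.

(** Adding the bound b (X) makes the integrand nonnegative, and it is subtracted afterwards. The
    bound may grow with [X], as required for integrands of the form X times a bounded function. *)
Lemma indep_fubini X Y (f : nat -> nat -> R) (b : nat -> R) :
  measurable_fun setT X -> measurable_fun setT Y -> indep_nat X Y ->
  (forall k l, `|f k l| <= b k) -> P.-integrable setT (EFin \o (b \o X)) ->
  [/\ P.-integrable setT (EFin \o (fun w => f (X w) (Y w))),
     P.-integrable setT (EFin \o (fun w => \int[P]_w' f (X w) (Y w'))) &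
  \int[P]_w f (X w) (Y w) = \int[P]_w \int[P]_w' f (X w) (Y w')].
Proof.
move=> mX mY XY fb intb.
have b0 k : 0 <= b k by apply: le_trans (fb k 0%N).
have intfk k : P.-integrable setT (EFin \o (fun w => f k (Y w))).
  by apply: (@integrable_natfun Y (f k) (b k)).
pose F k := \int[P]_w f k (Y w).
have Fb k : `|F k| <= b k.
  rewrite -[leRHS](Rintegral_prob_cst (b k)).
  apply: Rintegral_norm_le => //; first exact: measurable_natfun.
  exact: integrable_prob_cst.
have intF : P.-integrable setT (EFin \o (F \o X)).
  apply: integrable_dom intb => //; first exact: measurable_natfun.
  by move=> w _; exact: Fb.
have main : (\int[P]_w (f (X w) (Y w) + b (X w))%:E =
             \int[P]_w (F (X w) + b (X w))%:E)%E.
  rewrite (@indep_fubini_ge0 X Y (fun k l => (f k l + b k)%:E)) //; last first.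
    move=> k l; rewrite lee_fin; have := fb k l; rewrite ler_norml; lra.
  apply: eq_integral => w _.
  rewrite Rintegral_EFin //; last first.
    by apply: integrableDR => //; exact: integrable_prob_cst.
  rewrite RintegralD //; last exact: integrable_prob_cst.
  by rewrite Rintegral_prob_cst.
have mfXY : measurable_fun setT (fun w => f (X w) (Y w)) by exact: measurable_natfun2.
have intf : P.-integrable setT (EFin \o (fun w => f (X w) (Y w))).
  by apply: integrable_dom intb => // w _; exact: fb.
split=> //.
apply: (addIr (\int[P]_w b (X w))); rewrite -!RintegralD //.
by congr fine.
Qed.

End nat_random_variables.

(** * Sums over disjoint families of summands *)

Section weighted_sums.
Context d (T : measurableType d) (R : realType) (P : probability T R).
Variables (r : nat -> nat) (Z : nat -> nat -> {RV P >-> nat}).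
Hypothesis Z_indep : mutually_independent (index_set r) (fun p : nat * nat => Z p.1 p.2).
Implicit Types s : seq (nat * nat).

Definition sample s w : seq nat := [seq Z p.1 p.2 w | p <- s].

Let Jset s : {fset nat * nat} := [fset p in s]%fset.

(* Independence of two disjoint subfamilies is then independence of two
   variables with values in [nat]. *)
Let code s w : nat := choice.pickle (sample s w).

Lemma measurable_code s : measurable_fun setT (code s).
Proof.
elim: s => [|p s IH]; first exact: measurable_cst.
pose F k l : nat := choice.pickle (k :: odflt [::] (@choice.unpickle (seq nat) l)).
have -> : code (p :: s) = fun w => F (Z p.1 p.2 w) (code s w).
  by apply/funext => w; rewrite /F /code choice.pickleK.
by apply: measurable_natfun2 => //; exact: measurable_funPT.
Qed.

Lemma sample_prob s (f : nat * nat -> nat) : uniq s -> {in s, forall p, index_set r p} ->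
  P [set w | sample s w = map f s] =
  (\prod_(p <- s) fine (P [set w | Z p.1 p.2 w = f p]))%:E.
Proof.
move=> us sI.
have H := Z_indep (J := Jset s) _ (A := fun p => [set f p]) _.
have -> : [set w | sample s w = map f s] =
    \bigcap_(p in [set` Jset s]) (Z p.1 p.2 @^-1` [set f p]).
  apply/seteqP; split => w /=.
    by move=> /eq_in_map E p /=; rewrite !inE => ps; exact: E.
  by move=> E; apply/eq_in_map => p ps; apply: (E p) => /=; rewrite !inE.
rewrite H //; first congr (_%:E); last by move=> p /=; rewrite inE; exact: sI.
by apply: perm_big; apply: uniq_perm => // p; rewrite inE.
Qed.

Lemma indep_code s1 s2 : uniq (s1 ++ s2) -> {in s1 ++ s2, forall p, index_set r p} ->
  indep_nat P (code s1) (code s2).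
Proof.
move=> us sI k l.
have sub1 : {in s1, forall p, index_set r p} by move=> p ps; apply: sI; rewrite mem_cat ps.
have sub2 : {in s2, forall p, index_set r p} by move=> p ps; apply: sI; rewrite mem_cat ps orbT.
have [us1 us2] : uniq s1 /\ uniq s2 by move: us; rewrite cat_uniq => /and3P[].
have codeE s v : [set w | code s w = choice.pickle v] = [set w | sample s w = v].
  apply/seteqP; split => w /=; last by move=> <-.
  by move/(congr1 (@choice.unpickle (seq nat))); rewrite !choice.pickleK => -[].
(* A number that does not encode a list of the right length is never attained, and both sides are
   then zero. *)
have [[v1 [-> z1]]|n1] := pselect (exists v : seq nat, k = choice.pickle v /\ size v = size s1); last first.
  have -> : [set w | code s1 w = k] = set0.
    by apply/seteqP; split => // w /= E; case: n1; exists (sample s1 w); rewrite size_map.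
  by rewrite set0I measure0 mul0e.
have [[v2 [-> z2]]|n2] := pselect (exists v : seq nat, l = choice.pickle v /\ size v = size s2); last first.
  have -> : [set w | code s2 w = l] = set0.
    by apply/seteqP; split => // w /= E; case: n2; exists (sample s2 w); rewrite size_map.
  by rewrite setI0 measure0 mule0.
pose f p := nth 0%N (v1 ++ v2) (index p (s1 ++ s2)).
have fE : map f (s1 ++ s2) = v1 ++ v2.
  apply: (@eq_from_nth _ 0%N); first by rewrite size_map !size_cat z1 z2.
  move=> i; rewrite size_map => i_lt.
  by rewrite (nth_map (0, 0)%N) // /f index_uniq.
have [E1 E2] : map f s1 = v1 /\ map f s2 = v2.
  by move/eqP: fE; rewrite map_cat eqseq_cat ?size_map // => /andP[/eqP-> /eqP->].
rewrite !codeE -E1 -E2 !sample_prob // -EFinM -big_cat /= -sample_prob //.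
congr (P _); apply/seteqP; split => w /=; rewrite /sample !map_cat.
  by case=> -> ->.
by move/eqP; rewrite eqseq_cat ?size_map // => /andP[/eqP-> /eqP->].
Qed.

Lemma measurable_sample_fun s (a : seq nat -> nat) :
  measurable_fun setT (fun w => a (sample s w)).
Proof.
have -> : (fun w => a (sample s w)) =
    (fun k => a (odflt [::] (@choice.unpickle (seq nat) k))) \o code s.
  by apply/funext => w; rewrite /comp /code choice.pickleK.
apply: measurable_natfun; exact: measurable_code.
Qed.

Lemma sample_fubini s1 s2 (a b : seq nat -> nat) (f : nat -> nat -> R) (bd : nat -> R) :
  uniq (s1 ++ s2) -> {in s1 ++ s2, forall p, index_set r p} ->
  (forall k l, `|f k l| <= bd k) ->
  P.-integrable setT (EFin \o (fun w => bd (a (sample s1 w)))) ->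
  [/\ P.-integrable setT (EFin \o (fun w => f (a (sample s1 w)) (b (sample s2 w)))),
      P.-integrable setT (EFin \o (fun w => \int[P]_w' f (a (sample s1 w)) (b (sample s2 w')))) &
  \int[P]_w f (a (sample s1 w)) (b (sample s2 w)) =
  \int[P]_w \int[P]_w' f (a (sample s1 w)) (b (sample s2 w'))].
Proof.
move=> us sI fb ib.
pose dec k := odflt [::] (@choice.unpickle (seq nat) k).
have decE s w : dec (code s w) = sample s w by rewrite /dec /code choice.pickleK.
have [] := @indep_fubini _ _ _ P (code s1) (code s2) (fun k l => f (a (dec k)) (b (dec l)))
  (fun k => bd (a (dec k))).
- exact: measurable_code.
- exact: measurable_code.
- exact: indep_code.
- by move=> k l; exact: fb.
- by rewrite (_ : bd \o a \o dec \o code s1 = fun w => bd (a (sample s1 w))) //;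
    apply/funext => w /=; rewrite decE.
rewrite (_ : (fun w => f (a (dec (code s1 w))) (b (dec (code s2 w)))) =
  fun w => f (a (sample s1 w)) (b (sample s2 w))); last first.
  by apply/funext => w; rewrite !decE.
rewrite (_ : (fun w => \int[P]_w' f (a (dec (code s1 w))) (b (dec (code s2 w')))) =
  fun w => \int[P]_w' f (a (sample s1 w)) (b (sample s2 w'))); last first.
  apply/funext => w; rewrite decE; congr (Rintegral _ _ _).
  by apply/funext => w'; rewrite decE.
by move=> ? ? ?; split.
Qed.

Definition wsum s w : nat := (\sum_(p <- s) p.1 * Z p.1 p.2 w)%N.

Definition wdot s (v : seq nat) : nat := (\sum_(q <- zip s v) q.1.1 * q.2)%N.

Lemma wsumE s w : wsum s w = wdot s (sample s w).
Proof.
by rewrite /wsum /wdot; elim: s => [|p s IH]; rewrite ?big_nil //= !big_cons IH.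
Qed.

Lemma measurable_wsum s : measurable_fun setT (wsum s).
Proof.
by rewrite (funext (wsumE s) : wsum s = _); exact: measurable_sample_fun.
Qed.

Lemma wsum_cat s1 s2 w : wsum (s1 ++ s2) w = (wsum s1 w + wsum s2 w)%N.
Proof. by rewrite /wsum big_cat. Qed.

Lemma perm_wsum s1 s2 w : perm_eq s1 s2 -> wsum s1 w = wsum s2 w.
Proof. by move=> p12; rewrite /wsum; exact: perm_big. Qed.

Lemma wsum_fubini s1 s2 (f : nat -> nat -> R) c :
  uniq (s1 ++ s2) -> {in s1 ++ s2, forall p, index_set r p} ->
  (forall k l, `|f k l| <= c) ->
  \int[P]_w f (wsum s1 w) (wsum s2 w) =
  \int[P]_w \int[P]_w' f (wsum s1 w) (wsum s2 w').
Proof.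
move=> us sI fc.
have [] := @sample_fubini s1 s2 (wdot s1) (wdot s2) f (fun=> c) us sI fc.
  exact: integrable_prob_cst.
move=> _ _; rewrite (_ : (fun w => f (wdot s1 (sample s1 w)) (wdot s2 (sample s2 w))) =
  fun w => f (wsum s1 w) (wsum s2 w)); last by apply/funext => w; rewrite !wsumE.
move=> ->; congr (Rintegral _ _ _); apply/funext => w.
congr (Rintegral _ _ _); apply/funext => w'; by rewrite !wsumE.
Qed.

Definition index_pairs (S : seq nat) : seq (nat * nat) :=
  [seq (i, j) | i <- S, j <- index_iota 1 (r i).+1].

Lemma mem_index_pairs S p : (p \in index_pairs S) = (p.1 \in S) && (1 <= p.2 <= r p.1)%N.
Proof.
case: p => i j; apply/allpairsPdep/idP => [[i' [j' [iS]]]|].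
  by rewrite mem_index_iota ltnS => jr [-> ->] /=; rewrite iS.
by move=> /= /andP[iS jr]; exists i, j; split => //; rewrite mem_index_iota ltnS.
Qed.

Lemma index_pairs_uniq S : uniq S -> uniq (index_pairs S).
Proof.
move=> uS; apply: allpairs_uniq_dep => //.
- by move=> i _; exact: iota_uniq.
- by move=> [i j] [i' j'] _ _ [-> ->].
Qed.

Lemma index_pairs_sub S : {in S, forall i, (1 <= i)%N} ->
  {in index_pairs S, forall p, index_set r p}.
Proof.
by move=> S1 p; rewrite mem_index_pairs => /andP[/S1 p1 p2]; rewrite /index_set /= p1.
Qed.

Lemma index_pairs_cat S1 S2 : index_pairs (S1 ++ S2) = index_pairs S1 ++ index_pairs S2.
Proof. by rewrite /index_pairs map_cat flatten_cat. Qed.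

Lemma wsum_index_pairs S w : wsum (index_pairs S) w = (\sum_(i <- S) i * Zsum r Z i w)%N.
Proof.
rewrite /wsum big_allpairs_dep /=; apply: eq_bigr => i _.
by rewrite /Zsum big_distrr.
Qed.

Lemma Tsum_wsum a n w : Tsum r Z a n w = wsum (index_pairs (index_iota a.+1 n.+1)) w.
Proof. by rewrite wsum_index_pairs. Qed.

End weighted_sums.

(** * Unit shifts in total variation *)

Section total_variation.
Context d (T : measurableType d) (R : realType) (P : probability T R).

Lemma D1_has_sup (X : {mfun T >-> nat}) :
  has_sup [set `|fine (distribution P X A) - fine (distribution P (shift1 X) A)| |
            A in measurable].
Proof.
split; first by exists `|fine (distribution P X set0) - fine (distribution P (shift1 X) set0)|, set0.
exists 1 => _ [A mA <-].
have h (Q : probability nat R) : 0 <= fine (Q A) <= 1.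
  rewrite fine_ge0 //= -lee_fin fineK ?fin_num_measure //; exact: probability_le1.
have := h (distribution P X); have := h (distribution P (shift1 X)).
by rewrite ler_norml; lra.
Qed.

Lemma D1_ub (X : {mfun T >-> nat}) (A : set nat) :
  `|fine (P [set w | A (X w)]) - fine (P [set w | A (X w).+1])| <= D1 P X.
Proof.
rewrite /D1 /dTV; apply: sup_upper_bound; first exact: D1_has_sup.
by exists A.
Qed.

Lemma D1_ge0 (X : {mfun T >-> nat}) : 0 <= D1 P X.
Proof. by apply: le_trans (D1_ub X set0). Qed.

Lemma Rintegral_natfun_mono (X Y : T -> nat) (u : nat -> R) c :
  measurable_fun setT X -> measurable_fun setT Y -> (forall k, 0 <= u k <= c) ->
  (forall k, u k != 0 -> (P [set w | X w = k] <= P [set w | Y w = k])%E) ->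
  \int[P]_w u (X w) <= \int[P]_w u (Y w).
Proof.
move=> mX mY uc XY.
have u0 k : (0 <= (u k)%:E)%E by rewrite lee_fin; case/andP: (uc k).
have un k : `|u k| <= c by case/andP: (uc k) => a b; rewrite ger0_norm.
have iX := integrable_natfun P mX un; have iY := integrable_natfun P mY un.
rewrite -lee_fin -!Rintegral_EFin //.
rewrite (@integral_natfun _ _ _ P X (fun k => (u k)%:E)) //.
rewrite (@integral_natfun _ _ _ P Y (fun k => (u k)%:E)) //.
apply: lee_nneseries => [k _ _|k _]; first exact: mule_ge0.
have [->|nz] := eqVneq (u k) 0; first by rewrite !mul0e.
by apply: lee_wpmul2l; [exact: u0|exact: XY].
Qed.

Lemma Rintegral_indic_nat (X : T -> nat) (A : set nat) : measurable_fun setT X ->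
  \int[P]_w (\1_A (X w) : R) = fine (P [set w | A (X w)]).
Proof.
move=> mX; have mA : measurable [set w | A (X w)].
  by rewrite -[B in measurable B]setTI; exact: (mX _ A).
rewrite /Rintegral; congr fine.
rewrite -[in RHS](setIT [set w | A (X w)]) -integral_indic //.
Qed.

(** [A] is the Hahn set on which the law of X + 1 dominates that of X. In g = 2c 1_A - u + v - c,
    the function u >= 0 is carried by [A] and v >= 0 by its complement, so the shift changes both in
    the favourable direction and only the difference of the probabilities of [A], times 2c,
    remains. *)
Lemma D1_shift_le (X : {mfun T >-> nat}) (g : nat -> R) c : (forall k, `|g k| <= c) ->
  \int[P]_w g (X w).+1 - \int[P]_w g (X w) <= 2 * c * D1 P X.
Proof.
move=> gc; have c0 : 0 <= c by apply: le_trans (gc 0%N).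
have gc2 k : 0 <= c - g k <= 2 * c /\ 0 <= c + g k <= 2 * c.
  by have := gc k; rewrite ler_norml; lra.
have mX : measurable_fun setT X by exact: measurable_funPT.
have mX1 : measurable_fun setT (fun w => (X w).+1) by exact: (measurable_shift1 X).
pose A : set nat := [set k | (P [set w | X w = k] <= P [set w | (X w).+1 = k])%E].
have i01 (B : set nat) k : \1_B k = 0 :> R \/ \1_B k = 1 :> R.
  by rewrite indicE; case: (_ \in _); [right|left].
have ib (Y : T -> nat) (f : nat -> R) : measurable_fun setT Y -> (forall k, `|f k| <= 2 * c) ->
    P.-integrable setT (EFin \o (fun w => f (Y w))).
  by move=> mY fc; exact: (integrable_natfun P mY fc).
pose u k := (c - g k) * \1_A k : R; pose v k := (c + g k) * \1_(~` A) k : R.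
have uc k : 0 <= u k <= 2 * c.
  by rewrite /u; case: (i01 A k) => ->; have [] := gc2 k; rewrite ?mulr0 ?mulr1 //; lra.
have vc k : 0 <= v k <= 2 * c.
  by rewrite /v; case: (i01 (~` A) k) => ->; have [] := gc2 k; rewrite ?mulr0 ?mulr1 //; lra.
have un k : `|u k| <= 2 * c by case/andP: (uc k) => a b; rewrite ger0_norm.
have vn k : `|v k| <= 2 * c by case/andP: (vc k) => a b; rewrite ger0_norm.
have Hu : \int[P]_w u (X w) <= \int[P]_w u (X w).+1.
  apply: (Rintegral_natfun_mono mX mX1 uc) => k.
  by rewrite /u indicE; case: (boolP (k \in A)) => [/set_mem //|_]; rewrite mulr0 eqxx.
have Hv : \int[P]_w v (X w).+1 <= \int[P]_w v (X w).
  apply: (Rintegral_natfun_mono mX1 mX vc) => k.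
  rewrite /v indicE; case: (boolP (k \in ~` A)) => [/set_mem kA|_]; last by rewrite mulr0 eqxx.
  by move=> _; rewrite ltW // ltNge; apply/negP => h; exact: kA.
have gE k : g k = 2 * c * \1_A k - u k + v k - c.
  rewrite /u /v !indicE in_setC; case: (k \in A) => /=; ring.
have EX (Y : T -> nat) : measurable_fun setT Y -> \int[P]_w g (Y w) =
    2 * c * fine (P [set w | A (Y w)]) - \int[P]_w u (Y w) + \int[P]_w v (Y w) - c.
  move=> mY; have iu := ib _ _ mY un; have iv := ib _ _ mY vn.
  have iA : P.-integrable setT (EFin \o (fun w => \1_A (Y w) : R)).
    apply: (integrable_natfun P mY (c := 1)) => k.
    by case: (i01 A k) => ->; rewrite ?normr0 ?normr1.
  have iA2 : P.-integrable setT (EFin \o (fun w => 2 * c * \1_A (Y w) : R)) by exact: integrableZR.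
  have iAu : P.-integrable setT (EFin \o (fun w => 2 * c * \1_A (Y w) - u (Y w) : R)) by exact: integrableBR.
  have iAv : P.-integrable setT (EFin \o (fun w => 2 * c * \1_A (Y w) - u (Y w) + v (Y w) : R)) by exact: integrableDR.
  under eq_Rintegral do rewrite gE.
  rewrite RintegralB //; last exact: integrable_prob_cst.
  rewrite RintegralD // RintegralB // RintegralZl // Rintegral_indic_nat //.
  by rewrite Rintegral_prob_cst.
rewrite (EX _ mX) (EX _ mX1).
have := D1_ub X A; rewrite distrC => /(le_trans (ler_norm _)) => H.
have : 2 * c * (fine (P [set w | A (X w).+1]) - fine (P [set w | A (X w)])) <= 2 * c * D1 P X.
  by rewrite ler_wpM2l // mulr_ge0.
by move: Hu Hv; lra.
Qed.

Lemma D1_shift (X : {mfun T >-> nat}) (g : nat -> R) c : (forall k, `|g k| <= c) ->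
  `|\int[P]_w g (X w).+1 - \int[P]_w g (X w)| <= 2 * c * D1 P X.
Proof.
move=> gc; rewrite ler_norml D1_shift_le // andbT lerNl.
have := @D1_shift_le X (fun k => - g k) c.
have EN (Y : T -> nat) : measurable_fun setT Y -> \int[P]_w - g (Y w) = - \int[P]_w g (Y w).
  move=> mY; rewrite -mulN1r -RintegralZl //; last exact: (integrable_natfun P mY gc).
  by congr (Rintegral _ _ _); apply/funext => w; rewrite mulN1r.
rewrite EN; last exact: (measurable_shift1 X).
rewrite EN; last exact: measurable_funPT.
by rewrite opprK opprB addrC; apply => k; rewrite normrN.
Qed.

End total_variation.

(** * Size biasing and the explicit bound *)

Section dickman_approximation.
Context d (T : measurableType d) (R : realType) (P : probability T R).
Variables (r : nat -> nat) (Z : nat -> nat -> {RV P >-> nat}).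
Hypothesis r_pos : forall i : nat, (1 <= i)%N -> (1 <= r i)%N.
Hypothesis Z_indep : mutually_independent (index_set r) (fun p : nat * nat => Z p.1 p.2).
Hypothesis Z_ident : forall i j : nat, (1 <= i)%N -> (1 <= j <= r i)%N ->
  forall A : set nat, measurable A ->
  distribution P (Z i j) A = distribution P (Z i 1%N) A.
Hypothesis theta_fin :
  (ereal_sup [set theta_bar r Z i | i in [set i | (1 <= i)%N]] < +oo)%E.
Hypothesis mu_fin : forall i : nat, (1 <= i)%N -> (mu r Z i < +oo)%E.

Definition mean1 i : R := \int[P]_w (Z i 1%N w)%:R.

Lemma Z_prob i j k : (1 <= i)%N -> (1 <= j <= r i)%N ->
  P [set w | Z i j w = k] = P [set w | Z i 1%N w = k].
Proof. by move=> i1 jr; exact: (Z_ident i1 jr (A := [set k])). Qed.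

Lemma integral_Z_natR i j : (1 <= i)%N -> (1 <= j <= r i)%N ->
  (\int[P]_w (Z i j w)%:R%:E = \int[P]_w (Z i 1%N w)%:R%:E)%E.
Proof.
move=> i1 jr.
have E j' := @integral_natfun _ _ _ P (Z i j') (fun k => k%:R%:E).
rewrite !E //; apply: eq_eseriesr => k _; by rewrite Z_prob.
Qed.

Lemma theta_bar_lty i : (1 <= i)%N -> (theta_bar r Z i < +oo)%E.
Proof. by move=> i1; apply: le_lt_trans theta_fin; apply: ereal_sup_ubound; exists i. Qed.

Lemma theta_bar_ge0 i : (0 <= theta_bar r Z i)%E.
Proof.
rewrite /theta_bar unlock mule_ge0 ?lee_fin //.
by apply: integral_ge0 => w _; rewrite lee_fin.
Qed.

Lemma integrable_nat_lty (X : T -> nat) : measurable_fun setT X ->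
  (\int[P]_w (X w)%:R%:E < +oo)%E -> P.-integrable setT (EFin \o (fun w => (X w)%:R)).
Proof.
move=> mX fX; apply/integrableP; split.
  by apply/measurable_EFinP; exact: (@measurable_natfun _ _ _ _ X (fun k => k%:R : R)).
by under eq_integral do rewrite /= ger0_norm //.
Qed.

Lemma integrable_Zsum i : (1 <= i)%N ->
  P.-integrable setT (EFin \o (fun w => (Zsum r Z i w)%:R)).
Proof.
move=> i1; apply: integrable_nat_lty; first exact: measurable_Zsum.
have := theta_bar_lty i1; rewrite /theta_bar unlock.
have : (0 <= \int[P]_w (Zsum r Z i w)%:R%:E)%E.
  by apply: integral_ge0 => w _; rewrite lee_fin.
case: (integral _ _ _) => [x _ _|_|//]; first by rewrite ltry.
by rewrite gt0_muley ?ltxx // lte_fin ltr0n.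
Qed.

Lemma Z_le_Zsum i j w : (1 <= j <= r i)%N -> (Z i j w <= Zsum r Z i w)%N.
Proof.
move=> jr; rewrite /Zsum (bigD1_seq j) ?iota_uniq ?mem_index_iota ?ltnS //=.
exact: leq_addr.
Qed.

Lemma integrable_Z i j : (1 <= i)%N -> (1 <= j <= r i)%N ->
  P.-integrable setT (EFin \o (fun w => (Z i j w)%:R)).
Proof.
move=> i1 jr; apply: integrable_dom (integrable_Zsum i1) => //.
  exact: (@measurable_natfun _ _ _ _ (Z i j) (fun k => k%:R : R)).
by move=> w _; rewrite ger0_norm // ler_nat Z_le_Zsum.
Qed.

Lemma mean_Z i j : (1 <= i)%N -> (1 <= j <= r i)%N ->
  \int[P]_w (Z i j w)%:R = mean1 i.
Proof. by move=> i1 jr; rewrite /mean1 /Rintegral integral_Z_natR. Qed.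

Lemma mean1_ge0 i : 0 <= mean1 i.
Proof. by apply: Rintegral_ge0. Qed.

Lemma mean_Zsum i : (1 <= i)%N -> \int[P]_w (Zsum r Z i w)%:R = (r i)%:R * mean1 i.
Proof.
move=> i1.
have -> : \int[P]_w (Zsum r Z i w)%:R =
    \int[P]_w \sum_(j <- index_iota 1 (r i).+1) (Z i j w)%:R.
  by congr (Rintegral _ _ _); apply/funext => w; rewrite /Zsum natr_sum.
rewrite Rintegral_sum_in // => [|j]; last first.
  by rewrite mem_index_iota ltnS => jr; exact: integrable_Z.
rewrite big_nat; under eq_bigr => j jr do rewrite mean_Z //.
by rewrite -big_nat sumr_const_nat subn1 /= mulr_natl.
Qed.

Lemma theta_barE i : (1 <= i)%N -> theta_bar r Z i = ((i * r i)%N%:R * mean1 i)%:E.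
Proof.
move=> i1; rewrite /theta_bar unlock Rintegral_EFin //; last exact: integrable_Zsum.
by rewrite mean_Zsum // natrM -EFinM mulrA.
Qed.

Lemma theta_E i : (1 <= i)%N -> theta_ r Z i = (i * r i)%N%:R * mean1 i.
Proof. by move=> i1; rewrite /theta_ theta_barE. Qed.

Lemma theta_0 : theta_ r Z 0 = 0.
Proof. by rewrite /theta_ /theta_bar mul0e. Qed.

Lemma theta_ge0 i : 0 <= theta_ r Z i.
Proof. by rewrite /theta_ fine_ge0 // theta_bar_ge0. Qed.

Lemma theta_has_sup : has_sup [set theta_ r Z i | i in [set i | (1 <= i)%N]].
Proof.
split; first by exists (theta_ r Z 1), 1%N.
have := theta_fin; set S := ereal_sup _ => Sfin.
have S0 : (0 <= S)%E.
  by apply: le_trans (theta_bar_ge0 1) _; apply: ereal_sup_ubound; exists 1%N.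
exists (fine S) => _ [i /= i1 <-].
rewrite -lee_fin [leRHS]fineK; last by rewrite (ge0_fin_numE S0); exact: Sfin.
rewrite /theta_ fineK; last by rewrite (ge0_fin_numE (theta_bar_ge0 i)); exact: theta_bar_lty.
by apply: ereal_sup_ubound; exists i.
Qed.

Lemma theta_star_ge1 th : 1 <= theta_star r Z th.
Proof. by rewrite /theta_star le_max lexx. Qed.

Lemma theta_star_ge th : th <= theta_star r Z th.
Proof. by rewrite /theta_star !le_max lexx orbT. Qed.

Lemma theta_le_star th i : theta_ r Z i <= theta_star r Z th.
Proof.
case: i => [|i]; first by rewrite theta_0 (le_trans ler01) // theta_star_ge1.
rewrite /theta_star !le_max; apply/orP; right; apply/orP; right.
by apply: sup_upper_bound; [exact: theta_has_sup|exists i.+1].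
Qed.

Lemma eps_abs_le_mu i : (1 <= i)%N ->
  (\sum_(0 <= k <oo) k%:R%:E * `|eps r Z i k|%:E <= mu r Z i)%E.
Proof.
move=> i1.
have pos k : (0 <= k%:R%:E * `|eps r Z i k|%:E)%E by rewrite mule_ge0 ?lee_fin.
rewrite nneseries_recl // mul0e add0e; apply: lee_nneseries => [k _ _|k _]; first exact: pos.
rewrite lee_wpmul2l ?lee_fin //; apply: ereal_sup_ubound.
by exists i => //=.
Qed.

Lemma mu_ge0 i : (0 <= mu r Z i)%E.
Proof.
apply: nneseries_ge0 => k _ _; rewrite mule_ge0 ?lee_fin //.
apply: (@le_trans _ _ `|eps r Z i k|%:E); first by rewrite lee_fin.
by apply: ereal_sup_ubound; exists i => /=.
Qed.

Lemma Z_prob_eps i k : (1 <= i)%N -> mean1 i != 0 ->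
  fine (P [set w | Z i 1%N w = k]) = mean1 i * (eps r Z i k + (k == 1%N)%:R).
Proof.
move=> i1 m0; rewrite /eps theta_E //.
have ir0 : (i * r i)%N%:R != 0 :> R.
  by rewrite pnatr_eq0 -lt0n muln_gt0 i1 r_pos.
rewrite mulf_eq0 (negbTE ir0) (negbTE m0) /= subrK.
move: ir0 m0; move: (_%:R : R) (mean1 i) (fine _) => A m p A0 m0.
by field; rewrite m0 A0.
Qed.

Section one_variable.
Variables (i j : nat).
Hypotheses (i1 : (1 <= i)%N) (jr : (1 <= j <= r i)%N).
Let m := mean1 i.

Let integrable_Zij : P.-integrable setT (EFin \o (fun w => (Z i j w)%:R)).
Proof. exact: integrable_Z. Qed.

Let mean_Zij : \int[P]_w (Z i j w)%:R = m.
Proof. exact: mean_Z. Qed.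

Lemma integrable_ZPsi (Psi : nat -> R) c : (forall k, `|Psi k| <= c) ->
  P.-integrable setT (EFin \o (fun w => (Z i j w)%:R * Psi (Z i j w))).
Proof.
move=> Pc; apply: (@integrable_dom _ _ _ P setT measurableT _ (fun w => c * (Z i j w)%:R)).
- exact: (@measurable_natfun _ _ _ _ (Z i j) (fun k => k%:R * Psi k : R)).
- by move=> w _; rewrite normrM ger0_norm // mulrC ler_wpM2r.
- exact: integrableZR.
Qed.

(** By definition of [eps], k P[Z = k] = m (1{k = 1} + k eps_k), so the error is m times a sum
    dominated by [mu]. Adding c to Psi makes all terms nonnegative and allows a comparison of series
    term by term; it also turns the bound c into 2c. *)
Lemma Z_size_bias_le (Psi : nat -> R) c : (forall k, `|Psi k| <= c) -> m != 0 ->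
  \int[P]_w ((Z i j w)%:R * Psi (Z i j w)) <= m * Psi 1%N + 2 * c * m * fine (mu r Z i).
Proof.
move=> Pc m0; have c0 : 0 <= c by apply: le_trans (Pc 0%N).
have mge0 : 0 <= m by exact: mean1_ge0.
have Pc2 k : 0 <= Psi k + c <= 2 * c by have := Pc k; rewrite ler_norml; lra.
rewrite -(lerD2r (c * m)) -{1}mean_Zij -RintegralZl // -RintegralD //;
  [|exact: (integrable_ZPsi Pc)|exact: integrableZR].
have -> : \int[P]_w ((Z i j w)%:R * Psi (Z i j w) + c * (Z i j w)%:R) =
    \int[P]_w ((Z i j w)%:R * (Psi (Z i j w) + c)).
  by congr (Rintegral _ _ _); apply/funext => w; ring.
have int1 : P.-integrable setT (EFin \o (fun w => (Z i j w)%:R * (Psi (Z i j w) + c))).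
  apply: (@integrable_ZPsi (fun k => Psi k + c) (2 * c)) => k.
  by have /andP[a b] := Pc2 k; rewrite ger0_norm.
rewrite -lee_fin -Rintegral_EFin //.
rewrite (@integral_natfun _ _ _ P (Z i j) (fun k => (k%:R * (Psi k + c))%:E)) //; last first.
  by move=> k; rewrite lee_fin mulr_ge0 //; case/andP: (Pc2 k).
have E2 : (m * Psi 1%N + 2 * c * m * fine (mu r Z i) + c * m)%:E =
   ((m * (Psi 1%N + c))%:E + (2 * c * m)%:E * mu r Z i)%E.
  rewrite -[X in (_ = _ + _ * X)%E](fineK (_ : mu r Z i \is a fin_num)).
    by rewrite -EFinM -EFinD; congr (_%:E); ring.
  by rewrite (ge0_fin_numE (mu_ge0 i)); exact: mu_fin.
rewrite E2.
have cm0 : 0 <= 2 * c * m by rewrite !mulr_ge0.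
have cmE : (0 <= (2 * c * m)%:E)%E by rewrite lee_fin.
have S := lee_wpmul2l cmE (eps_abs_le_mu i1).
apply: le_trans (leeD (lexx (m * (Psi 1%N + c))%:E) S) => {S}.
rewrite -nneseriesZl; last by move=> k _; rewrite mule_ge0 ?lee_fin.
rewrite -[X in (_ <= X + _)%E](@nneseries_pick _ (fun=> (m * (Psi 1%N + c))%:E) 1); last first.
  by move=> _; rewrite lee_fin mulr_ge0 //; case/andP: (Pc2 1%N).
rewrite -nneseriesD; first last.
- by move=> k _ _; rewrite mule_ge0 ?lee_fin // mule_ge0 ?lee_fin.
- move=> k _ _; rewrite mule_ge0 ?lee_fin // mulr_ge0 //; by case/andP: (Pc2 1%N).
apply: lee_nneseries => [k _ _|k _].
  by rewrite mule_ge0 // lee_fin mulr_ge0 //; case/andP: (Pc2 k).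
rewrite Z_prob //.
have -> : P [set w | Z i 1%N w = k] = (fine (P [set w | Z i 1%N w = k]))%:E.
  by rewrite fineK // fin_num_measure //; exact: measurable_nateq.
rewrite (Z_prob_eps k i1 m0) -!EFinM -EFinD lee_fin -/m.
have /andP[a b] := Pc2 k; have e1 := ler_norm (eps r Z i k).
have e0 := normr_ge0 (eps r Z i k).
have H1 : (Psi k + c) * eps r Z i k <= 2 * c * `|eps r Z i k|.
  by apply: le_trans (_ : (Psi k + c) * `|eps r Z i k| <= _); [rewrite ler_wpM2l|rewrite ler_wpM2r].
rewrite mulrCA (_ : _ * _ + _ = m * ((Psi 1%N + c) * (1%N == k)%:R + k%:R * (2 * c * `|eps r Z i k|))); last by ring.
rewrite ler_wpM2l // mulrDr addrC lerD //.
  by rewrite [1%N == k]eq_sym; case: eqP => [->|_]; rewrite ?mulr0 // mul1r.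
by rewrite -[leLHS]mulrA; apply: ler_wpM2l.
Qed.

Lemma Z_size_bias (Psi : nat -> R) c : (forall k, `|Psi k| <= c) ->
  `|\int[P]_w ((Z i j w)%:R * Psi (Z i j w)) - m * Psi 1%N| <=
    2 * c * m * fine (mu r Z i).
Proof.
(* For m = 0 the value of [eps] is the default 0 and says nothing about the law; the integral
   vanishes because the mean of [Z i j] does. *)
move=> Pc; have [m0|m0] := eqVneq m 0.
  have : `|\int[P]_w ((Z i j w)%:R * Psi (Z i j w))| <= \int[P]_w (c * (Z i j w)%:R).
    apply: Rintegral_norm_le => //.
    - exact: (@measurable_natfun _ _ _ _ (Z i j) (fun k => k%:R * Psi k : R)).
    - by move=> w _; rewrite normrM ger0_norm // mulrC ler_wpM2r.
    - exact: integrableZR.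
  by rewrite RintegralZl // mean_Zij m0 !(mulr0, mul0r) subr0.
have U := Z_size_bias_le Pc m0.
have Pc' k : `|- Psi k| <= c by rewrite normrN.
have := Z_size_bias_le Pc' m0.
have -> : \int[P]_w ((Z i j w)%:R * - Psi (Z i j w)) = - \int[P]_w ((Z i j w)%:R * Psi (Z i j w)).
  rewrite -mulN1r -RintegralZl //; last exact: (integrable_ZPsi Pc).
  by congr (Rintegral _ _ _); apply/funext => w; ring.
move: U; set A := Rintegral _ _ _; set B := 2 * c * m * _; rewrite mulrN => U L.
by rewrite ler_norml; apply/andP; split; lra.
Qed.

(** Given the other summands, size biasing replaces [Z i j] by 1, at the cost 2 c m mu_i. Putting
    [Z i j] back into the sum alters it only where [Z i j] is not 0, an event of probability at most
    m, at the cost 2 c m for each unit of mean. *)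
Lemma wsum_size_bias (s : seq (nat * nat)) (g : nat -> R) c :
  (i, j) \in s -> uniq s -> {in s, forall p, index_set r p} ->
  (forall k, `|g k| <= c) ->
  P.-integrable setT (EFin \o (fun w => (Z i j w)%:R * g (wsum Z s w))) /\
  `|\int[P]_w ((Z i j w)%:R * g (wsum Z s w)) - m * \int[P]_w g (wsum Z s w + i)%N| <=
    m * (2 * c * (fine (mu r Z i) + m)).
Proof.
move=> ijs us sI gc; have c0 : 0 <= c by apply: le_trans (gc 0%N).
set s' := rem (i, j) s.
have ps : perm_eq s ((i, j) :: s') by exact: perm_to_rem.
have us' : uniq ([:: (i, j)] ++ s') by rewrite -(perm_uniq ps).
have sI' : {in [:: (i, j)] ++ s', forall p, index_set r p}.
  by move=> p; rewrite -(perm_mem ps); exact: sI.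
have WE w : wsum Z s w = (i * Z i j w + wsum Z s' w)%N.
  by rewrite (perm_wsum _ _ ps) /wsum big_cons.
pose Psi k := \int[P]_w g (i * k + wsum Z s' w)%N.
have PsiE k : Psi k = \int[P]_w g (i * k + wdot s' (sample Z s' w))%N.
  by congr (Rintegral _ _ _); apply/funext => w; rewrite wsumE.
have int_bd (h : T -> nat) : measurable_fun setT h -> P.-integrable setT (EFin \o (fun w => g (h w))).
  by move=> mh; exact: (integrable_natfun P mh gc).
have mW s0 (f : nat -> nat) : measurable_fun setT (fun w => f (wsum Z s0 w)).
  exact: (@measurable_natfun _ _ _ _ _ f (measurable_wsum Z s0)).
have Psic k : `|Psi k| <= c.
  rewrite -[leRHS](@Rintegral_prob_cst _ _ _ P) /Psi; apply: Rintegral_norm_le => //.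
    exact: (@measurable_natfun _ _ _ _ _ g (mW s' (fun l => i * k + l)%N)).
  exact: integrable_prob_cst.
have headE w : head 0%N (sample Z [:: (i, j)] w) = Z i j w by [].
have bnd z t : `|z%:R * g (i * z + t)%N| <= z%:R * c.
  by rewrite normrM ger0_norm // ler_wpM2l.
have ibnd : P.-integrable setT (EFin \o (fun w => (head 0%N (sample Z [:: (i, j)] w))%:R * c)).
  rewrite (_ : (fun w => _) = fun w => c * (Z i j w)%:R); first exact: integrableZR.
  by apply/funext => w; rewrite headE mulrC.
have [I1 _ E1] := sample_fubini Z_indep (wdot s') us' sI' bnd ibnd.
have FE : (fun w => (Z i j w)%:R * g (wsum Z s w)) = fun w =>
    (head 0%N (sample Z [:: (i, j)] w))%:R *
    g (i * head 0%N (sample Z [:: (i, j)] w) + wdot s' (sample Z s' w))%N.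
  by apply/funext => w; rewrite headE WE -wsumE.
split; first by rewrite FE.
have -> : \int[P]_w ((Z i j w)%:R * g (wsum Z s w)) = \int[P]_w ((Z i j w)%:R * Psi (Z i j w)).
  rewrite FE E1; congr (Rintegral _ _ _); apply/funext => w.
  rewrite RintegralZl //; last first.
    apply: int_bd; apply: (@measurable_natfun _ _ _ _ _ (fun l => i * _ + l)%N).
    exact: measurable_sample_fun.
  by rewrite headE PsiE.
rewrite -[X in X - _](subrK (m * Psi 1%N)) -addrA (le_trans (ler_normD _ _)) //.
rewrite 2!mulrDr; apply: lerD.
  rewrite (_ : m * (2 * c * _) = 2 * c * m * fine (mu r Z i)); last by ring.
  exact: Z_size_bias.
have m0 : 0 <= m by exact: mean1_ge0.
rewrite -mulrBr normrM (ger0_norm m0) ler_wpM2l //.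
rewrite /Psi muln1.
have i2 : P.-integrable setT (EFin \o (fun w => g (i + wsum Z s' w)%N)).
  exact: (int_bd _ (mW s' (addn i))).
have i3 : P.-integrable setT (EFin \o (fun w => g (wsum Z s w + i)%N)).
  exact: (int_bd _ (mW s (addn^~ i))).
rewrite -RintegralB // -mean_Zij -[leRHS]RintegralZl //.
apply: Rintegral_norm_le => //.
- have i4 : P.-integrable setT (EFin \o (fun w => g (i + wsum Z s' w)%N - g (wsum Z s w + i)%N)).
    exact: integrableBR.
  exact: integrable_measurable i4.
- move=> w _; rewrite WE; case: (Z i j w) => [|k].
    by rewrite muln0 add0n addnC subrr normr0 mulr0.
  apply: le_trans (ler_normB _ _) _; apply: le_trans (lerD (gc _) (gc _)) _.
  by rewrite -natr1; have : 0 <= c * k%:R by [rewrite mulr_ge0]; lra.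
- exact: integrableZR.
Qed.

End one_variable.

Variable theta : R.
Hypothesis theta_gt0 : 0 < theta.

Let ts := theta_star r Z theta.

Let mi i := Num.max (fine (mu r Z i)) (i * r i)%N%:R^-1.

Lemma integrable_Tsum a n : P.-integrable setT (EFin \o (fun w => (Tsum r Z a n w)%:R)).
Proof.
have -> : (fun w => (Tsum r Z a n w)%:R : R) =
    fun w => \sum_(i <- index_iota a.+1 n.+1) i%:R * (Zsum r Z i w)%:R.
  by apply/funext => w; rewrite /Tsum natr_sum; apply: eq_bigr => i _; rewrite natrM.
apply: integrable_sum_in => // i; rewrite mem_index_iota => /andP[ai _].
by apply: integrableZR => //; apply: (integrable_Zsum); exact: leq_trans ai.
Qed.

(** Adding [wsum_size_bias] over the r_i copies gives the error 2 c theta_i (mu_i + m_i) at index i.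
    Since m_i = theta_i / (i r_i), both mu_i and m_i are at most [ts * mi i], which produces the
    factor 4 and accounts for the maximum in [sigma_star]. *)
Lemma Tsum_size_bias a n (g : nat -> R) c : (a <= n)%N -> (forall k, `|g k| <= c) ->
  P.-integrable setT (EFin \o (fun w => (Tsum r Z a n w)%:R * g (Tsum r Z a n w))) /\
  `|\int[P]_w ((Tsum r Z a n w)%:R * g (Tsum r Z a n w)) -
    \sum_(a.+1 <= i < n.+1) theta_ r Z i * \int[P]_w g (Tsum r Z a n w + i)%N|
  <= c * (4 * ts ^+ 2 * sigma_star r Z n).
Proof.
move=> an gc; have c0 : 0 <= c by apply: le_trans (gc 0%N).
set S := index_iota a.+1 n.+1; pose s := index_pairs r S.
have TE : Tsum r Z a n = wsum Z s by apply/funext => w; rewrite Tsum_wsum.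
have S1 : {in S, forall i, (1 <= i)%N}.
  by move=> i; rewrite mem_index_iota => /andP[/(leq_ltn_trans (leq0n a))].
have us : uniq s by apply: index_pairs_uniq; exact: iota_uniq.
have sI : {in s, forall p, index_set r p} by exact: index_pairs_sub.
rewrite TE.
have sb p (ps : p \in s) : P.-integrable setT (EFin \o (fun w => (Z p.1 p.2 w)%:R * g (wsum Z s w))) /\
  `|\int[P]_w ((Z p.1 p.2 w)%:R * g (wsum Z s w)) - mean1 p.1 * \int[P]_w g (wsum Z s w + p.1)%N| <=
    mean1 p.1 * (2 * c * (fine (mu r Z p.1) + mean1 p.1)).
  have /andP[p1 p2] := sI _ ps; case: p ps p1 p2 => i j ijs p1 p2.
  exact: wsum_size_bias.
have FE w : (wsum Z s w)%:R * g (wsum Z s w) =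
    \sum_(p <- s) p.1%:R * ((Z p.1 p.2 w)%:R * g (wsum Z s w)).
  rewrite {1}/wsum natr_sum mulr_suml; apply: eq_bigr => p _.
  by rewrite natrM mulrA.
have int1 : {in s, forall p, P.-integrable setT
    (EFin \o (fun w => p.1%:R * ((Z p.1 p.2 w)%:R * g (wsum Z s w))))}.
  by move=> p /sb[ip _]; exact: integrableZR.
rewrite (funext FE : (fun w => (wsum Z s w)%:R * g (wsum Z s w)) = _).
split; first exact: integrable_sum_in.
rewrite Rintegral_sum_in //.
have -> : \sum_(a.+1 <= i < n.+1) theta_ r Z i * \int[P]_w g (wsum Z s w + i)%N =
   \sum_(p <- s) p.1%:R * (mean1 p.1 * \int[P]_w g (wsum Z s w + p.1)%N).
  rewrite [RHS]big_allpairs_dep /=; apply: eq_big_seq => i /S1 i1.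
  by rewrite (theta_E i1) sumr_const_nat subn1 /= natrM -mulr_natl; ring.
rewrite -sumrB (le_trans (ler_norm_sum _ _ _)) //.
have -> : c * (4 * ts ^+ 2 * sigma_star r Z n) =
    \sum_(1 <= i < n.+1) c * (4 * ts ^+ 2 * mi i).
  by rewrite -mulr_sumr -mulr_sumr.
have mi0 i : 0 <= mi i by rewrite /mi le_max fine_ge0 // mu_ge0.
have ts1 : 1 <= ts by exact: theta_star_ge1.
have ts0 : 0 <= ts by apply: le_trans ts1.
apply: le_trans (_ : \sum_(i <- S) c * (4 * ts ^+ 2 * mi i) <= _); last first.
  rewrite [leRHS](big_cat_nat _ (n := a.+1)) //= lerDr sumr_ge0 // => i _.
  by rewrite mulr_ge0 // mulr_ge0 // mulr_ge0 ?sqr_ge0.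
rewrite [leLHS]big_allpairs_dep /= big_seq [leRHS]big_seq.
apply: ler_sum => i iS; have i1 := S1 _ iS.
have m0 : 0 <= mean1 i by exact: mean1_ge0.
apply: le_trans (_ : \sum_(1 <= j < (r i).+1)
   i%:R * (mean1 i * (2 * c * (fine (mu r Z i) + mean1 i))) <= _).
  apply: ler_sum_nat => j jr.
  have ijs : (i, j) \in s by rewrite mem_index_pairs iS -ltnS.
  have [ii le] := wsum_size_bias i1 jr ijs us sI gc.
  by rewrite RintegralZl // -mulrBr normrM normr_nat ler_wpM2l.
rewrite sumr_const_nat subn1 /= -[leLHS]mulr_natl.
have thE := theta_E i1.
have th1 : theta_ r Z i <= ts by exact: theta_le_star.
have th0 := theta_ge0 i.
have ir0 : 0 < (i * r i)%N%:R :> R by rewrite ltr0n muln_gt0 i1 r_pos.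
have mE : mean1 i <= ts * mi i.
  apply: le_trans (_ : ts * (i * r i)%N%:R^-1 <= _); last first.
    by rewrite ler_wpM2l // /mi le_max lexx orbT.
  by rewrite ler_pdivlMr // mulrC -thE.
have muE : fine (mu r Z i) <= mi i by rewrite /mi le_max lexx.
have -> : (r i)%:R * (i%:R * (mean1 i * (2 * c * (fine (mu r Z i) + mean1 i)))) =
   c * (2 * (theta_ r Z i * (fine (mu r Z i) + mean1 i))) by rewrite thE natrM; ring.
apply: ler_wpM2l => //.
rewrite (_ : 4 * ts ^+ 2 * mi i = 2 * (2 * ts ^+ 2 * mi i)); last by ring.
rewrite ler_pM2l //.
have tsm : mi i <= ts * mi i by rewrite ler_peMl.
apply: le_trans (_ : ts * (2 * (ts * mi i)) <= _); last by rewrite le_eqVlt; apply/orP; left; apply/eqP; ring.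
apply: ler_pM => //; first by rewrite addr_ge0 // fine_ge0 // mu_ge0.
by rewrite mulr_natl mulr2n lerD // (le_trans muE).
Qed.

(** A real [sup] is an upper bound only for a bounded set; here the block averages lie between 0 and
    [ts], so theta + ts is a bound. *)
Lemma delta_le m j : `|theta - m%:R^-1 * \sum_(1 <= i < m.+1) theta_ r Z (j * m + i)%N| <=
  delta r Z m theta.
Proof.
apply: sup_upper_bound; last by exists j.
split; first by exists `|theta - m%:R^-1 * \sum_(1 <= i < m.+1) theta_ r Z (0 * m + i)%N|, 0%N.
exists (theta + ts) => _ [k _ <-].
have ts1 : 1 <= ts by exact: theta_star_ge1.
have ts0 : 0 <= ts by apply: le_trans ts1.
apply: le_trans (ler_normB _ _) _; rewrite gtr0_norm // lerD2l.
have s0 : 0 <= \sum_(1 <= i < m.+1) theta_ r Z (k * m + i)%N.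
  by apply: sumr_ge0 => i _; exact: theta_ge0.
rewrite ger0_norm ?mulr_ge0 //.
have [->|m0] := posnP m; first by rewrite invr0 mul0r.
rewrite mulrC ler_pdivrMr ?ltr0n //.
apply: le_trans (_ : \sum_(1 <= i < m.+1) ts <= _).
  by apply: ler_sum => i _; exact: theta_le_star.
by rewrite sumr_const_nat subn1 /= mulr_natr.
Qed.

Lemma Tsum_stein a n m (g : nat -> R) : (a < n)%N -> (0 < m)%N ->
  (forall k, `|g k| <= n%:R^-1) ->
  P.-integrable setT (EFin \o (fun w => (Tsum r Z a n w)%:R * g (Tsum r Z a n w))) /\
  `|\int[P]_w ((Tsum r Z a n w)%:R * g (Tsum r Z a n w)) -
    theta * \sum_(1 <= i < n.+1) \int[P]_w g (Tsum r Z a n w + i)%N|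
  <= eps1 r Z theta n a m.
Proof.
move=> an m0 gn.
have [iT sb] := Tsum_size_bias (ltnW an) gn; split=> //.
have n0 : 0 < n%:R :> R by rewrite ltr0n (leq_ltn_trans _ an).
have ts1 : 1 <= ts by exact: theta_star_ge1.
have ts0 : 0 <= ts by apply: le_trans ts1.
have nV0 : 0 <= n%:R^-1 :> R by rewrite invr_ge0 ltW.
pose x i := \int[P]_w g (Tsum r Z a n w + i)%N.
pose D := 2 * n%:R^-1 * D1 P (Tsum r Z a n).
have mT i : measurable_fun setT (fun w => (Tsum r Z a n w + i)%N).
  exact: (@measurable_natfun _ _ _ _ _ (addn^~ i) (measurable_Tsum r Z a n)).
have xn i : `|x i| <= n%:R^-1.
  rewrite -[leRHS](@Rintegral_prob_cst _ _ _ P) /x; apply: Rintegral_norm_le => //.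
    exact: (@measurable_natfun _ _ _ _ _ g (mT i)).
  exact: integrable_prob_cst.
have xD i : `|x i.+1 - x i| <= D.
  have := @D1_shift _ _ _ P (Tsum r Z a n) (fun k => g (k + i)%N) n%:R^-1 (fun k => gn _).
  rewrite /x; under [X in X - _]eq_Rintegral do rewrite addSn -addnS.
  by [].
have tB i : 0 <= theta_ r Z i <= ts by rewrite theta_ge0 theta_le_star.
have thB : 0 <= theta <= ts by rewrite ltW // theta_star_ge.
have blk := block_sum_le n xn xD tB thB m0 (delta_le m).
have dl0 : 0 <= delta r Z m theta by apply: le_trans (delta_le m 0).
have D0 := D1_ge0 P (Tsum r Z a n).
set A := Rintegral _ _ _.
have -> : A - theta * \sum_(1 <= i < n.+1) x i =
   (A - \sum_(a.+1 <= i < n.+1) theta_ r Z i * x i)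
   + (\sum_(1 <= i < n.+1) (theta_ r Z i - theta) * x i - \sum_(1 <= i < a.+1) theta_ r Z i * x i).
  have -> : \sum_(1 <= i < n.+1) (theta_ r Z i - theta) * x i =
      \sum_(1 <= i < a.+1) theta_ r Z i * x i + \sum_(a.+1 <= i < n.+1) theta_ r Z i * x i
      - theta * \sum_(1 <= i < n.+1) x i.
    rewrite -(big_cat_nat _ (n := a.+1)) //=; last exact: ltnW.
    by rewrite mulr_sumr -sumrB; apply: eq_bigr => i _; rewrite mulrBl.
  ring.
have sa : `|\sum_(1 <= i < a.+1) theta_ r Z i * x i| <= n%:R^-1 * ts * a%:R.
  apply: le_trans (ler_norm_sum _ _ _) _.
  apply: le_trans (_ : \sum_(1 <= i < a.+1) ts * n%:R^-1 <= _).
    apply: ler_sum => i _; have /andP[t0 t1] := tB i.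
    by rewrite normrM ger0_norm // ler_pM.
  by rewrite sumr_const_nat subn1 /= mulr_natr [ts * _]mulrC.
apply: le_trans (ler_normD _ _) _.
apply: le_trans (lerD sb (le_trans (ler_normB _ _) (lerD blk sa))) _.
rewrite -/ts /eps1 -/ts.
have J : (n %/ m)%:R * m%:R * n%:R^-1 <= 1 :> R.
  by rewrite -natrM ler_pdivrMr // mul1r ler_nat leq_trunc_div.
have -> : (n %/ m)%:R * (ts * D * m%:R ^+ 2 / 8 + m%:R * delta r Z m theta * n%:R^-1) =
  ((n %/ m)%:R * m%:R * n%:R^-1) * (4^-1 * ts * m%:R * D1 P (Tsum r Z a n) + delta r Z m theta).
  by rewrite /D; field; rewrite gt_eqF.
set Q := 4^-1 * ts * m%:R * _ + _.
have Q0 : 0 <= Q by rewrite /Q addr_ge0 // mulr_ge0 // mulr_ge0 // mulr_ge0.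
have H1 : (n %/ m)%:R * m%:R / n%:R * Q <= Q by rewrite ler_piMl.
have sig0 : 0 <= sigma_star r Z n.
  by apply: sumr_ge0 => i _; rewrite le_max fine_ge0 // mu_ge0.
(* The size-bias error comes with 4 and the incomplete block with [m]; both fit under the 5 and the
   [2 * m] of [eps1]. *)
have H2 : n%:R^-1 * (4 * ts ^+ 2 * sigma_star r Z n) <= n%:R^-1 * ts * (5 * ts * sigma_star r Z n).
  rewrite (_ : n%:R^-1 * ts * (5 * ts * _) = n%:R^-1 * (5 * ts ^+ 2 * sigma_star r Z n)); last by ring.
  by rewrite ler_wpM2l // ler_wpM2r // ler_wpM2r ?sqr_ge0 // ler_nat.
have H3 : m%:R * ts * n%:R^-1 <= n%:R^-1 * ts * (2 * m%:R).
  rewrite (_ : m%:R * ts * n%:R^-1 = n%:R^-1 * ts * m%:R); last by ring.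
  by rewrite ler_wpM2l ?mulr_ge0 // ler_peMl // ler1n.
rewrite 2![n%:R^-1 * ts * (_ + _)]mulrDr.
apply: le_trans (lerD H2 (lerD (lerD H1 H3) (lexx _))) _.
by rewrite le_eqVlt; apply/orP; left; apply/eqP; ring.
Qed.

Variable Ptheta : probability (measurableTypeR R) R.
Hypothesis Ptheta_dickman : is_dickman theta Ptheta.
Local Notation D := (`[0%R, +oo[%classic : set R).

Lemma lipschitz1P (f : R -> R) : (1 : R).-lipschitz f ->
  forall x y, `|f x - f y| <= `|x - y|.
Proof. by move=> H x y; have := H (x, y) (conj I I); rewrite /= mul1r. Qed.

Lemma lip_measurable (f : R -> R) : (forall x y, `|f x - f y| <= `|x - y|) ->
  measurable_fun setT f.
Proof.
move=> fL; apply: continuous_measurable_fun => x.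
apply/cvgrPdist_le => e e0; near=> y; apply: le_trans (fL _ _) _.
by near: y; apply: cvgr_dist_le.
Unshelve. all: by end_near.
Qed.

Lemma integrable_f_Tsum a n (f : R -> R) : (forall x y, `|f x - f y| <= `|x - y|) ->
  P.-integrable setT (EFin \o (fun w => f ((Tsum r Z a n w)%:R / n%:R))).
Proof.
move=> fL.
apply: (@integrable_dom _ _ _ P setT measurableT _
   (fun w => `|f 0| + n%:R^-1 * (Tsum r Z a n w)%:R)).
- exact: (@measurable_natfun _ _ _ _ _ (fun k => f (k%:R / n%:R)) (measurable_Tsum r Z a n)).
- move=> w _; set x := _ / _; have x0 : 0 <= x by rewrite divr_ge0.
  rewrite -[f x](subrK (f 0)) addrC (le_trans (ler_normD _ _)) // lerD2l.
  by rewrite (le_trans (fL _ _)) // subr0 ger0_norm // mulrC.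
- apply: integrableDR => //; first exact: integrable_prob_cst.
  by apply: integrableZR => //; exact: integrable_Tsum.
Qed.

(** Both expectations are compared with the same number [fN 0]. The cut series leaves the residual
    fN - fN 0 of Lipschitz constant kap^N / n; its expectations are controlled by the means of T and
    of the Dickman law, gathered in [C], and vanish as [N] grows. Finally 1 + 2 theta <= (1 +
    theta)^2. *)
Lemma expectation_diff_le a n m (f : R -> R) : (a < n)%N -> (0 < m)%N ->
  (forall x y, `|f x - f y| <= `|x - y|) ->
  `|\int[P]_w f ((Tsum r Z a n w)%:R / n%:R) - \int[Ptheta]_(x in D) f x| <=
  n%:R^-1 * (1 + theta) ^+ 2 + eps1 r Z theta n a m.
Proof.
move=> an m0 fL.
have n0 : 0 < n%:R :> R by rewrite ltr0n (leq_ltn_trans _ an).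
have nV0 : 0 <= n%:R^-1 :> R by rewrite invr_ge0 ltW.
set kap := theta / (1 + theta).
have th1 : 0 < 1 + theta by rewrite addr_gt0.
have kap0 : 0 <= kap by rewrite divr_ge0 // ltW.
have kap1 : kap < 1 by rewrite ltr_pdivrMr // mul1r ltrDr.
set EA := \int[P]_w _; set ED := \int[Ptheta]_(x in D) _.
pose C : R := \int[P]_w (Tsum r Z a n w)%:R + (n%:R * theta + 2^-1).
have C0 : 0 <= C.
  rewrite addr_ge0 //; first by apply: Rintegral_ge0.
  by rewrite addr_ge0 // mulr_ge0 // ltW.
have main N : `|EA - ED| <=
   n%:R^-1 * (1 + theta) ^+ 2 + eps1 r Z theta n a m + C * n%:R^-1 * kap ^+ N.
  pose F j : R := f (j%:R / n%:R).
  have FL j : `|F j.+1 - F j| <= n%:R^-1.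
    apply: le_trans (fL _ _) _.
    by rewrite -mulrBl -natr1 addrC addKr mul1r ger0_norm.
  pose g := stein_sol theta n F N; pose fN := stein_iter theta n F N.
  have gn j : `|g j| <= n%:R^-1 by exact: stein_sol_le.
  have gE j : theta * \sum_(1 <= i < n.+1) g (j + i)%N - j%:R * g j = fN j - f (j%:R / n%:R).
    exact: stein_solE.
  have fNk j : `|fN j - fN 0%N| <= j%:R * (kap ^+ N * n%:R^-1).
    have := @ler_dist_steps _ fN _ (stein_iter_lip theta_gt0 n N FL) j 0%N.
    by rewrite subr0 normr_nat mulrC.
  have n0' : (0 < n)%N by exact: leq_ltn_trans an.
  have [_ HD] := dickman_stein_bound theta_gt0 Ptheta_dickman n0' fL
     (measurable_funTS (lip_measurable fL)) gn gE fNk.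
  have [iTg HT] := Tsum_stein an m0 gn.
  have mT (h : nat -> R) : measurable_fun setT (fun w => h (Tsum r Z a n w)).
    exact: (@measurable_natfun _ _ _ _ _ h (measurable_Tsum r Z a n)).
  have ifN : P.-integrable setT (EFin \o (fun w => fN (Tsum r Z a n w) - fN 0%N)).
    apply: (@integrable_dom _ _ _ P setT measurableT _
       (fun w => (kap ^+ N * n%:R^-1) * (Tsum r Z a n w)%:R)).
    - exact: (mT (fun k => fN k - fN 0%N)).
    - by move=> w _; rewrite mulrC.
    - by apply: integrableZR => //; exact: integrable_Tsum.
  have ig i : P.-integrable setT (EFin \o (fun w => g (Tsum r Z a n w + i)%N)).
    exact: (@integrable_natfun _ _ _ P _ (fun k => g (k + i)%N) _ (measurable_Tsum r Z a n)).
  have isg : P.-integrable setT (EFin \o (fun w => \sum_(1 <= i < n.+1) g (Tsum r Z a n w + i)%N)).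
    exact: integrable_sumR.
  have itsg : P.-integrable setT
      (EFin \o (fun w => theta * \sum_(1 <= i < n.+1) g (Tsum r Z a n w + i)%N)).
    exact: integrableZR.
  have iS : P.-integrable setT (EFin \o (fun w =>
     theta * \sum_(1 <= i < n.+1) g (Tsum r Z a n w + i)%N - (Tsum r Z a n w)%:R * g (Tsum r Z a n w))).
    exact: integrableBR.
  have EE : EA - fN 0%N = \int[P]_w (fN (Tsum r Z a n w) - fN 0%N) +
     (\int[P]_w ((Tsum r Z a n w)%:R * g (Tsum r Z a n w)) -
      theta * \sum_(1 <= i < n.+1) \int[P]_w g (Tsum r Z a n w + i)%N).
    have E3 : \int[P]_w (theta * \sum_(1 <= i < n.+1) g (Tsum r Z a n w + i)%N -
        (Tsum r Z a n w)%:R * g (Tsum r Z a n w)) =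
      theta * \sum_(1 <= i < n.+1) \int[P]_w g (Tsum r Z a n w + i)%N -
      \int[P]_w ((Tsum r Z a n w)%:R * g (Tsum r Z a n w)).
      by rewrite RintegralB // RintegralZl // Rintegral_sum.
    have iF := integrable_f_Tsum a n fL.
    have E4 : \int[P]_w (f ((Tsum r Z a n w)%:R / n%:R) - fN 0%N) = EA - fN 0%N.
      by rewrite RintegralB // ?Rintegral_prob_cst //; exact: integrable_prob_cst.
    rewrite -E4 -[X in _ = _ + X]opprB -E3 -[RHS]RintegralB //.
    by congr (Rintegral _ _ _); apply/funext => w; rewrite gE; ring.
  have HN : `|\int[P]_w (fN (Tsum r Z a n w) - fN 0%N)| <=
      (kap ^+ N * n%:R^-1) * \int[P]_w (Tsum r Z a n w)%:R.
    rewrite -RintegralZl //; last exact: integrable_Tsum.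
    apply: Rintegral_norm_le => //.
    - exact: (mT (fun k => fN k - fN 0%N)).
    - by move=> w _; rewrite mulrC.
    - by apply: integrableZR => //; exact: integrable_Tsum.
  rewrite -(subrKA (fN 0%N)) EE -[X in _ + X]opprB.
  apply: le_trans (ler_normB _ _) _.
  apply: le_trans (lerD (le_trans (ler_normD _ _) (lerD HN HT)) HD) _.
  rewrite /C; set K := kap ^+ N; set I := Rintegral _ _ _; set e := eps1 _ _ _ _ _ _.
  have : n%:R^-1 * (1 + 2 * theta) <= n%:R^-1 * (1 + theta) ^+ 2.
    rewrite ler_wpM2l // sqrrD expr1n mul1r -mulr_natl; have := sqr_ge0 theta; lra.
  move: (n%:R^-1 * (1 + 2 * theta)) (n%:R^-1 * _ ^+ 2) => u v uv.
  rewrite (_ : _ + (u + _) = u + e + (I + (n%:R * theta + 2^-1)) / n%:R * K); last by ring.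
  by rewrite !lerD2r.
apply/ler_addgt0Pr => e e0.
have cv : C * n%:R^-1 * kap ^+ N @[N --> \oo] --> C * n%:R^-1 * 0.
  by apply: cvgMr; apply: cvg_expr; rewrite ger0_norm.
rewrite mulr0 in cv.
have /cvgr0_norm_le /(_ _ e0) [N _ HN] := cv.
apply: le_trans (main N) _; rewrite lerD2l.
by apply: le_trans (ler_norm _) _; apply: HN => /=.
Qed.

Lemma Ptheta_integral (f : R -> R) : Ptheta.-integrable D (EFin \o f) -> measurable_fun setT f ->
  (\int[Ptheta]_x (f x)%:E = \int[Ptheta]_(x in D) (f x)%:E)%E.
Proof.
move=> fi mf.
have mD : measurable (D : set (measurableTypeR R)) by [].
have N0 : Ptheta (~` D) = 0%E.
  by rewrite probability_setC // (dickman_mass Ptheta_dickman) subee.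
have mN : measurable (~` D : set (measurableTypeR R)) by exact: measurableC.
have mfE : measurable_fun (setT : set (measurableTypeR R)) (EFin \o f) by exact/measurable_EFinP.
have DE : setT `\` ~` D = D :> set (measurableTypeR R) by rewrite setTD setCK.
have fiT : Ptheta.-integrable setT (EFin \o f).
  by apply/(negligible_integrable mN measurableT mfE N0); rewrite DE.
by rewrite (negligible_integral mN measurableT fiT N0) DE.
Qed.

Lemma dW_le a n m : (a < n)%N -> (0 < m)%N ->
  (dW (distribution P (Tscaled r Z a n)) Ptheta <=
   (n%:R^-1 * (1 + theta) ^+ 2 + eps1 r Z theta n a m)%:E)%E.
Proof.
move=> an m0; apply: ge_ereal_sup => _ [f /= /lipschitz1P fL <-].
have mf := lip_measurable fL.
have fi : Ptheta.-integrable D (EFin \o f).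
  have [intx _] := dickman_mean theta_gt0 Ptheta_dickman.
  apply: (@integrable_dom _ _ _ Ptheta D (measurable_itv _) f (fun x => `|f 0| + x)).
  - exact: measurable_funTS.
  - move=> x; rewrite halflineP => x0.
    rewrite -[f x](subrK (f 0)) addrC (le_trans (ler_normD _ _)) // lerD2l.
    by rewrite (le_trans (fL _ _)) // subr0 ger0_norm.
  - apply: integrableDR => //; apply: integrable_cstR => //.
    exact: (dickman_mass_lty Ptheta_dickman).
have fT : EFin \o f \o Tscaled r Z a n = EFin \o (fun w => f ((Tsum r Z a n w)%:R / n%:R)).
  by apply/funext => w; rewrite /= /Tscaled mulrC.
have iT := integrable_f_Tsum a n fL.
have mfE : measurable_fun setT (EFin \o f : measurableTypeR R -> \bar R) by exact/measurable_EFinP.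
have iTE : P.-integrable setT (EFin \o f \o Tscaled r Z a n) by rewrite fT.
have EP : (\int[distribution P (Tscaled r Z a n)]_x (f x)%:E)%E =
    (\int[P]_w f ((Tsum r Z a n w)%:R / n%:R))%:E.
  rewrite -Rintegral_EFin //; have := integral_distribution mfE iTE.
  by move=> ->; rewrite fT.
rewrite Ptheta_integral // [X in (_ - X)%E]Rintegral_EFin // EP -EFinB lee_fin.
exact: expectation_diff_le.
Qed.

(** Since n >= 1, the default value m = 1 is itself one of the competitors, so the iterated minimum
    is the true one. *)
Lemma dW_le_min a n : (a < n)%N ->
  (dW (distribution P (Tscaled r Z a n)) Ptheta <=
   (n%:R^-1 * (1 + theta) ^+ 2 +
    \big[Num.min/eps1 r Z theta n a 1]_(1 <= m < n.+1) eps1 r Z theta n a m)%:E)%E.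
Proof.
move=> an; rewrite big_nat.
apply: (big_ind (fun x => (dW (distribution P (Tscaled r Z a n)) Ptheta <=
   (n%:R^-1 * (1 + theta) ^+ 2 + x)%:E)%E)).
- exact: dW_le.
- by move=> x y hx hy; rewrite minEle; case: ifP.
- by move=> m /andP[m1 _]; exact: dW_le.
Qed.

End dickman_approximation.

(** * Smoothness by coupling *)

Section shift_bounds.
Context d (T : measurableType d) (R : realType) (P : probability T R).
Variables (r : nat -> nat) (Z : nat -> nat -> {RV P >-> nat}).
Hypothesis Z_indep : mutually_independent (index_set r) (fun p : nat * nat => Z p.1 p.2).
Implicit Types (S Q : seq nat) (e : int).

Definition ssum S (w : T) : nat := wsum Z (index_pairs r S) w.

Definition admissible S := uniq S && all (leq 1) S.

(* [shift_bound S e x] says that the law of [ssum S] and its translate by [e]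
   are at distance at most [x] in the dual norm of bounded functions. *)
Definition shift_bound S e (x : R) := forall phi : int -> R,
  (forall z, `|phi z| <= 1) ->
  `|\int[P]_w phi (ssum S w)%:Z - \int[P]_w phi ((ssum S w)%:Z + e)| <= x.

Lemma measurable_ssum S : measurable_fun setT (ssum S).
Proof. exact: measurable_wsum. Qed.

Lemma integrable_ssum S (phi : int -> R) e : (forall z, `|phi z| <= 1) ->
  P.-integrable setT (EFin \o (fun w => phi ((ssum S w)%:Z + e))).
Proof.
move=> p1; exact: (@integrable_natfun _ _ _ P _ (fun k => phi (k%:Z + e)) 1 (measurable_ssum S)).
Qed.

Lemma integrable_ssum0 S (phi : int -> R) : (forall z, `|phi z| <= 1) ->
  P.-integrable setT (EFin \o (fun w => phi (ssum S w)%:Z)).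
Proof.
move=> p1; exact: (@integrable_natfun _ _ _ P _ (fun k => phi k%:Z) 1 (measurable_ssum S)).
Qed.

Lemma ssum_abs_le1 S (phi : int -> R) e : (forall z, `|phi z| <= 1) ->
  `|\int[P]_w phi ((ssum S w)%:Z + e)| <= 1.
Proof.
move=> p1; rewrite -[leRHS](@Rintegral_prob_cst _ _ _ P).
apply: Rintegral_norm_le => //; last exact: integrable_prob_cst.
exact: integrable_measurable (integrable_ssum S e p1).
Qed.

Lemma ssum_add0 S (phi : int -> R) :
  \int[P]_w phi (ssum S w)%:Z = \int[P]_w phi ((ssum S w)%:Z + 0).
Proof. by congr (Rintegral _ _ _); apply/funext => w; rewrite addr0. Qed.

Lemma shift_boundW S e x y : x <= y -> shift_bound S e x -> shift_bound S e y.
Proof. by move=> xy H phi p1; apply: le_trans (H _ p1) xy. Qed.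

Lemma shift_bound2 S e : shift_bound S e 2.
Proof.
move=> phi p1; apply: le_trans (ler_normB _ _) _.
by rewrite ssum_add0 [2]mulr2n lerD // ssum_abs_le1.
Qed.

Lemma shift_bound0 S : shift_bound S 0 0.
Proof. by move=> phi p1; rewrite -ssum_add0 subrr normr0. Qed.

Lemma shift_boundD S e e' x y :
  shift_bound S e x -> shift_bound S e' y -> shift_bound S (e + e') (x + y).
Proof.
move=> Hx Hy phi p1.
have := lerD (Hx _ p1) (Hy (fun z => phi (z + e)) (fun z => p1 _)).
apply: le_trans; apply: le_trans (ler_normD _ _) => /=.
rewrite le_eqVlt; apply/orP; left; apply/eqP; congr (`|_|).
rewrite addrA subrK; congr (_ - Rintegral _ _ _); apply/funext => w.
by congr phi; rewrite -addrA [e + e']addrC.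
Qed.

Lemma shift_boundN S e x : shift_bound S e x -> shift_bound S (- e) x.
Proof.
move=> H phi p1; have := H (fun z => phi (z - e)) (fun z => p1 _).
rewrite distrC; congr (`|_ - _| <= _); congr (Rintegral _ _ _); apply/funext => w.
by rewrite addrK.
Qed.

Lemma shift_boundM S e x (k : nat) : shift_bound S e x -> shift_bound S (e *+ k) (k%:R * x).
Proof.
move=> H; elim: k => [|k IH]; first by rewrite mul0r mulr0n; exact: shift_bound0.
by rewrite [e *+ _]mulrS -natr1 mulrDl mul1r [e + _]addrC; exact: shift_boundD.
Qed.

Lemma shift_boundMz S e x (k : int) : shift_bound S e x ->
  shift_bound S (e *~ k) (`|k|%:R * x).
Proof.
case: k => k H; first by rewrite absz_nat; exact: shift_boundM.
by rewrite NegzE mulrNz abszN absz_nat; apply: shift_boundN; exact: shift_boundM.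
Qed.

Lemma perm_ssum S Q w : perm_eq S Q -> ssum S w = ssum Q w.
Proof. by move=> pSQ; rewrite /ssum !wsum_index_pairs; exact: perm_big. Qed.

Lemma perm_shift_bound S Q e x : perm_eq S Q -> shift_bound S e x -> shift_bound Q e x.
Proof.
move=> pSQ H phi p1; have := H _ p1.
by have -> : ssum S = ssum Q by apply/funext => w; exact: perm_ssum.
Qed.

Lemma ssum_cat S Q w : ssum (S ++ Q) w = (ssum S w + ssum Q w)%N.
Proof. by rewrite /ssum index_pairs_cat wsum_cat. Qed.

Lemma admissible_pairs S Q : admissible (S ++ Q) ->
  uniq (index_pairs r S ++ index_pairs r Q) /\
  {in index_pairs r S ++ index_pairs r Q, forall p, index_set r p}.
Proof.
move=> /andP[uS S1]; rewrite -index_pairs_cat; split; first exact: index_pairs_uniq.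
by apply: index_pairs_sub => i iS; exact: (allP S1).
Qed.

Lemma ssum_fubini S Q (f : nat -> nat -> R) c : admissible (S ++ Q) ->
  (forall k l, `|f k l| <= c) ->
  \int[P]_w f (ssum S w) (ssum Q w) = \int[P]_w \int[P]_w' f (ssum S w) (ssum Q w').
Proof. by case/admissible_pairs=> u sI fc; exact: (wsum_fubini Z_indep u sI fc). Qed.

Section split.
Variables (S Q : seq nat) (phi : int -> R) (e : int).
Hypothesis SQ : admissible (S ++ Q).
Hypothesis p1 : forall z, `|phi z| <= 1.

Definition shift_diff (k : nat) : R :=
  \int[P]_w phi (k + ssum Q w)%N%:Z - \int[P]_w phi ((k + ssum Q w)%N%:Z + e).

Lemma shift_diff_bound x k : shift_bound Q e x -> `|shift_diff k| <= x.
Proof.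
move=> H; have := H (fun z => phi (k%:Z + z)) (fun z => p1 _).
rewrite /shift_diff; congr (`|_ - _| <= _); congr (Rintegral _ _ _); apply/funext => w.
by rewrite PoszD addrA.
Qed.

Lemma shift_split :
  \int[P]_w phi (ssum (S ++ Q) w)%:Z - \int[P]_w phi ((ssum (S ++ Q) w)%:Z + e) =
  \int[P]_w shift_diff (ssum S w).
Proof.
rewrite -RintegralB //; [|exact: integrable_ssum0|exact: integrable_ssum].
pose f k l := phi (k + l)%N%:Z - phi ((k + l)%N%:Z + e).
transitivity (\int[P]_w f (ssum S w) (ssum Q w)).
  by congr (Rintegral _ _ _); apply/funext => w; rewrite ssum_cat.
rewrite (@ssum_fubini S Q f 2) //; last first.
  by move=> k l; rewrite (le_trans (ler_normB _ _)) // [2]mulr2n lerD.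
congr (Rintegral _ _ _); apply/funext => w; rewrite RintegralB //.
- exact: (@integrable_natfun _ _ _ P _ (fun l => phi (ssum S w + l)%N%:Z) 1 (measurable_ssum Q)).
- exact: (@integrable_natfun _ _ _ P _ (fun l => phi ((ssum S w + l)%N%:Z + e)) 1 (measurable_ssum Q)).
Qed.

End split.

(** Convolution with the law of an independent sum contracts the norm: the bound holds for each
    value of [ssum S] and is averaged. *)
Lemma shift_bound_cat S Q e x : admissible (S ++ Q) ->
  shift_bound Q e x -> shift_bound (S ++ Q) e x.
Proof.
move=> SQ H phi p1; rewrite shift_split //.
rewrite -[leRHS](@Rintegral_prob_cst _ _ _ P); apply: Rintegral_norm_le => //.
- exact: (@measurable_natfun _ _ _ _ _ (shift_diff Q phi e) (measurable_ssum S)).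
- by move=> w _; exact: shift_diff_bound.
- exact: integrable_prob_cst.
Qed.

Lemma shift_bound_sub S Q e x : admissible S -> uniq Q -> {subset Q <= S} ->
  shift_bound Q e x -> shift_bound S e x.
Proof.
move=> /andP[uS S1] uQ QS H.
have pS : perm_eq ([seq i <- S | i \notin Q] ++ Q) S.
  apply: uniq_perm => //.
    rewrite cat_uniq filter_uniq // uQ andbT /=; apply/hasPn => i iQ.
    by rewrite mem_filter iQ.
  by move=> i; rewrite mem_cat mem_filter; case: (boolP (i \in Q)) => [iQ|_]; rewrite ?(QS _ iQ) ?orbF.
apply: (perm_shift_bound pS); apply: shift_bound_cat => //.
by rewrite /admissible (perm_uniq pS) (perm_all _ pS) uS.
Qed.

Let atom S k : R := \int[P]_w (ssum S w == k)%:R.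

(* Mineka's coupling step: on the two atoms [i] and [i + m] of [ssum S] the
   two copies exchange their values, which moves the difference by [m]. *)
Lemma shift_bound_pair S Q e (i m : nat) x y z q : admissible (S ++ Q) ->
  (0 < m)%N -> 0 <= q -> q <= atom S i -> q <= atom S (i + m) ->
  shift_bound Q e x -> shift_bound Q (e + m%:Z) y -> shift_bound Q (e - m%:Z) z ->
  shift_bound (S ++ Q) e ((1 - 2 * q) * x + q * (y + z)).
Proof.
move=> SQ m0 q0 qi qim Hx Hy Hz phi p1; rewrite shift_split //.
set F := shift_diff Q phi e.
have Fx k : `|F k| <= x by exact: shift_diff_bound.
have x0 : 0 <= x by apply: le_trans (Fx 0%N).
have im : (i == i + m)%N = false by apply/negbTE; rewrite neq_ltn -{1}[i]addn0 ltn_add2l m0.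
(* The exchange itself: of the four expectations, the one started at i is paired with the shifted
   one started at i + m, and conversely, so the differences become e + m and e - m. *)
have FF : `|F i + F (i + m)%N| <= y + z.
  have -> : F i + F (i + m)%N = shift_diff Q phi (e + m%:Z) i + shift_diff Q phi (e - m%:Z) (i + m).
    rewrite /F /shift_diff.
    have -> : \int[P]_w phi ((i + ssum Q w)%N%:Z + (e + m%:Z)) =
              \int[P]_w phi ((i + m + ssum Q w)%N%:Z + e).
      by congr (Rintegral _ _ _); apply/funext => w; congr phi; rewrite !PoszD; ring.
    have -> : \int[P]_w phi ((i + m + ssum Q w)%N%:Z + (e - m%:Z)) =
              \int[P]_w phi ((i + ssum Q w)%N%:Z + e).
      by congr (Rintegral _ _ _); apply/funext => w; congr phi; rewrite !PoszD; ring.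
    ring.
  apply: le_trans (ler_normD _ _) _; apply: lerD.
    exact: shift_diff_bound.
  exact: shift_diff_bound.
pose a k : R := (k == i)%:R; pose b k : R := (k == i + m)%N%:R.
(* Off the two atoms, and for their mass in excess of [q], the difference stays e and costs [x].
   Only the mass [q] of each atom takes part in the exchange. *)
pose h k := F k - F i * a k - F (i + m)%N * b k.
have ib (u : nat -> R) c : (forall k, `|u k| <= c) ->
    P.-integrable setT (EFin \o (fun w => u (ssum S w))).
  by move=> uc; exact: (integrable_natfun P (measurable_ssum S) uc).
have b1 (u : bool) : `|u%:R : R| <= 1 by case: u; rewrite ?normr1 ?normr0.
have ia : P.-integrable setT (EFin \o (fun w => a (ssum S w))) by apply: (ib a 1) => k; exact: b1.
have ib' : P.-integrable setT (EFin \o (fun w => b (ssum S w))) by apply: (ib b 1) => k; exact: b1.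
have iF : P.-integrable setT (EFin \o (fun w => F (ssum S w))) by apply: (ib F x).
have iFa : P.-integrable setT (EFin \o (fun w => F i * a (ssum S w))) by exact: integrableZR.
have iFb : P.-integrable setT (EFin \o (fun w => F (i + m)%N * b (ssum S w))) by exact: integrableZR.
have iFFa : P.-integrable setT (EFin \o (fun w => F (ssum S w) - F i * a (ssum S w))).
  exact: integrableBR.
have ih : P.-integrable setT (EFin \o (fun w => h (ssum S w))) by exact: integrableBR.
have ixa : P.-integrable setT (EFin \o (fun w => x * a (ssum S w))) by exact: integrableZR.
have ixb : P.-integrable setT (EFin \o (fun w => x * b (ssum S w))) by exact: integrableZR.
have icx := integrable_prob_cst P x.
have ixx : P.-integrable setT (EFin \o (fun w => x - x * a (ssum S w))) by exact: integrableBR.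
have hx : `|\int[P]_w h (ssum S w)| <= x - x * atom S i - x * atom S (i + m).
  have -> : x - x * atom S i - x * atom S (i + m) =
     \int[P]_w (x - x * a (ssum S w) - x * b (ssum S w)).
    by rewrite RintegralB // RintegralB // !RintegralZl // Rintegral_prob_cst.
  apply: Rintegral_norm_le => //; first exact: integrable_measurable ih.
    move=> w _; move: (ssum S w) => k; rewrite /h /a /b.
    case: (k =P i) => [->|_]; first by rewrite im !(mulr1, mulr0) subrr subr0 normr0 subrr subr0.
    case: (k =P (i + m)%N) => [->|_]; first by rewrite !(mulr1, mulr0) !subr0 subrr normr0 subrr.
    by rewrite !mulr0 !subr0.
  exact: integrableBR.
have FE : \int[P]_w F (ssum S w) = \int[P]_w h (ssum S w) + atom S i * F i + atom S (i + m) * F (i + m)%N.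
  rewrite /h RintegralB // RintegralB // !RintegralZl //.
  by rewrite -/(atom S i) -/(atom S (i + m)); ring.
rewrite FE.
set A := atom S i; set B := atom S (i + m); set H := Rintegral _ _ _.
have -> : H + A * F i + B * F (i + m)%N =
   H + q * (F i + F (i + m)%N) + ((A - q) * F i + (B - q) * F (i + m)%N) by ring.
apply: le_trans (ler_normD _ _) _.
have t1 : `|H + q * (F i + F (i + m)%N)| <= x - x * A - x * B + q * (y + z).
  by apply: le_trans (ler_normD _ _) _; rewrite lerD // normrM ger0_norm // ler_wpM2l.
have t2 : `|(A - q) * F i + (B - q) * F (i + m)%N| <= (A - q) * x + (B - q) * x.
  have A0 : 0 <= A - q by rewrite subr_ge0.
  have B0 : 0 <= B - q by rewrite subr_ge0.
  apply: le_trans (ler_normD _ _) _; rewrite !normrM (ger0_norm A0) (ger0_norm B0).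
  by rewrite lerD // ler_wpM2l.
by apply: le_trans (lerD t1 t2) _; rewrite le_eqVlt; apply/orP; left; apply/eqP; ring.
Qed.

Lemma D1_le_shift a n x : shift_bound (index_iota a.+1 n.+1) 1 x ->
  D1 P (Tsum r Z a n) <= x.
Proof.
move=> H; rewrite /D1 /dTV; apply: ge_sup; first by have [] := D1_has_sup P (Tsum r Z a n).
move=> _ [A mA <-].
pose phi (z : int) : R := \1_A `|z|%N.
have p1 z : `|phi z| <= 1 by rewrite /phi indicE; case: (_ \in _); rewrite ?normr1 ?normr0.
have := H _ p1.
have TE w : ssum (index_iota a.+1 n.+1) w = Tsum r Z a n w by rewrite Tsum_wsum.
have -> : \int[P]_w phi (ssum (index_iota a.+1 n.+1) w)%:Z =
    fine (distribution P (Tsum r Z a n) A).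
  rewrite -(@Rintegral_indic_nat _ _ _ P (Tsum r Z a n)) //.
  by congr (Rintegral _ _ _); apply/funext => w; rewrite TE /phi absz_nat.
have -> : \int[P]_w phi ((ssum (index_iota a.+1 n.+1) w)%:Z + 1) =
    fine (distribution P (shift1 (Tsum r Z a n)) A).
  rewrite -(@Rintegral_indic_nat _ _ _ P (shift1 (Tsum r Z a n))) //.
  by congr (Rintegral _ _ _); apply/funext => w; rewrite TE /phi -PoszD absz_nat addn1.
by [].
Qed.

End shift_bounds.

(** * Lower bounds for atoms *)

Section atoms.
Context d (T : measurableType d) (R : realType) (P : probability T R).
Variables (r : nat -> nat) (Z : nat -> nat -> {RV P >-> nat}).
Hypothesis r_pos : forall i : nat, (1 <= i)%N -> (1 <= r i)%N.
Hypothesis Z_indep : mutually_independent (index_set r) (fun p : nat * nat => Z p.1 p.2).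
Hypothesis Z_ident : forall i j : nat, (1 <= i)%N -> (1 <= j <= r i)%N ->
  forall A : set nat, measurable A ->
  distribution P (Z i j) A = distribution P (Z i 1%N) A.
Hypothesis theta_fin :
  (ereal_sup [set theta_bar r Z i | i in [set i | (1 <= i)%N]] < +oo)%E.

Definition atom (X : T -> nat) k : R := \int[P]_w (X w == k)%:R.

Lemma atomE (X : T -> nat) k : measurable_fun setT X ->
  atom X k = fine (P [set w | X w = k]).
Proof.
move=> mX; rewrite -(@Rintegral_indic_nat _ _ _ P X [set k]) //.
congr (Rintegral _ _ _); apply/funext => w; rewrite indicE; congr (nat_of_bool _)%:R.
by apply/eqP/idP; rewrite inE.
Qed.

Lemma boolR_norm (b : bool) : `|b%:R : R| <= 1.
Proof. by case: b; rewrite ?normr1 ?normr0. Qed.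

Lemma integrable_atom (X : T -> nat) k : measurable_fun setT X ->
  P.-integrable setT (EFin \o (fun w => (X w == k)%:R)).
Proof. by move=> mX; exact: (@integrable_natfun _ _ _ P X (fun l => (l == k)%:R) 1 mX (fun l => boolR_norm _)). Qed.

Lemma atom_ge0 (X : T -> nat) k : 0 <= atom X k.
Proof. by apply: Rintegral_ge0. Qed.

Lemma atom_wsum_mul s1 s2 k l : uniq (s1 ++ s2) ->
  {in s1 ++ s2, forall p, index_set r p} ->
  \int[P]_w ((wsum Z s1 w == k)%:R * (wsum Z s2 w == l)%:R) =
  atom (wsum Z s1) k * atom (wsum Z s2) l.
Proof.
move=> us sI.
rewrite (@wsum_fubini _ _ _ P r Z Z_indep s1 s2 (fun x y => (x == k)%:R * (y == l)%:R) 1 us sI); last first.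
  by move=> x y; case: eqP; case: eqP; rewrite ?mulr0 ?mul0r ?mulr1 ?normr0 ?normr1.
rewrite mulrC -RintegralZl //; last by apply: integrable_atom; exact: measurable_wsum.
congr (Rintegral _ _ _); apply/funext => w; rewrite RintegralZl; first by rewrite mulrC.
  by [].
by apply: integrable_atom; exact: measurable_wsum.
Qed.

Lemma ssum1E i w : ssum r Z [:: i] w = (i * Zsum r Z i w)%N.
Proof. by rewrite /ssum wsum_index_pairs big_cons big_nil addn0. Qed.

Lemma Zsum_mean i : (1 <= i)%N -> \int[P]_w (Zsum r Z i w)%:R = theta_ r Z i / i%:R.
Proof.
move=> i1; rewrite (mean_Zsum Z_ident theta_fin i1) (theta_E Z_ident theta_fin i1) natrM.
by field; rewrite pnatr_eq0 -lt0n.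
Qed.

(** Markov's inequality: 1 - Z_i is at most the indicator of Z_i = 0. *)
Lemma atom_zero_ge i : (1 <= i)%N -> 1 - theta_ r Z i / i%:R <= atom (ssum r Z [:: i]) 0.
Proof.
move=> i1; have iZ := integrable_Zsum theta_fin i1.
have i1Z : P.-integrable setT (EFin \o (fun w => 1 - (Zsum r Z i w)%:R)).
  by apply: integrableBR => //; exact: (integrable_prob_cst P 1).
have -> : 1 - theta_ r Z i / i%:R = \int[P]_w (1 - (Zsum r Z i w)%:R).
  rewrite RintegralB //; last exact: (integrable_prob_cst P 1).
  by rewrite Rintegral_prob_cst Zsum_mean.
apply: le_Rintegral => //.
- by apply: integrable_atom; exact: measurable_ssum.
- move=> w _; rewrite ssum1E muln_eq0 -leqn0 leqNgt i1 /=.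
  by case: (Zsum r Z i w) => [|k] /=; [rewrite subr0|rewrite lerBlDr add0r ler1n].
Qed.

(** Z_i = 1 contains the disjoint events, one for each j, that the j-th copy is 1 and the others
    vanish. By the bound on [eps], the copy is 1 with probability at least half its mean; the others
    vanish with at least the probability that Z_i = 0. The r_i means add up to theta_i / i. *)
Lemma atom_one_ge i : (1 <= i)%N -> - 2^-1 <= eps r Z i 1 -> theta_ r Z i <= i%:R ->
  theta_ r Z i / i%:R / 2 * (1 - theta_ r Z i / i%:R) <= atom (ssum r Z [:: i]) i.
Proof.
move=> i1 e1 thi.
have i0 : 0 < i%:R :> R by rewrite ltr0n.
have t1 : 0 <= 1 - theta_ r Z i / i%:R by rewrite subr_ge0 ler_pdivrMr // mul1r.
have [m0|m0] := eqVneq (mean1 Z i) 0.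
  by rewrite (theta_E Z_ident theta_fin i1) m0 mulr0 !mul0r; exact: atom_ge0.
have mge0 : 0 <= mean1 Z i by exact: mean1_ge0.
set row := index_pairs r [:: i].
have urow : uniq row by exact: index_pairs_uniq.
have rowI : {in row, forall p, index_set r p}.
  by apply: index_pairs_sub => k; rewrite inE => /eqP ->.
pose h j w : R := (wsum Z [:: (i, j)] w == i)%:R * (wsum Z (rem (i, j) row) w == 0%N)%:R.
have jrow j : (1 <= j < (r i).+1)%N -> (i, j) \in row.
  by rewrite ltnS => jr; rewrite mem_index_pairs inE eqxx.
have one j w : wsum Z [:: (i, j)] w = (i * Z i j w)%N by rewrite /wsum big_cons big_nil addn0.
have rowE j w : (1 <= j < (r i).+1)%N ->
    ssum r Z [:: i] w = (wsum Z [:: (i, j)] w + wsum Z (rem (i, j) row) w)%N.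
  move=> /jrow jr; rewrite -wsum_cat /=; apply: perm_wsum; exact: perm_to_rem.
have Ej j : (1 <= j < (r i).+1)%N ->
    mean1 Z i / 2 * (1 - theta_ r Z i / i%:R) <= \int[P]_w h j w.
  move=> jr; have pr := perm_to_rem (jrow _ jr).
  have us : uniq ([:: (i, j)] ++ rem (i, j) row) by rewrite -(perm_uniq pr).
  have sI : {in [:: (i, j)] ++ rem (i, j) row, forall p, index_set r p}.
    by move=> p; rewrite -(perm_mem pr); exact: rowI.
  rewrite /h (atom_wsum_mul i 0 us sI).
  apply: ler_pM => //; first by rewrite divr_ge0.
    have -> : atom (wsum Z [:: (i, j)]) i = fine (P [set w | Z i 1%N w = 1%N]).
      rewrite atomE; last exact: measurable_wsum.
      rewrite -(Z_prob Z_ident (j := j)) //; congr (fine (P _)); apply/seteqP; split => w /=; rewrite one.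
        by move=> E; apply/eqP; rewrite -(eqn_pmul2l i1) muln1; apply/eqP.
      by move=> ->; rewrite muln1.
    rewrite (Z_prob_eps r_pos Z_ident theta_fin 1 i1 m0) ler_wpM2l //.
    by rewrite -lerBlDr; apply: le_trans e1; rewrite eqxx /= mulr1n; lra.
  apply: le_trans (atom_zero_ge i1) _; apply: le_Rintegral => //.
  - by apply: integrable_atom; exact: measurable_ssum.
  - by apply: integrable_atom; exact: measurable_wsum.
  - move=> w _; rewrite (rowE j) // addn_eq0 ler_nat.
    by case: (wsum Z [:: _] w == 0%N).
have ih j : P.-integrable setT (EFin \o h j).
  apply: (@integrable_dom _ _ _ P setT measurableT _ (fun w => (wsum Z [:: (i, j)] w == i)%:R)).
  - exact: (measurable_natfun2 (fun x y => (x == i)%:R * (y == 0%N)%:R : R)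
      (measurable_wsum Z [:: (i, j)]) (measurable_wsum Z (rem (i, j) row))).
  - by move=> w _; rewrite /h; case: (_ == i); case: (_ == 0%N);
      rewrite ?mulr1 ?mulr0 ?mul0r ?normr1 ?normr0.
  - by apply: integrable_atom; exact: measurable_wsum.
apply: le_trans (_ : \sum_(1 <= j < (r i).+1) \int[P]_w h j w <= _).
  apply: le_trans (_ : \sum_(1 <= j < (r i).+1) mean1 Z i / 2 * (1 - theta_ r Z i / i%:R) <= _).
    rewrite sumr_const_nat subn1 /= -[leRHS]mulr_natl (theta_E Z_ident theta_fin i1) natrM.
    by rewrite le_eqVlt; apply/orP; left; apply/eqP; field; rewrite gt_eqF.
  exact: ler_sum_nat.
rewrite -Rintegral_sum //; apply: le_Rintegral => //.
- exact: integrable_sumR.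
- by apply: integrable_atom; exact: measurable_ssum.
move=> w _.
apply: le_trans (_ : \sum_(1 <= j < (r i).+1) (Z i j w == 1%N)%:R * (ssum r Z [:: i] w == i)%:R <= _).
  apply: ler_sum_nat => j jr; rewrite /h (rowE j) // one -natrM -natrM ler_nat.
  have -> : (i * Z i j w == i)%N = (Z i j w == 1%N).
    by rewrite -[RHS](eqn_pmul2l i1) muln1.
  case: eqP => [->|_] //; rewrite muln1 !mul1n.
  by case: eqP => // ->; rewrite addn0 eqxx.
rewrite -mulr_suml; case: eqP => [E|_]; last by rewrite mulr0.
rewrite mulr1 -natr_sum /= ler_nat.
have ZS : Zsum r Z i w = 1%N.
  by apply/eqP; rewrite -(eqn_pmul2l i1) -ssum1E muln1; apply/eqP.
rewrite -[leqRHS]ZS /Zsum; apply: leq_sum => j _.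
by case: (Z i j w) => [|[|k]].
Qed.

(** One of the two variables is 1 and the other 0. The vanishing one contributes at least 1/2, and
    the other at least theta_k / (4k), hence psi / k; this is what the 4 in [4 * psi] is for. *)
Lemma atom_pair_ge i m (psi : R) : (1 <= i)%N -> (0 < m)%N -> 0 < psi ->
  2 * theta_ r Z i <= i%:R -> 2 * theta_ r Z (i + m) <= i%:R ->
  4 * psi <= theta_ r Z i -> 4 * psi <= theta_ r Z (i + m) ->
  - 2^-1 <= eps r Z i 1 -> - 2^-1 <= eps r Z (i + m) 1 ->
  psi / (2 * (i + m)%:R) <= atom (ssum r Z [:: i; (i + m)%N]) i /\
  psi / (2 * (i + m)%:R) <= atom (ssum r Z [:: i; (i + m)%N]) (i + m).
Proof.
move=> i1 m0 psi0 ti tim pi pim ei eim.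
have im1 : (1 <= i + m)%N by rewrite (leq_trans i1) // leq_addr.
have iR : 0 < i%:R :> R by rewrite ltr0n.
have imR : 0 < (i + m)%:R :> R by rewrite ltr0n.
have iim : i%:R <= (i + m)%:R :> R by rewrite ler_nat leq_addr.
have i_im : (i == i + m)%N = false.
  by apply/negbTE; rewrite neq_ltn -{1}[i]addn0 ltn_add2l m0.
have half k (x : R) : 0 < x -> 2 * theta_ r Z k <= x -> 2^-1 <= 1 - theta_ r Z k / x.
  move=> x0 kx; have : theta_ r Z k / x <= 2^-1 by rewrite ler_pdivrMr // mulrC ler_pdivlMr // mulrC.
  by lra.
have z1 := le_trans (half _ _ iR ti) (atom_zero_ge i1).
have z2 := le_trans (half _ _ imR (le_trans tim iim)) (atom_zero_ge im1).
have one k : (1 <= k)%N -> 4 * psi <= theta_ r Z k -> 2 * theta_ r Z k <= k%:R ->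
    - 2^-1 <= eps r Z k 1 -> psi / k%:R <= atom (ssum r Z [:: k]) k.
  move=> k1 pk tk ek; have kR : 0 < k%:R :> R by rewrite ltr0n.
  have th0 := theta_ge0 r Z k.
  have tk' : theta_ r Z k <= k%:R by apply: le_trans tk; rewrite mulr_natl mulr2n lerDl.
  apply: le_trans (atom_one_ge k1 ek tk').
  have h := half _ _ kR tk.
  apply: le_trans (_ : theta_ r Z k / k%:R / 2 * 2^-1 <= _); last first.
    by rewrite ler_wpM2l // divr_ge0 // divr_ge0.
  have -> : theta_ r Z k / k%:R / 2 / 2 = (theta_ r Z k / 4) / k%:R by field; rewrite gt_eqF.
  by rewrite ler_wpM2r ?invr_ge0 // ler_pdivlMr // mulrC.
have o1 := one _ i1 pi ti ei; have o2 := one _ im1 pim (le_trans tim iim) eim.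
have adm : admissible ([:: i] ++ [:: (i + m)%N]).
  by rewrite /admissible /= inE i_im i1 im1.
have [us sI] := admissible_pairs r adm.
have mul k l := atom_wsum_mul k l us sI.
have pairE w : ssum r Z [:: i; (i + m)%N] w = (ssum r Z [:: i] w + ssum r Z [:: (i + m)%N] w)%N.
  by rewrite -ssum_cat.
have lower k l : atom (ssum r Z [:: i]) k * atom (ssum r Z [:: (i + m)%N]) l <=
    atom (ssum r Z [:: i; (i + m)%N]) (k + l).
  rewrite -mul; apply: le_Rintegral => //.
  - apply: (@integrable_dom _ _ _ P setT measurableT _ (fun=> 1)).
    + exact: (measurable_natfun2 (fun x y => (x == k)%:R * (y == l)%:R : R)
        (measurable_wsum Z _) (measurable_wsum Z _)).
    + by move=> w _; case: eqP; case: eqP; rewrite ?mulr0 ?mul0r ?mulr1 ?normr0 ?normr1.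
    + exact: integrable_prob_cst.
  - by apply: integrable_atom; exact: measurable_ssum.
  - move=> w _; rewrite pairE -natrM ler_nat /ssum.
    by case: eqP => [->|//]; case: eqP => [->|//]; rewrite eqxx.
split.
  rewrite -[X in atom _ X](addn0 i); apply: le_trans (lower i 0%N).
  apply: le_trans (_ : psi / i%:R * 2^-1 <= _); last by rewrite ler_pM // divr_ge0 // ltW.
  rewrite invfM mulrA mulrAC ler_wpM2r // ler_wpM2l ?lef_pV2 // ltW //.
rewrite -[X in atom _ X](add0n (i + m)%N); apply: le_trans (lower 0%N (i + m)%N).
apply: le_trans (_ : 2^-1 * (psi / (i + m)%:R) <= _); last first.
  by rewrite ler_pM // divr_ge0 // ltW.
by rewrite invfM mulrCA.
Qed.

End atoms.

(** * Potentials of the walk modulo [v] *)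

Section potential.
Variables (u v : nat).
Hypotheses (v_gt0 : (0 < v)%N) (uv : coprime u v).

Lemma coprime_inverse : exists u' : int, ((u%:Z * u')%R = 1 %[mod v])%Z.
Proof.
have [a [b E]] := Bezoutz u v.
exists a; rewrite mulrC; apply/eqP; rewrite eqz_mod_dvd.
have -> : a * u%:Z - 1 = - b * v%:Z :> int.
  have gE : gcdz u v = 1 by rewrite /gcdz /= (eqP uv).
  by move: E; rewrite gE => E; apply/eqP; rewrite subr_eq mulNr addrC -E addrK.
exact: dvdz_mull.
Qed.

Definition uinv : int := xget 0 [set u' : int | ((u%:Z * u')%R = 1 %[mod v])%Z].

Lemma uinvP : ((u%:Z * uinv)%R = 1 %[mod v])%Z.
Proof.
exact: (@xgetPex _ 0 [set u' : int | ((u%:Z * u')%R = 1 %[mod v])%Z] coprime_inverse).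
Qed.

(* The number of steps [-u] leading from [e] to a multiple of [v]. *)
Definition residue (e : int) : int := ((e * uinv)%R %% v)%Z.

Let vz0 : v%:Z != 0. Proof. by rewrite eqz_nat -lt0n. Qed.

Lemma residue_itv e : 0 <= residue e < v%:Z.
Proof. by rewrite /residue modz_ge0 //= ltz_pmod // ltz_nat. Qed.

Lemma residue_eq0 e : residue e = 0 -> (v%:Z %| e)%Z.
Proof.
move=> H; have : (v%:Z %| (e * uinv)%R)%Z by apply/dvdz_mod0P.
move=> /(dvdz_mulr u%:Z) D.
have -> : e = (e * uinv * u%:Z) - e * (u%:Z * uinv - 1) by ring.
apply: rpredB; first exact: D.
by apply: dvdz_mull; rewrite -eqz_mod_dvd; apply/eqP; exact: uinvP.
Qed.

Lemma residue_add e : residue e != 0 ->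
  residue (e + u%:Z) = (if residue e + 1 == v%:Z then 0 else residue e + 1).
Proof.
move=> e0; have /andP[r0 rv] := residue_itv e.
have -> : residue (e + u%:Z) = ((residue e + 1)%R %% v)%Z.
  rewrite /residue mulrDl; apply/eqP; rewrite eqz_mod_dvd.
  have -> : e * uinv + u%:Z * uinv - (((e * uinv) %% v)%Z + 1) =
     (e * uinv - ((e * uinv) %% v)%Z) + (u%:Z * uinv - 1) by ring.
  apply: rpredD; last by rewrite -eqz_mod_dvd; apply/eqP; exact: uinvP.
  by rewrite -eqz_mod_dvd modz_mod.
case: eqP => [->|/eqP ne]; first by rewrite modzz.
rewrite modz_small // addr_ge0 //= lt_neqAle ne /=; lia.
Qed.

Lemma residue_sub e : residue e != 0 -> residue (e - u%:Z) = residue e - 1.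
Proof.
move=> e0; have /andP[r0 rv] := residue_itv e.
have -> : residue (e - u%:Z) = ((residue e - 1)%R %% v)%Z.
  rewrite /residue mulrBl; apply/eqP; rewrite eqz_mod_dvd.
  have -> : e * uinv - u%:Z * uinv - (((e * uinv) %% v)%Z - 1) =
     (e * uinv - ((e * uinv) %% v)%Z) - (u%:Z * uinv - 1) by ring.
  apply: rpredB; last by rewrite -eqz_mod_dvd; apply/eqP; exact: uinvP.
  by rewrite -eqz_mod_dvd modz_mod.
rewrite modz_small //; move: e0 r0 rv; lia.
Qed.

Context {R : realType}.

(* Along the walk with steps [u] and [- u] stopped at the multiples of [v],
   [wpot] is strictly superharmonic and [bpot] superharmonic. *)
Definition wpot (e : int) : R := (residue e)%:~R * (v%:R - (residue e)%:~R).

Lemma wpot0 e : residue e = 0 -> wpot e = 0.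
Proof. by move=> E; rewrite /wpot E mul0r. Qed.

Lemma wpot_ge0 e : 0 <= wpot e.
Proof.
have /andP[r0 rv] := residue_itv e.
rewrite /wpot mulr_ge0 ?ler0z // subr_ge0 -[v%:R]/(v%:Z%:~R) ler_int; exact: ltW.
Qed.

Lemma wpot_le e : wpot e <= v%:R ^+ 2.
Proof.
have /andP[r0 rv] := residue_itv e.
have r0' : 0 <= (residue e)%:~R :> R by rewrite ler0z.
have rv' : (residue e)%:~R <= v%:R :> R by rewrite -[v%:R]/(v%:Z%:~R) ler_int; exact: ltW.
rewrite /wpot expr2; apply: ler_pM => //; first by rewrite subr_ge0.
by rewrite gerBl.
Qed.

Lemma wpot_ge1 e : residue e != 0 -> 1 <= wpot e.
Proof.
move=> e0; have /andP[r0 rv] := residue_itv e.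
rewrite /wpot -[v%:R]/(v%:Z%:~R) -intrB -intrM -[1]/(1%:~R) ler_int.
move: e0 r0 rv; move: (residue e) => x; nia.
Qed.

(** The second difference of x (v - x) is -2, and the jump of the residue from v to 0 is harmless
    because the product vanishes at both ends. [wpot] is the mean absorption time of the simple walk
    on {0, ..., v}. *)
Lemma wpot_step e : residue e != 0 ->
  wpot (e + u%:Z) + wpot (e - u%:Z) = 2 * wpot e - 2.
Proof.
move=> e0; rewrite /wpot residue_sub // residue_add //.
rewrite intrB; case: eqP => [E|_]; last by rewrite intrD; ring.
have -> : v%:R = (residue e)%:~R + 1 :> R by rewrite -[v%:R]/(v%:Z%:~R) -E intrD.
ring.
Qed.

Definition bpot (e : int) : R := `|e|%:~R + u%:R * wpot e.

(** Two steps raise |e| by at most 2u in total, and u times the drop 2 of [wpot] compensates this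
    exactly. Thus [bpot] bounds the mean of |e| when the walk stops. *)
Lemma bpot_step e : residue e != 0 ->
  bpot (e + u%:Z) + bpot (e - u%:Z) <= 2 * bpot e.
Proof.
move=> e0; rewrite /bpot.
have n1 : `|e + u%:Z|%:~R <= `|e|%:~R + u%:R :> R.
  by rewrite -[u%:R]/(u%:Z%:~R) -intrD ler_int (le_trans (ler_normD _ _)).
have n2 : `|e - u%:Z|%:~R <= `|e|%:~R + u%:R :> R.
  by rewrite -[u%:R]/(u%:Z%:~R) -intrD ler_int (le_trans (ler_normB _ _)).
have := wpot_step e0; move: n1 n2.
move: (wpot (e + _)) (wpot (e - _)) (wpot e) (`|e + _|%:~R : R) (`|e - _|%:~R : R) (`|e|%:~R : R) (u%:R : R).
move=> a b c A B C U n1 n2 s.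
have -> : a = 2 * c - 2 - b by lra.
lra.
Qed.

Lemma bpot_ge e : `|e|%:~R <= bpot e.
Proof. by rewrite /bpot lerDl mulr_ge0 // wpot_ge0. Qed.

End potential.

(** * Iterated coupling steps *)

Section chains.
Context d (T : measurableType d) (R : realType) (P : probability T R).
Variables (r : nat -> nat) (Z : nat -> nat -> {RV P >-> nat}).
Hypothesis Z_indep : mutually_independent (index_set r) (fun p : nat * nat => Z p.1 p.2).
Implicit Types (M Q : seq nat) (e : int).

Definition pair_seq m M : seq nat := flatten [seq [:: i; (i + m)%N] | i <- M].

Definition atoms_ge m (q : R) i :=
  (q <= atom P (ssum r Z [:: i; (i + m)%N]) i) &&
  (q <= atom P (ssum r Z [:: i; (i + m)%N]) (i + m)).

Lemma admissible_catr S Q : admissible (S ++ Q) -> admissible Q.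
Proof. by rewrite /admissible cat_uniq all_cat => /andP[/and3P[_ _ ->] /andP[_ ->]]. Qed.

(** One pair sends the difference m to 0 or to 2m with weight q each, so the bound y becomes (1 -
    2q) y + q x. Started at x, this recursion tends geometrically to its fixed point x / 2. *)
Lemma shift_bound_double M Q m x q : admissible (pair_seq m M ++ Q) -> (0 < m)%N ->
  0 <= q -> all (atoms_ge m q) M ->
  shift_bound r Z Q m x -> shift_bound r Z Q (m%:Z + m%:Z) x ->
  shift_bound r Z (pair_seq m M ++ Q) m (x * (2^-1 + 2^-1 * (1 - 2 * q) ^+ size M)).
Proof.
move=> adm m0 q0 aM H1 H2; elim: M adm aM => [_ _|i M IH].
  by rewrite (_ : x * _ = x) //= expr0; field.
rewrite /pair_seq /= -/(pair_seq m M).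
move=> adm /andP[/andP[a1 a2] aM].
have adm' : admissible ([:: i; (i + m)%N] ++ (pair_seq m M ++ Q)) by [].
have admQ := admissible_catr adm'.
have S1 := IH admQ aM.
have S2 : shift_bound r Z (pair_seq m M ++ Q) (m%:Z + m%:Z) x.
  by apply: shift_bound_cat.
have S3 : shift_bound r Z (pair_seq m M ++ Q) (m%:Z - m%:Z) 0.
  by rewrite subrr; exact: shift_bound0.
have := shift_bound_pair Z_indep adm' m0 q0 a1 a2 S1 S2 S3.
by apply: shift_boundW; rewrite le_eqVlt; apply/orP; left; apply/eqP; rewrite exprS; field.
Qed.

(** [bpot] does not grow on average. A pair lowers the mean of [wpot] by 2q, at least the fraction
    2q / v^2 of it because wpot <= v^2; hence the factor per pair. Where the residue is 0 the walk
    stops and the pair is left aside. *)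
Lemma shift_bound_potential u v M Q (eps t q : R) :
  (0 < v)%N -> coprime u v -> (0 < u)%N ->
  admissible (pair_seq u M ++ Q) -> 0 <= q -> all (atoms_ge u q) M ->
  0 <= eps -> 0 <= t -> 2 * q <= v%:R ^+ 2 ->
  (forall e, shift_bound r Z Q e (eps * bpot u v e + 2 * wpot u v e * t)) ->
  forall e, shift_bound r Z (pair_seq u M ++ Q) e
    (eps * bpot u v e + 2 * wpot u v e * (t * (1 - 2 * q / v%:R ^+ 2) ^+ size M)).
Proof.
move=> v0 uv u0 adm q0 aM eps0 t0 qv HQ; elim: M adm aM => [_ _ e|i M IH].
  by rewrite expr0 mulr1; exact: HQ.
rewrite /pair_seq /= -/(pair_seq u M) => adm /andP[/andP[a1 a2] aM] e.
have adm' : admissible ([:: i; (i + u)%N] ++ (pair_seq u M ++ Q)) by [].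
have admQ := admissible_catr adm'.
have {}IH := IH admQ aM.
have [e0|e0] := eqVneq (residue u v e) 0.
  rewrite wpot0 // mulr0 mul0r addr0.
  have := IH e; rewrite wpot0 // mulr0 mul0r addr0; exact: (shift_bound_cat Z_indep adm').
have := shift_bound_pair Z_indep adm' u0 q0 a1 a2 (IH e) (IH (e + u%:Z)) (IH (e - u%:Z)).
apply: shift_boundW.
have v2 : 0 < v%:R ^+ 2 :> R by rewrite exprn_gt0 // ltr0n.
have k0 : 0 <= 1 - 2 * q / v%:R ^+ 2 by rewrite subr_ge0 ler_pdivrMr // mul1r.
set s := t * (1 - 2 * q / v%:R ^+ 2) ^+ size M.
have s0 : 0 <= s by rewrite mulr_ge0 // exprn_ge0.
have -> : t * (1 - 2 * q / v%:R ^+ 2) ^+ size (i :: M) = (1 - 2 * q / v%:R ^+ 2) * s.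
  by rewrite /s mulrCA -exprS.
have Bs := bpot_step v0 uv (R := R) e0.
have Ws := wpot_step v0 uv (R := R) e0.
have W1 := @wpot_le u v v0 R e.
set W := wpot u v e in Ws W1 *; set Wp := wpot u v (e + _) in Ws *.
set Wm := wpot u v (e - _) in Ws *.
set B := bpot u v e in Bs *; set Bp := bpot u v (e + _) in Bs *.
set Bm := bpot u v (e - _) in Bs *.
have -> : (1 - 2 * q) * (eps * B + 2 * W * s) + q * (eps * Bp + 2 * Wp * s + (eps * Bm + 2 * Wm * s)) =
   (1 - 2 * q) * (eps * B) + q * eps * (Bp + Bm) + ((1 - 2 * q) * (2 * W * s) + 2 * q * s * (Wp + Wm)) by ring.
rewrite Ws.
have T1 : q * eps * (Bp + Bm) <= q * eps * (2 * B) by rewrite ler_wpM2l // mulr_ge0.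
have T2 : 4 * q * s * (W / v%:R ^+ 2) <= 4 * q * s.
  apply: ler_piMr; first by rewrite mulr_ge0 // mulr_ge0.
  by rewrite ler_pdivrMr // mul1r.
have -> : eps * B + 2 * W * ((1 - 2 * q / v%:R ^+ 2) * s) =
   eps * B + 2 * W * s - 4 * q * s * (W / v%:R ^+ 2).
  by field; rewrite pnatr_eq0 -lt0n.
lra.
Qed.

End chains.

(** * Disjoint pairs inside a window *)

Section windows.
Variables (k : nat) (good : nat -> Prop).
Hypothesis k_gt0 : (0 < k)%N.
Hypothesis good_blocks : forall j, (1 <= j)%N ->
  exists i, good i /\ (j * k + 1 <= i <= j.+1 * k)%N.

Lemma perm_pair_seq m M : perm_eq (pair_seq m M) (M ++ map (addn^~ m) M).
Proof.
elim: M => // i M IH; rewrite /pair_seq /= perm_cons.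
rewrite -[in X in perm_eq _ X](cat1s (i + m)%N) perm_sym perm_catCA perm_sym /=.
by rewrite perm_cons.
Qed.

(** Passing from i to i + m flips the parity of i / m, so no partner i + m belongs to the chosen
    class. *)
Lemma uniq_pair_seq m M (b : bool) : (0 < m)%N -> uniq M ->
  {in M, forall i, odd (i %/ m) = b} -> uniq (pair_seq m M).
Proof.
move=> m0 uM oM; rewrite (perm_uniq (perm_pair_seq m M)) cat_uniq uM /=.
rewrite map_inj_uniq ?uM ?andbT; last by move=> x y /addIn.
apply/hasPn => _ /mapP[i iM ->]; apply/negP => imM.
have := oM _ imM; rewrite divnDr // divnn m0 addn1 /= (oM _ iM).
by case: b {oM}.
Qed.

(** One good index is taken from each of the 6L blocks with number j in [L,
    7L[; these indices lie in ]kL, 7kL], and m <= kL keeps the partners below 8kL. The more frequent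
    parity of i / m retains at least 3L of them. *)
Lemma exists_window_pairs m L : (1 <= L)%N -> (0 < m)%N -> (m <= k * L)%N ->
  exists M : seq nat, [/\ uniq (pair_seq m M),
    {in pair_seq m M, forall x, k * L < x <= 8 * (k * L)}%N,
    {in M, forall i, good i /\ (k * L < i)%N /\ (i + m <= 8 * (k * L))%N} &
    (3 * L <= size M)%N].
Proof.
move=> L1 m0 mL.
have [f fP] : exists f : nat -> nat, forall j, (1 <= j)%N ->
    good (f j) /\ (j * k + 1 <= f j <= j.+1 * k)%N.
  have /choice[f fP] : forall j, exists i, (1 <= j)%N -> good i /\ (j * k + 1 <= i <= j.+1 * k)%N.
    move=> j; have [j1|j1] := leqP 1 j; last by exists 0%N.
    by have [i iP] := good_blocks j1; exists i.
  by exists f.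
pose J := iota L (6 * L).
have J1 j : j \in J -> (L <= j < 7 * L)%N by rewrite mem_iota; lia.
pose reps := map f J.
have injf : {in J &, injective f}.
  move=> j j' /J1 /andP[j1 _] /J1 /andP[j1' _] E.
  have [_ /andP[a b]] := fP j (leq_trans L1 j1).
  have [_ /andP[a' b']] := fP j' (leq_trans L1 j1').
  by rewrite E in a b; nia.
have ureps : uniq reps by rewrite map_inj_in_uniq // iota_uniq.
have repsP i : i \in reps -> good i /\ (k * L < i <= 7 * (k * L))%N.
  move=> /mapP[j /J1 /andP[j1 j2] ->]; have [g /andP[a b]] := fP j (leq_trans L1 j1).
  split=> //; apply/andP; split; nia.
suff [b hb] : exists b : bool, (3 * L <= count (fun i => odd (i %/ m) == b) reps)%N.
  pose M := [seq i <- reps | odd (i %/ m) == b].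
  have MP i : i \in M -> good i /\ (k * L < i <= 7 * (k * L))%N.
    by rewrite mem_filter => /andP[_ /repsP].
  exists M; split.
  - apply: (@uniq_pair_seq _ _ b) => //; first exact: filter_uniq.
    by move=> i; rewrite mem_filter => /andP[/eqP].
  - move=> x; rewrite (perm_mem (perm_pair_seq m M)) mem_cat => /orP[/MP[_ h]|]; first by lia.
    by move=> /mapP[i /MP[_ h] ->]; lia.
  - by move=> i /MP[g h]; split=> //; lia.
  - by rewrite size_filter.
have := count_predC (fun i => odd (i %/ m)) reps.
rewrite size_map size_iota => E.
have [h|h] := leqP (3 * L) (count (fun i => odd (i %/ m)) reps).
  by exists true; apply: leq_trans h _; apply: sub_count => i /= ->.
exists false; apply: leq_trans (_ : count (predC (fun i => odd (i %/ m))) reps <= _)%N; first by lia.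
by apply: sub_count => i /= /negbTE ->.
Qed.

End windows.

(** * Convergence and rates *)

Lemma dW_ge0 (R : realType) (mu nu : probability (measurableTypeR R) R) : (0 <= dW mu nu)%E.
Proof.
apply: ereal_sup_ubound; exists (cst 0); last by rewrite !integral0 subee // abse0.
by move=> [x y] _ /=; rewrite subrr normr0 mul1r.
Qed.

Lemma cvg_powR0 (R : realType) (u : R^nat) (p : R) : 0 < p -> (forall n, 0 <= u n) ->
  u @ \oo --> 0 -> (fun n => u n `^ p) @ \oo --> 0.
Proof.
move=> p0 u0 cu; apply/cvgr0Pnorm_le => e e0.
have e1 : 0 < e `^ p^-1 by rewrite powR_gt0.
move/cvgr0Pnorm_le : cu => /(_ _ e1); apply: filterS => n.
rewrite !ger0_norm ?powR_ge0 // => un.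
apply: (@le_trans _ _ ((e `^ p^-1) `^ p)).
  by apply: ge0_ler_powR; rewrite ?nnegrE ?(ltW p0) ?(ltW e1).
by rewrite -powRrM mulVf ?gt_eqF // powRr1 // ltW.
Qed.

Section power_rates.
Context (R : realType).
Implicit Types (n i : nat) (g : R).

Lemma sum_sqrtV_le n : \sum_(1 <= i < n.+1) (Num.sqrt i%:R : R)^-1 <= 2 * Num.sqrt n%:R.
Proof.
elim: n => [|n IH]; first by rewrite big_geq // mulr_ge0.
rewrite big_nat_recr //=; apply: le_trans (lerD IH (lexx _)) _.
set s : R := Num.sqrt n%:R; set t : R := Num.sqrt n.+1%:R.
have t0 : 0 < t by rewrite sqrtr_gt0 ltr0n.
have s0 : 0 <= s by exact: sqrtr_ge0.
have ss : s ^+ 2 = n%:R by rewrite sqr_sqrtr.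
have tt : t ^+ 2 = s ^+ 2 + 1 by rewrite ss sqr_sqrtr // natr1.
rewrite -lerBrDl -[t^-1]mul1r ler_pdivrMr //.
move: tt s0 t0; clear; nra.
Qed.

Lemma invr_powR (x g : R) : 0 <= x -> x^-1 `^ g = x `^ (- g).
Proof. by move=> x0; rewrite -powR_inv1 // -powRrM mulN1r. Qed.

Lemma sum_powRN_le g n : 0 <= g <= 2^-1 -> (1 <= n)%N ->
  n%:R^-1 * \sum_(1 <= i < n.+1) i%:R `^ (- g) <= 2 * n%:R `^ (- g).
Proof.
move=> /andP[g0 g1] n1; have n0 : 0 < n%:R :> R by rewrite ltr0n.
have sn : 0 < Num.sqrt n%:R :> R by rewrite sqrtr_gt0.
(* [(n / i) ^ g <= (n / i) ^ (1 / 2)] since [i <= n] *)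
have H i : (1 <= i < n.+1)%N ->
    i%:R `^ (- g) <= n%:R `^ (- g) * Num.sqrt n%:R * (Num.sqrt i%:R)^-1.
  move=> /andP[i1 iln]; have i0 : 0 < i%:R :> R by rewrite ltr0n.
  have ni : 1 <= n%:R / i%:R :> R by rewrite ler_pdivlMr // mul1r ler_nat.
  have := ler_powR ni g1.
  rewrite powR12_sqrt ?divr_ge0 // powRM ?invr_ge0 // invr_powR // sqrtrM // sqrtrV //.
  rewrite -mulrA => h; apply: le_trans (_ : n%:R `^ (- g) * (n%:R `^ g * i%:R `^ (- g)) <= _).
    by rewrite mulrA [n%:R `^ (- g)]powRN mulVf ?mul1r // gt_eqF // powR_gt0.
  by rewrite ler_wpM2l // powR_ge0.
have {}H : \sum_(1 <= i < n.+1) i%:R `^ (- g) <=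
    \sum_(1 <= i < n.+1) n%:R `^ (- g) * Num.sqrt n%:R * (Num.sqrt i%:R)^-1.
  by apply: ler_sum_nat => i; exact: H.
rewrite -mulr_sumr in H; have := sum_sqrtV_le n; set S := \sum_(_ <= _ < _) _ => S2.
rewrite mulrC ler_pdivrMr //; apply: (le_trans H).
apply: (@le_trans _ _ (n%:R `^ (- g) * Num.sqrt n%:R * (2 * Num.sqrt n%:R))).
  by rewrite ler_wpM2l // mulr_ge0 ?powR_ge0 ?ltW.
have sq : Num.sqrt n%:R * Num.sqrt n%:R = n%:R :> R by rewrite -expr2 sqr_sqrtr.
by rewrite -[X in _ <= _ * X]sq le_eqVlt; apply/orP; left; apply/eqP; ring.
Qed.

(** The finitely many indices before the asymptotic bound sets in are absorbed by the finite sum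
    [S]. *)
Lemma eqO_powRN_le (f : nat -> R) g : f =O_\oo (fun n => n%:R `^ (- g) : R^o) ->
  exists2 C, 0 <= C & forall n, (1 <= n)%N -> f n <= C * n%:R `^ (- g).
Proof.
move=> /eqO_exP[k k0 [N _ HN]].
pose S := \sum_(0 <= i < N) `|f i| * i%:R `^ g.
have S0 : 0 <= S by apply: sumr_ge0 => i _; rewrite mulr_ge0 // powR_ge0.
exists (k + S) => [|n n1]; first by rewrite addr_ge0 // ltW.
have n0 : 0 < n%:R :> R by rewrite ltr0n.
have [nN|Nn] := ltnP n N; last first.
  apply: le_trans (ler_norm _) _; apply: le_trans (HN n Nn) _ => /=.
  by rewrite ger0_norm ?powR_ge0 // ler_wpM2r ?powR_ge0 // lerDl.
apply: le_trans (ler_norm _) _.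
have -> : `|f n| = `|f n| * n%:R `^ g * n%:R `^ (- g).
  by rewrite powRN mulfK // gt_eqF // powR_gt0.
rewrite ler_wpM2r ?powR_ge0 //; apply: le_trans (_ : S <= _); last by rewrite lerDr ltW.
rewrite /S (bigD1_seq n) ?iota_uniq ?mem_index_iota //= lerDl.
by apply: sumr_ge0 => i _; rewrite mulr_ge0 // powR_ge0.
Qed.

End power_rates.

Section rates.
Context d (T : measurableType d) (R : realType) (P : probability T R).
Variables (r : nat -> nat) (Z : nat -> nat -> {RV P >-> nat}).
Hypothesis r_pos : forall i : nat, (1 <= i)%N -> (1 <= r i)%N.
Hypothesis Z_indep : mutually_independent (index_set r) (fun p : nat * nat => Z p.1 p.2).
Hypothesis Z_ident : forall i j : nat, (1 <= i)%N -> (1 <= j <= r i)%N ->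
  forall A : set nat, measurable A ->
  distribution P (Z i j) A = distribution P (Z i 1%N) A.
Hypothesis theta_fin :
  (ereal_sup [set theta_bar r Z i | i in [set i | (1 <= i)%N]] < +oo)%E.

(** The term k = 1 of [mu i0] already contains the supremum over all indices from [i0] on. *)
Lemma eps1_ge i0 i : is_i0 r Z i0 -> (i0 <= i)%N -> - 2^-1 <= eps r Z i 1.
Proof.
move=> [i01 mu0 _] i0i.
have pos k : (0 <= k%:R%:E * ereal_sup [set `|eps r Z j k|%:E | j in [set j | (i0 <= j)%N]])%E.
  rewrite mule_ge0 ?lee_fin //; apply: (@le_trans _ _ `|eps r Z i0 k|%:E); first by rewrite lee_fin.
  by apply: ereal_sup_ubound; exists i0 => /=.
have H : (`|eps r Z i 1|%:E <= (2^-1)%:E)%E.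
  apply: le_trans mu0; rewrite /mu.
  apply: le_trans (@nneseries_lim_ge _ _ _ 1 2 _); last by move=> k _ _; exact: pos.
  by rewrite big_nat1 mul1e; apply: ereal_sup_ubound; exists i.
by move: H; rewrite lee_fin ler_norml => /andP[].
Qed.

Section scale_walk.
Variables (u v k : nat) (psi : R) (i0 : nat).
Hypotheses (u_gt0 : (0 < u)%N) (v_gt0 : (0 < v)%N) (uv : coprime u v).
Hypotheses (k_gt0 : (0 < k)%N) (psi_gt0 : 0 < psi) (i0P : is_i0 r Z i0).
Hypothesis blocks : forall e j : nat, scales u v e -> (1 <= j)%N ->
  Eprime r Z i0 e psi `&` [set i | (j * k + 1 <= i <= j.+1 * k)%N] !=set0.

Let ts : R := theta_star r Z 0.

Lemma mix_theta_le i : theta_ r Z i <= ts. Proof. exact: (theta_le_star theta_fin). Qed.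

Lemma mix_scale_gt0 m : scales u v m -> (0 < m)%N.
Proof. by case=> [->//|[g _ <-]]; rewrite muln_gt0 v_gt0 expn_gt0. Qed.

(** Twice the 3L pairs of a window times the exchange weight psi / (16 k L). The product does not
    depend on L, so all windows are equally efficient. *)
Let rate : R := 3 * psi / (8 * k%:R).

Lemma rate_gt0 : 0 < rate.
Proof. by rewrite /rate divr_gt0 ?mulr_gt0 ?ltr0n. Qed.

Lemma window_pairs m L : scales u v m -> (1 <= L)%N -> (m <= k * L)%N ->
  (i0 <= k * L)%N -> 2 * ts <= (k * L)%:R ->
  exists (M : seq nat) (q : R), [/\ uniq (pair_seq m M),
    {in pair_seq m M, forall x, k * L < x <= 8 * (k * L)}%N,
    all (atoms_ge r Z m q) M, 0 < q & 2 * q <= 1 /\ rate <= (size M)%:R * (2 * q)].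
Proof.
move=> sm L1 mL i0L tL.
have m0 := mix_scale_gt0 sm.
pose good i := (i0 <= i)%N /\ 4 * psi <= Num.min (theta_ r Z i) (theta_ r Z (i + m)%N).
have gb j : (1 <= j)%N -> exists i, good i /\ (j * k + 1 <= i <= j.+1 * k)%N.
  by move=> j1; have [i [g jk]] := blocks sm j1; exists i.
have [M [uM sM gM szM]] := exists_window_pairs k_gt0 gb L1 m0 mL.
have kL0 : 0 < (k * L)%:R :> R by rewrite ltr0n muln_gt0 k_gt0.
pose q := psi / (16 * (k * L)%:R); exists M, q.
have q0 : 0 < q by rewrite divr_gt0 // mulr_gt0.
have psiL : psi <= (k * L)%:R / 8.
  have [i [[_ +] _]] := gb 1%N isT; rewrite le_min => /andP[h _].
  by have := le_trans h (mix_theta_le i); lra.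
split=> //.
- apply/allP => i /gM[[i0i +] [Li iL]]; rewrite le_min => /andP[t1 t2].
  have i1 : (1 <= i)%N by exact: leq_ltn_trans Li.
  have LiR : (k * L)%:R <= i%:R :> R by rewrite ler_nat ltnW.
  have th2 j : 2 * theta_ r Z j <= i%:R.
    by apply: le_trans LiR; apply: le_trans tL; rewrite ler_pM2l // mix_theta_le.
  have [A1 A2] := atom_pair_ge r_pos Z_indep Z_ident theta_fin i1 m0 psi_gt0 (th2 _) (th2 _)
    t1 t2 (eps1_ge i0P i0i) (eps1_ge i0P (leq_trans i0i (leq_addr m i))).
  have qle : q <= psi / (2 * (i + m)%:R).
    rewrite /q ler_pM2l // lef_pV2 ?posrE ?mulr_gt0 ?ltr0n ?addn_gt0 ?i1 ?muln_gt0 ?k_gt0 ?L1 //.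
    apply: le_trans (_ : 2 * (8 * (k * L))%N%:R <= _); first by rewrite ler_pM2l // ler_nat.
    by rewrite natrM mulrA -natrM.
  by rewrite /atoms_ge (le_trans qle A1) (le_trans qle A2).
- split.
    rewrite /q mulrA ler_pdivrMr ?mulr_gt0 // mul1r; lra.
  have -> : rate = (3 * L)%:R * (2 * q).
    rewrite /rate /q !natrM; field.
    by rewrite !pnatr_eq0 -!lt0n k_gt0 L1.
  by rewrite ler_wpM2r ?ler_nat // mulr_ge0 // ltW.
Qed.

(** The factors gained in one window by the doubling step and by the walk: the powers in
    [shift_bound_double] and [shift_bound_potential] are bounded through (1 - y)^M <= 1/(1 + M
    y). *)
Let lamv : R := 2^-1 + 2^-1 / (1 + rate).
Let lamu : R := (1 + rate / v%:R ^+ 2)^-1.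

Lemma pow_le_rate (y c : R) M : 0 <= y <= 1 -> 0 < c -> c <= M%:R * y ->
  (1 - y) ^+ M <= (1 + c)^-1.
Proof.
move=> y01 c0 cM; rewrite -[leRHS]mul1r ler_pdivlMr ?addr_gt0 //.
apply: le_trans (bernoulli_le M y01); rewrite ler_wpM2l ?lerD2l //.
by rewrite exprn_ge0 // subr_ge0; case/andP: y01.
Qed.

Lemma admissible_window M m L E : (1 <= L)%N -> uniq (pair_seq m M) ->
  {in pair_seq m M, forall x, L < x <= 8 * L}%N -> (8 * L <= E)%N ->
  admissible (pair_seq m M ++ index_iota (8 * L).+1 E.+1) /\
  {subset pair_seq m M ++ index_iota (8 * L).+1 E.+1 <= index_iota L.+1 E.+1}.
Proof.
move=> L1 uM sM LE; split; last first.
  move=> x; rewrite mem_cat mem_index_iota => /orP[/sM|]; rewrite mem_index_iota; lia.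
rewrite /admissible cat_uniq uM iota_uniq andbT /=; apply/andP; split.
  apply/hasPn => x; rewrite mem_index_iota => /andP[h _].
  by apply/negP => /sM /andP[_ h2]; move: h; rewrite ltnNge h2.
apply/allP => x; rewrite mem_cat mem_index_iota => /orP[/sM|]; lia.
Qed.

Lemma admissible_iota L E : admissible (index_iota L.+1 E.+1).
Proof.
by rewrite /admissible iota_uniq; apply/allP => x; rewrite mem_index_iota; lia.
Qed.

Section one_window.
Variables (L E : nat).
Hypotheses (L_gt0 : (1 <= L)%N) (i0L : (i0 <= k * L)%N) (tL : 2 * ts <= (k * L)%:R).
Hypothesis LE : (8 * (k * L) <= E)%N.
Let kL1 : (1 <= k * L)%N. Proof. by rewrite muln_gt0 k_gt0. Qed.
Let rest := index_iota (8 * (k * L)).+1 E.+1.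

Lemma window_double m x : scales u v m -> (m <= k * L)%N -> 0 <= x ->
  shift_bound r Z rest m x -> shift_bound r Z rest (m%:Z + m%:Z) x ->
  shift_bound r Z (index_iota (k * L).+1 E.+1) m (x * lamv).
Proof.
move=> sm mL x0 H1 H2.
have [M [q [uM sM aM q0 [q1 qM]]]] := window_pairs sm L_gt0 mL i0L tL.
have [adm sub] := admissible_window kL1 uM sM LE.
apply: (shift_bound_sub Z_indep (admissible_iota _ _) _ sub); first by case/andP: adm.
have := shift_bound_double Z_indep adm (mix_scale_gt0 sm) (ltW q0) aM H1 H2.
apply: shift_boundW; rewrite ler_wpM2l // lerD2l ler_pM2l ?invr_gt0 //.
by apply: pow_le_rate; [rewrite mulr_ge0 // ltW|exact: rate_gt0|].
Qed.

Lemma window_potential (eps t : R) : (u <= k * L)%N -> 0 <= eps -> 0 <= t ->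
  (forall e, shift_bound r Z rest e (eps * bpot u v e + 2 * wpot u v e * t)) ->
  forall e, shift_bound r Z (index_iota (k * L).+1 E.+1) e
    (eps * bpot u v e + 2 * wpot u v e * (t * lamu)).
Proof.
move=> uL eps0 t0 H e; have su : scales u v u by left.
have [M [q [uM sM aM q0 [q1 qM]]]] := window_pairs su L_gt0 uL i0L tL.
have [adm sub] := admissible_window kL1 uM sM LE.
apply: (shift_bound_sub Z_indep (admissible_iota _ _) _ sub); first by case/andP: adm.
have v1 : 1 <= v%:R ^+ 2 :> R by rewrite -natrX ler1n expn_gt0 v_gt0.
have v2 : 0 < v%:R ^+ 2 :> R by apply: lt_le_trans v1.
have := shift_bound_potential Z_indep v_gt0 uv u_gt0 adm (ltW q0) aM eps0 t0 (le_trans q1 v1) H e.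
apply: shift_boundW; rewrite lerD2l; apply: ler_wpM2l; first by rewrite mulr_ge0 // wpot_ge0.
apply: ler_wpM2l => //.
apply: pow_le_rate.
- apply/andP; split; first by rewrite divr_ge0 // ?mulr_ge0 // ltW.
  by rewrite ler_pdivrMr // mul1r; exact: le_trans v1.
- by rewrite divr_gt0 // rate_gt0.
- by rewrite mulrA ler_pM2r ?invr_gt0.
Qed.

End one_window.

Lemma lamv_itv : 0 < lamv < 1.
Proof.
have r0 := rate_gt0; have r1 : 0 < 1 + rate by rewrite addr_gt0.
rewrite /lamv addr_gt0 ?divr_gt0 ?invr_gt0 //=.
have : 2^-1 / (1 + rate) < 2^-1 by rewrite ltr_pdivrMr // mulrDr mulr1 ltrDl mulr_gt0 ?invr_gt0.
lra.
Qed.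

Lemma lamu_itv : 0 < lamu < 1.
Proof.
have r0 : 0 < rate / v%:R ^+ 2 by rewrite divr_gt0 ?rate_gt0 // exprn_gt0 // ltr0n.
by rewrite /lamu invr_gt0 addr_gt0 //= invf_lt1 ?addr_gt0 // ltrDl.
Qed.

Section phases.
Variable A : nat.
Hypotheses (A_gt0 : (1 <= A)%N) (i0A : (i0 <= k * A)%N) (tA : 2 * ts <= (k * A)%:R).
Hypotheses (uA : (u <= k * A)%N) (vA : (v <= k * A)%N).

Let lev t := (k * (A * 8 ^ t))%N.

Let levS t : lev t.+1 = (8 * lev t)%N. Proof. by rewrite /lev expnS; ring. Qed.

Let lev_mono t s : (lev t <= lev (t + s))%N.
Proof. by rewrite /lev !leq_mul2l leq_exp2l // leq_addr !orbT. Qed.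

Let lev0 t : (k * A <= lev t)%N.
Proof. by rewrite /lev leq_mul2l leq_pmulr ?expn_gt0 // orbT. Qed.

Let A8_gt0 t : (1 <= A * 8 ^ t)%N. Proof. by rewrite muln_gt0 A_gt0 expn_gt0. Qed.

(* From the shift [v * 2 ^ g] one window leads to [0] or to [v * 2 ^ g.+1] with
   equal probabilities; the latter is handled by the next windows. *)
Lemma phase_double s t g : (g <= t)%N ->
  shift_bound r Z (index_iota (lev t).+1 (lev (t + s)).+1) (v * 2 ^ g)%N (2 * lamv ^+ s).
Proof.
have /andP[l0 l1] := lamv_itv.
elim: s t g => [|s IH] t g gt; first by rewrite expr0 mulr1; exact: shift_bound2.
rewrite exprSr mulrA.
have h : (8 * (k * (A * 8 ^ t)) <= lev (t + s.+1))%N.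
  by rewrite -/(lev t) -levS addnS -addSn lev_mono.
have x0 : 0 <= 2 * lamv ^+ s by rewrite mulr_ge0 // exprn_ge0 // ltW.
apply: window_double => //.
- exact: leq_trans i0A (lev0 t).
- by apply: le_trans tA _; rewrite ler_nat; exact: lev0.
- by right; exists g.
(* The difference v 2^g fits into window t because g <= t and the windows grow by the factor 8,
   faster than the difference doubles. *)
- rewrite mulnA; apply: leq_mul => //.
  apply: (@leq_trans (2 ^ t)); first by rewrite leq_exp2l.
  by case: (t) => // t'; rewrite leq_exp2r.
- by rewrite -/(lev t) -levS addnS -addSn; apply: IH; exact: leqW.
- rewrite -PoszD addnn -mul2n. rewrite [(2 * (v * _))%N]mulnCA -expnS.
  by rewrite -/(lev t) -levS addnS -addSn; apply: IH.
Qed.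

(** A multiple e = z v of v costs |z| times the bound for v, and |z| <= |e| <= bpot e. At other e
    the trivial bound 2 is enough, since wpot >= 1 there. *)
Lemma phase_base N e :
  shift_bound r Z (index_iota (lev N).+1 (lev (N + N)).+1) e
    (2 * lamv ^+ N * bpot u v e + 2 * wpot u v e * 1).
Proof.
have /andP[l0 l1] := lamv_itv.
have x0 : 0 <= 2 * lamv ^+ N by rewrite mulr_ge0 // exprn_ge0 // ltW.
have b0 : `|e|%:~R <= bpot u v e :> R by exact: bpot_ge.
have b1 : 0 <= bpot u v e :> R by apply: le_trans b0; rewrite ler0z.
have [re|re] := eqVneq (residue u v e) 0.
  have /dvdzP[z ez] := residue_eq0 uv re.
  have Hv : shift_bound r Z (index_iota (lev N).+1 (lev (N + N)).+1) v%:Z (2 * lamv ^+ N).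
    by have := @phase_double N N 0%N (leq0n _); rewrite expn0 muln1.
  have := shift_boundMz z Hv; have -> : v%:Z *~ z = e by rewrite ez mulrzz mulrC.
  apply: shift_boundW; rewrite wpot0 // mulr0 mul0r addr0 mulrC ler_wpM2l //.
  apply: le_trans b0; rewrite (_ : _%:R = (absz z)%:Z%:~R) // ler_int abszE ez normrM.
  by rewrite ler_peMr // ger0_norm // lez_nat.
apply: shift_boundW (@shift_bound2 _ _ _ P r Z _ e).
apply: ler_wpDl; first by rewrite mulr_ge0.
by rewrite mulr1 ler_peMr // wpot_ge1.
Qed.

(** Levels below N serve the walk with steps u, levels N to 2N the doubling. The induction runs
    downwards from level N, each window contributing one factor [lamu]. *)
Lemma phase_potential N s t : (t + s = N)%N -> forall e,
  shift_bound r Z (index_iota (lev t).+1 (lev (N + N)).+1) e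
    (2 * lamv ^+ N * bpot u v e + 2 * wpot u v e * lamu ^+ s).
Proof.
have /andP[l0 l1] := lamv_itv; have /andP[m0 m1] := lamu_itv.
elim: s t => [|s IH] t tN e.
  by rewrite expr0; move: tN; rewrite addn0 => ->; exact: phase_base.
rewrite exprSr.
have h : (8 * (k * (A * 8 ^ t)) <= lev (N + N))%N.
  rewrite -/(lev t) -levS; have -> : (N + N = t.+1 + (s + N))%N by lia.
  exact: lev_mono.
apply: window_potential => //.
- exact: leq_trans i0A (lev0 t).
- by apply: le_trans tA _; rewrite ler_nat; exact: lev0.
- exact: leq_trans uA (lev0 t).
- by rewrite mulr_ge0 // exprn_ge0 // ltW.
- by rewrite exprn_ge0 // ltW.
- by rewrite -/(lev t) -levS; apply: IH; rewrite addSnnS.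
Qed.

Let lam : R := Num.max lamv lamu.
Let K : R := 2 * (1 + u%:R * v%:R ^+ 2) + 2 * v%:R ^+ 2.

(** The 2N windows of ratio 8 require the factor 8^(2N) = 64^N. [K] comes from the values of the two
    potentials at e = 1. *)
Lemma D1_window_le a n N : (a <= k * A)%N -> (k * A * 64 ^ N <= n)%N ->
  D1 P (Tsum r Z a n) <= K * lam ^+ N.
Proof.
move=> aA An; apply: D1_le_shift.
have /andP[l0 l1] := lamv_itv; have /andP[m0 m1] := lamu_itv.
have lE : (lev (N + N) <= n)%N.
  have e8 : (8 ^ (N + N) = 64 ^ N)%N by rewrite addnn -mul2n expnM.
  by rewrite /lev e8 mulnA.
have := @phase_potential N N 0%N (add0n N) 1.
move=> /(shift_bound_sub Z_indep (admissible_iota a n) (iota_uniq _ _)) H.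
have {}H := H _; apply: shift_boundW (H _).
  have w := wpot_le u v_gt0 (R := R) 1.
  have lv : lamv ^+ N <= lam ^+ N.
    by apply: lerXn2r; rewrite ?nnegrE ?le_max ?lexx // ?ltW // lt_max l0.
  have lu : lamu ^+ N <= lam ^+ N.
    by apply: lerXn2r; rewrite ?nnegrE ?le_max ?lexx ?orbT // ?ltW // lt_max l0.
  have L0 : 0 <= lam ^+ N by apply: le_trans lv; rewrite exprn_ge0 // ltW.
  have b : bpot u v 1 <= 1 + u%:R * v%:R ^+ 2 :> R.
    by rewrite /bpot normr1 lerD2l ler_wpM2l.
  have b1 : 0 <= bpot u v 1 :> R by rewrite addr_ge0 // mulr_ge0 // wpot_ge0.
  rewrite /K [leRHS]mulrDl; apply: lerD.
    by rewrite mulrAC; apply: ler_pM => //; [rewrite mulr_ge0|rewrite exprn_ge0 // ltW|rewrite ler_wpM2l].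
  by apply: ler_pM => //; [rewrite mulr_ge0 // wpot_ge0|rewrite exprn_ge0 // ltW|rewrite ler_wpM2l].
move=> x; rewrite !mem_index_iota /lev expn0 muln1 => /andP[x1 x2]; apply/andP; split.
  exact: leq_ltn_trans aA x1.
by apply: (leq_trans x2); rewrite ltnS.
Qed.

End phases.

End scale_walk.

Lemma D1_le2 a n : D1 P (Tsum r Z a n) <= 2.
Proof. by apply: D1_le_shift => //; exact: shift_bound2. Qed.

Lemma D1_geometric : QLC_blocks r Z -> exists (lam K : R) (C : nat),
  [/\ 0 < lam < 1, 0 <= K, (1 <= C)%N &
    forall a n N, (C * a.+1 * 64 ^ N <= n)%N -> D1 P (Tsum r Z a n) <= K * lam ^+ N].
Proof.
move=> [u [v [k [psi [i0 [[u0 v0 uv] k0 psi0 i0P blocks]]]]]].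
set ts := theta_star r Z 0.
have ts0 : 0 <= 2 * ts by rewrite mulr_ge0 // (le_trans ler01) // theta_star_ge1.
pose C0 := (i0 + u + v + Num.bound (2 * ts))%N.
have C01 : (1 <= C0)%N by rewrite /C0; move: u0; lia.
pose lam : R := Num.max (2^-1 + 2^-1 / (1 + 3 * psi / (8 * k%:R)))
   (1 + 3 * psi / (8 * k%:R) / v%:R ^+ 2)^-1.
pose K : R := 2 * (1 + u%:R * v%:R ^+ 2) + 2 * v%:R ^+ 2.
exists lam, K, (k * C0.+1)%N; split.
- have /andP[l0 l1] := lamv_itv k0 psi0.
  have /andP[m0 m1] := lamu_itv v0 k0 psi0.
  by rewrite /lam lt_max l0 gt_max l1.
- by rewrite /K addr_ge0 // mulr_ge0 // ?exprn_ge0 // addr_ge0 // mulr_ge0 // exprn_ge0.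
- by rewrite muln_gt0 k0.
move=> a n N H.
have kA x : (x <= C0)%N -> (x <= k * (a + C0))%N.
  by move=> xC; rewrite (leq_trans xC) // (leq_trans (leq_addl a _)) // leq_pmull.
apply: (D1_window_le u0 v0 uv k0 psi0 i0P blocks (A := (a + C0)%N)).
- by rewrite addn_gt0 C01 orbT.
- by apply: kA; rewrite /C0; lia.
- apply: (@le_trans _ _ (Num.bound (2 * ts))%:R); first by rewrite ltW // archi_boundP.
  by rewrite ler_nat; apply: kA; rewrite /C0; lia.
- by apply: kA; rewrite /C0; lia.
- by apply: kA; rewrite /C0; lia.
- by rewrite (leq_trans (leq_addr C0 a)) // leq_pmull.
(* With A = a + C0 one has a + C0 <= (C0 + 1) (a + 1); this is the reason for [C0.+1] in the
   constant and for a + 1 in place of a. *)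
apply: leq_trans H; rewrite leq_mul2r -mulnA leq_mul2l; apply/orP; right; apply/orP; right.
by move: C01; nia.
Qed.

(** [eta] is chosen with 64^(-eta) = lam. For the largest N with C (a + 1) 64^N <= n, the failure of
    the inequality at N + 1 bounds lam^(N+1) by a power of (a + 1) / n. When no N exists this power,
    with its constant, exceeds the trivial bound 2. *)
Lemma D1_power : QLC_blocks r Z -> exists eta C : R, [/\ 0 < eta, 0 <= C &
  forall a n, (a < n)%N -> D1 P (Tsum r Z a n) <= C * (a.+1%:R / n%:R) `^ eta].
Proof.
move=> /D1_geometric [lam [K [C [/andP[l0 l1] K0 C1 H]]]].
pose b : R := 64^-1.
have b0 : 0 < b by rewrite invr_gt0.
have lnb : ln b < 0 by rewrite ln_lt0 // b0 invf_lt1 // ltr1n.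
have lnl : ln lam < 0 by rewrite ln_lt0 // l0.
pose eta := ln lam / ln b; exists eta, ((K / lam + 2) * C%:R `^ eta).
have eta0 : 0 < eta by rewrite /eta nmulr_rgt0 // invr_lt0.
have c0 : 0 <= K / lam + 2 by rewrite addr_ge0 // divr_ge0 // ltW.
split=> //; first by rewrite mulr_ge0 // powR_ge0.
move=> a n an.
have n0 : 0 < n%:R :> R by rewrite ltr0n (leq_ltn_trans _ an).
pose x : R := C%:R * (a.+1%:R / n%:R).
have x0 : 0 <= x by rewrite mulr_ge0 // divr_ge0 // ltW.
rewrite -mulrA -powRM // ?divr_ge0 ?(ltW n0) // -/x.
have nC (N : nat) : (n < C * a.+1 * 64 ^ N)%N -> lam ^+ N <= x `^ eta.
  move=> h; have -> : lam = b `^ eta.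
    rewrite /powR gt_eqF // /eta divfK ?lnK ?posrE //; exact: ltr0_neq0.
  rewrite -powR_mulrn ?powR_ge0 // powRAC powR_mulrn ?(ltW b0) //.
  apply: ge0_ler_powR; rewrite ?nnegrE ?exprn_ge0 ?(ltW b0) ?(ltW eta0) //.
  rewrite /b exprVn /x mulrA ler_pdivlMr // mulrC ler_pdivrMr ?exprn_gt0 //.
  by rewrite -natrX -!natrM ler_nat ltnW.
have [nlt|nge] := ltnP n (C * a.+1).
  have := nC 0%N; rewrite expn0 muln1 expr0 => /(_ nlt) e1.
  apply: le_trans (D1_le2 a n) _; rewrite -[leLHS]mulr1; apply: ler_pM => //.
  by rewrite lerDr divr_ge0 // ltW.
have Ca0 : (0 < C * a.+1)%N by rewrite muln_gt0 C1.
pose N := trunc_log 64 (n %/ (C * a.+1)).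
have q0 : (0 < n %/ (C * a.+1))%N by rewrite divn_gt0.
have /andP[h1 h2] := trunc_log_bounds (isT : 1 < 64)%N q0.
have HN : D1 P (Tsum r Z a n) <= K * lam ^+ N.
  by apply: H; rewrite mulnC -leq_divRL.
have h3 : lam ^+ N.+1 <= x `^ eta by apply: nC; rewrite mulnC -ltn_divLR.
apply: le_trans HN _.
have -> : K * lam ^+ N = K / lam * lam ^+ N.+1.
  by rewrite exprS mulrA divfK // gt_eqF.
apply: le_trans (_ : K / lam * x `^ eta <= _); first by rewrite ler_wpM2l // divr_ge0 // ltW.
by rewrite ler_wpM2r ?powR_ge0 // lerDl.
Qed.

Lemma sigma_star_cvg : mu r Z i @[i --> \oo] --> 0%E ->
  n%:R^-1 * sigma_star r Z n @[n --> \oo] --> 0.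
Proof.
move=> /fine_cvgP[_ cmu].
pose u (n : nat) : R := Num.max (fine (mu r Z n.+1)) (n.+1 * r n.+1)%N%:R^-1.
have cu : u @ \oo --> 0.
  apply: (@squeeze_cvgr _ _ _ _ (cst 0) (fun n => fine (mu r Z n.+1) + harmonic n)).
  - apply: nearW => n; rewrite /u le_max fine_ge0 ?mu_ge0 //= ge_max.
    rewrite lerDl invr_ge0 ler0n /= ler_wpDl ?fine_ge0 ?mu_ge0 //.
    rewrite lef_pV2 ?posrE ?ltr0n ?muln_gt0 ?r_pos // ler_nat leq_pmulr //.
    exact: r_pos.
  - exact: cvg_cst.
  - rewrite -[X in _ --> X]addr0; apply: cvgD; last exact: cvg_harmonic.
    by move: cmu; rewrite -cvg_shiftS.
rewrite -cvg_shiftS; have := cesaro cu; apply: cvg_trans.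
apply: near_eq_cvg; apply: nearW => n /=.
by rewrite /arithmetic_mean /series /= /sigma_star big_add1.
Qed.

(** Both entries of the maximum are at most a multiple of i^(-g): the first by g <= al, the second
    because 1 / (i r_i) <= 1 / i and g <= 1. The cap 1/2 on g is the one of [sum_powRN_le]. *)
Lemma sigma_star_le (al C g : R) : 0 <= C -> 0 <= g <= 2^-1 -> g <= al ->
  (forall n, (1 <= n)%N -> fine (mu r Z n) <= C * n%:R `^ (- al)) ->
  forall n, (1 <= n)%N -> n%:R^-1 * sigma_star r Z n <= 2 * (C + 1) * n%:R `^ (- g).
Proof.
move=> C0 g01 gal muC n n1.
apply: (@le_trans _ _ ((C + 1) * (n%:R^-1 * \sum_(1 <= i < n.+1) i%:R `^ (- g)))).
  rewrite [leRHS]mulrCA ler_wpM2l ?invr_ge0 // mulr_sumr; apply: ler_sum_nat => i /andP[i1 _].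
  have iR : 1 <= i%:R :> R by rewrite ler1n.
  have ag : i%:R `^ (- al) <= i%:R `^ (- g) :> R by rewrite ler_powR // lerN2.
  have i1g : i%:R^-1 <= i%:R `^ (- g) :> R.
    rewrite -powR_inv1 // ler_powR // lerN2; case/andP: g01 => _ /le_trans; apply.
    by rewrite invf_le1 // ler1n.
  have pg : 0 <= i%:R `^ (- g) :> R by exact: powR_ge0.
  rewrite ge_max; apply/andP; split.
    apply: le_trans (muC i i1) _; rewrite mulrDl mul1r ler_wpDr // ler_wpM2l //.
  apply: (@le_trans _ _ i%:R^-1).
    by rewrite lef_pV2 ?posrE ?ltr0n ?muln_gt0 ?r_pos ?i1 // ler_nat leq_pmulr // r_pos.
  by apply: le_trans i1g _; rewrite mulrDl mul1r lerDr mulr_ge0.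
apply: le_trans (_ : (C + 1) * (2 * n%:R `^ (- g)) <= _).
  by rewrite ler_wpM2l ?addr_ge0 //; exact: sum_powRN_le.
by rewrite le_eqVlt; apply/orP; left; apply/eqP; ring.
Qed.

Hypothesis mu_fin : forall i : nat, (1 <= i)%N -> (mu r Z i < +oo)%E.
Variables (theta : R) (Ptheta : probability (measurableTypeR R) R).
Hypotheses (theta_gt0 : 0 < theta) (Ptheta_dickman : is_dickman theta Ptheta).

(** The block length m is fixed first, so that delta is at most e / 2; every other term of [eps1]
    then tends to 0 with n, as m stays constant. *)
Lemma dW_cvg0 (a : nat -> nat) : QLC r Z theta ->
  (fun n => (a n)%:R : R^o) =o_\oo (fun n => n%:R : R^o) ->
  dW (distribution P (Tscaled r Z (a n) n)) Ptheta @[n --> \oo] --> 0%E.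
Proof.
move=> [cmu cdelta /D1_power[eta [C [eta0 C0 D1P]]]] ao.
have cinv : n%:R^-1 @[n --> \oo] --> (0 : R).
  by rewrite -(cvg_shiftS (fun n : nat => n%:R^-1 : R)); exact: cvg_harmonic.
have ca : (a n)%:R / n%:R @[n --> \oo] --> (0 : R).
  apply/cvgr0Pnorm_le => e e0; have := (eqoP _ _ _).1 ao e e0.
  apply: filterS2 (nbhs_infty_gt 0%N) => n n0 /=.
  by rewrite !ger0_norm ?divr_ge0 // ler_pdivrMr // ltr0n.
have aln : \forall n \near \oo, (a n < n)%N.
  move/cvgr0Pnorm_le : ca => /(_ 2^-1); rewrite invr_gt0 => /(_ (ltr0n _ 2)).
  apply: filterS2 (nbhs_infty_gt 0%N) => n n0.
  rewrite ger0_norm ?divr_ge0 // ler_pdivrMr ?ltr0n // => h.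
  by rewrite -(ltr_nat R) (le_lt_trans h) // gtr_pMl ?ltr0n // invf_lt1 // ltr1n.
have cD : D1 P (Tsum r Z (a n) n) @[n --> \oo] --> 0.
  have cx : (a n).+1%:R / n%:R @[n --> \oo] --> (0 : R).
    rewrite (_ : (fun n => _) = (fun n => (a n)%:R / n%:R + n%:R^-1)); last first.
      by apply/funext => n; rewrite -natr1 mulrDl mul1r.
    by rewrite -[X in _ --> X]addr0; apply: cvgD.
  have cx' : C * ((a n).+1%:R / n%:R) `^ eta @[n --> \oo] --> (0 : R).
    rewrite -[X in _ --> X](mulr0 C); apply: cvgMl_tmp; exact: cvg_powR0.
  apply: (@squeeze_cvgr _ _ _ _ (cst 0) _ _ _ _ (cvg_cst 0) cx').
  by apply: filterS aln => n an; rewrite D1_ge0 D1P.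
apply/fine_cvgP.
have bound e : 0 < e -> \forall n \near \oo,
    (dW (distribution P (Tscaled r Z (a n) n)) Ptheta <= e%:E)%E.
  move=> e0; have e2 : 0 < e / 2 by rewrite divr_gt0.
  have [m [m0 dm]] : exists m, (0 < m)%N /\ delta r Z m theta <= e / 2.
    have [M _ HM] := (cvgr0Pnorm_le _).1 cdelta _ e2.
    exists M.+1; split=> //; apply: le_trans (ler_norm _) _; apply: HM; exact: leqnSn.
  set ts := theta_star r Z theta.
  have cB : n%:R^-1 * (1 + theta) ^+ 2 + (4^-1 * ts * m%:R * D1 P (Tsum r Z (a n) n) +
     (5 * ts ^+ 2 * (n%:R^-1 * sigma_star r Z n) + 2 * m%:R * ts * n%:R^-1 +
      ts * ((a n)%:R / n%:R))) @[n --> \oo] --> 0.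
    rewrite -[X in _ --> X]addr0; apply: cvgD.
      by rewrite -[X in _ --> X](mul0r ((1 + theta) ^+ 2)); apply: cvgMr_tmp.
    rewrite -[X in _ --> X]addr0; apply: cvgD.
      by rewrite -[X in _ --> X](mulr0 (4^-1 * ts * m%:R)); apply: cvgMl_tmp.
    rewrite -[X in _ --> X]addr0; apply: cvgD.
      rewrite -[X in _ --> X]addr0; apply: cvgD.
        rewrite -[X in _ --> X](mulr0 (5 * ts ^+ 2)); apply: cvgMl_tmp.
        exact: sigma_star_cvg.
      by rewrite -[X in _ --> X](mulr0 (2 * m%:R * ts)); apply: cvgMl_tmp.
    by rewrite -[X in _ --> X](mulr0 ts); apply: cvgMl_tmp.
  move/cvgr0Pnorm_le : cB => /(_ _ e2); apply: filterS2 aln => n an h.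
  apply: le_trans (dW_le r_pos Z_indep Z_ident theta_fin mu_fin theta_gt0 Ptheta_dickman an m0) _.
  rewrite lee_fin; have := lerD (le_trans (ler_norm _) h) dm.
  rewrite -splitr; apply: le_trans; rewrite le_eqVlt; apply/orP; left; apply/eqP.
  by rewrite /eps1 -/ts; ring.
split.
  apply: filterS (bound 1 ltr01) => n h; rewrite ge0_fin_numE ?dW_ge0 //.
  exact: le_lt_trans h (ltry _).
apply/cvgr0Pnorm_le => e e0; apply: filterS (bound e e0) => n h /=.
rewrite ger0_norm ?fine_ge0 ?dW_ge0 // -lee_fin fineK //.
by rewrite ge0_fin_numE ?dW_ge0 //; exact: le_lt_trans h (ltry _).
Qed.

Lemma dW_rate : QLC2 r Z theta -> exists eta : R, 0 < eta /\
  exists C : R, forall a n : nat, (a < n)%N ->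
    (dW (distribution P (Tscaled r Z a n)) Ptheta <= (C * (a.+1%:R / n%:R) `^ eta)%:E)%E.
Proof.
move=> [[al al0 muO] [be be0 deltaO]].
move=> /D1_power[et [C1 [et0 C10 D1P]]].
have [Ca Ca0 muC] := eqO_powRN_le muO.
have [Cb Cb0 deltaC] := eqO_powRN_le deltaO.
set ts := theta_star r Z theta.
have ts1 : 1 <= ts by exact: theta_star_ge1.
have ts0 : 0 <= ts by exact: le_trans ts1.
(* With x = (a + 1) / n and m of order x^(-ka), the terms m D1 and m / n are of orders x^(et - ka)
   and x^(1 - ka), both at most x^ka by the halving; delta is of order x^(ka be), and the mean of
   sigma of order n^(-g) <= x^g. [eta] is the least of these exponents. *)
pose g := Num.min al 2^-1; pose ka := Num.min et 1 / 2.
have g0 : 0 < g by rewrite lt_min al0 invr_gt0 ltr0n.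
have ka0 : 0 < ka by rewrite divr_gt0 // lt_min et0 ltr01.
have ka_et : ka <= et - ka.
  by rewrite lerBrDr -splitr ge_min lexx.
have ka_1 : ka <= 1 - ka.
  by rewrite lerBrDr -splitr ge_min lexx orbT.
pose eta := Num.min ka (Num.min (ka * be) g).
have eta0 : 0 < eta by rewrite /eta lt_min ka0 lt_min mulr_gt0.
exists eta; split=> //.
exists ((1 + theta) ^+ 2 + 2^-1 * ts * C1 + Cb + 10 * ts ^+ 2 * (Ca + 1) + 5 * ts) => a n an.
have n1 : (1 <= n)%N by exact: leq_ltn_trans an.
have n0 : 0 < n%:R :> R by rewrite ltr0n.
pose x : R := a.+1%:R / n%:R; rewrite -/x.
have x0 : 0 < x by rewrite divr_gt0.
have x1 : x <= 1 by rewrite ler_pdivrMr // mul1r ler_nat.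
have pw p : eta <= p -> x `^ p <= x `^ eta by apply: ger_powR; rewrite x0.
have nx : n%:R^-1 <= x by rewrite /x ler_peMl ?invr_ge0 // ler1n.
have e_ka : eta <= ka by rewrite ge_min lexx.
have xX : x <= x `^ eta.
  by rewrite -{1}[x]powRr1 ?(ltW x0) //; apply: pw; move: ka_1 e_ka ka0; lra.
(* This [m] balances [m * D1] against [delta m]. *)
pose y := x `^ (- ka); pose m := (Num.truncn y).+1.
have y1 : 1 <= y by rewrite -(powRr0 x); apply: ger_powR; rewrite ?x0 // oppr_le0 ltW.
have yp : 0 < y by exact: lt_le_trans y1.
have y0 := ltW yp.
have my : m%:R <= 2 * y.
  by rewrite /m -natr1 mulr_natl mulr2n lerD // truncn_le.
have ym : y <= m%:R by rewrite ltW // truncnS_gt.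
have yM p : y * x `^ p = x `^ (p - ka).
  by rewrite addrC powRD // (gt_eqF x0) implybT.
apply: le_trans (dW_le r_pos Z_indep Z_ident theta_fin mu_fin theta_gt0 Ptheta_dickman an (isT : 0 < m)%N) _.
rewrite lee_fin.
set X := x `^ eta; have X0 : 0 <= X by exact: powR_ge0.
have t1 : n%:R^-1 * (1 + theta) ^+ 2 <= (1 + theta) ^+ 2 * X.
  by rewrite mulrC ler_wpM2l ?sqr_ge0 // (le_trans nx).
have t2 : m%:R * D1 P (Tsum r Z a n) <= 2 * C1 * X.
  apply: (@le_trans _ _ (2 * y * (C1 * x `^ et))).
    by rewrite ler_pM // ?D1_ge0 // D1P.
  rewrite mulrACA ler_wpM2l ?mulr_ge0 // yM; apply: pw; exact: le_trans ka_et.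
have t3 : delta r Z m theta <= Cb * X.
  apply: le_trans (deltaC m isT) _; rewrite ler_wpM2l //.
  apply: (@le_trans _ _ (y `^ (- be))).
    rewrite !powRN lef_pV2 ?posrE ?powR_gt0 ?ltr0n //.
    by apply: ge0_ler_powR; rewrite ?nnegrE ?(ltW be0).
  by rewrite /y -powRrM mulrNN; apply: pw; rewrite !ge_min lexx orbT.
have t4 : n%:R^-1 * sigma_star r Z n <= 2 * (Ca + 1) * X.
  have g01 : 0 <= g <= 2^-1 by rewrite (ltW g0) ge_min lexx orbT.
  have gal : g <= al by rewrite ge_min lexx.
  apply: le_trans (sigma_star_le Ca0 g01 gal muC n1) _; rewrite ler_wpM2l ?mulr_ge0 ?addr_ge0 //.
  rewrite -invr_powR //; apply: (@le_trans _ _ (x `^ g)).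
    by apply: ge0_ler_powR; rewrite ?nnegrE ?invr_ge0 // ltW.
  by apply: pw; rewrite /eta ge_min [X in _ || X]ge_min lexx !orbT.
have t5 : n%:R^-1 * m%:R <= 2 * X.
  apply: (@le_trans _ _ (x * (2 * y))); first by rewrite ler_pM // invr_ge0.
  rewrite mulrCA ler_wpM2l // mulrC -{1}[x]powRr1 ?(ltW x0) // yM.
  by apply: pw; exact: le_trans ka_1.
have t6 : n%:R^-1 * a%:R <= X.
  apply: le_trans xX; rewrite mulrC /x ler_wpM2r ?invr_ge0 // ler_nat; exact: leqnSn.
have u2 := ler_wpM2l (mulr_ge0 (ler0n R 1) ts0) t2.
have u4 := ler_wpM2l (mulr_ge0 (ler0n R 5) (sqr_ge0 ts)) t4.
have u5 := ler_wpM2l (mulr_ge0 (ler0n R 2) ts0) t5.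
have u6 := ler_wpM2l ts0 t6.
rewrite /eps1 -/ts.
have -> : n%:R^-1 * (1 + theta) ^+ 2 + (4^-1 * ts * m%:R * D1 P (Tsum r Z a n) + delta r Z m theta +
    n%:R^-1 * ts * (5 * ts * sigma_star r Z n + 2 * m%:R + a%:R)) =
  n%:R^-1 * (1 + theta) ^+ 2 + 4^-1 * (1 * ts * (m%:R * D1 P (Tsum r Z a n))) + delta r Z m theta +
  5 * ts ^+ 2 * (n%:R^-1 * sigma_star r Z n) + 2 * ts * (n%:R^-1 * m%:R) +
  ts * (n%:R^-1 * a%:R) by ring.
have -> : ((1 + theta) ^+ 2 + 2^-1 * ts * C1 + Cb + 10 * ts ^+ 2 * (Ca + 1) + 5 * ts) * X =
  (1 + theta) ^+ 2 * X + 4^-1 * (1 * ts * (2 * C1 * X)) + Cb * X +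
  5 * ts ^+ 2 * (2 * (Ca + 1) * X) + 2 * ts * (2 * X) + ts * X by field.
by rewrite !lerD // ler_pM2l ?invr_gt0.
Qed.

End rates.

Theorem theorem3p3 (d : measure_display) (T : measurableType d) (R : realType)
  (P : probability T R) (r : nat -> nat) (Z : nat -> nat -> {RV P >-> nat})
  (theta : R) (Ptheta : probability (measurableTypeR R) R)
  (r_pos : forall i : nat, (1 <= i)%N -> (1 <= r i)%N)
  (Z_indep : mutually_independent (index_set r)
               (fun p : nat * nat => Z p.1 p.2))
  (Z_ident : forall i j : nat, (1 <= i)%N -> (1 <= j <= r i)%N ->
     forall A : set nat, measurable A ->
       distribution P (Z i j) A = distribution P (Z i 1%N) A)
  (theta_fin : (ereal_sup [set theta_bar r Z i | i in [set i | (1 <= i)%N]]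
                  < +oo)%E)
  (mu_fin : forall i : nat, (1 <= i)%N -> (mu r Z i < +oo)%E)
  (theta_gt0 : 0 < theta)
  (Ptheta_dickman : is_dickman theta Ptheta) :
  [/\ forall a n : nat, (a < n)%N ->
        (dW (distribution P (Tscaled r Z a n)) Ptheta <=
         (n%:R^-1 * (1 + theta) ^+ 2 +
          \big[Num.min/eps1 r Z theta n a 1]_(1 <= m < n.+1)
             eps1 r Z theta n a m)%:E)%E,
      QLC r Z theta ->
        forall a : nat -> nat,
          (fun n => (a n)%:R : R^o) =o_\oo (fun n => n%:R : R^o) ->
          dW (distribution P (Tscaled r Z (a n) n)) Ptheta @[n --> \oo] --> 0%E &
      QLC2 r Z theta ->
        exists eta : R, 0 < eta /\
        exists C : R, forall a n : nat, (a < n)%N ->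
          (dW (distribution P (Tscaled r Z a n)) Ptheta <=
           (C * (a.+1%:R / n%:R) `^ eta)%:E)%E].
Proof.
split.
- move=> a n an.
  exact: (dW_le_min r_pos Z_indep Z_ident theta_fin mu_fin theta_gt0 Ptheta_dickman an).
- move=> qlc a ao.
  exact: (dW_cvg0 r_pos Z_indep Z_ident theta_fin mu_fin theta_gt0 Ptheta_dickman qlc ao).
- exact: (dW_rate r_pos Z_indep Z_ident theta_fin mu_fin theta_gt0 Ptheta_dickman).
Qed.
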